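(* Let $K$ be any closed and unbounded trapezoid with base $K_0$ and height $L\in(0,\infty]$. Let $(u_0,v_0)\in L^{1,1}(K_0;M)$ satisfy the compatibility condition $v_0(x)\in T_{u_0(x)}M$ for almost every $x\in K_0$, and let $f\in L^1(K;\mathbb R^n)$. Let $u^1,u^2\in\mathscr H(K)$ be two $M$-valued mild solutions in $K$ of the forced wave map equation with the same forcing $f$ and the same initial data $(u_0,v_0)$. Then $u^1=u^2$.
   Context: Trapezoids: a closed convex set $K\subseteq[0,\infty)\times\mathbb R$ of positive Lebesgue measure is a trapezoid if for every $(t,x)\in K$ the closed triangle with vertices $(t,x),(0,x-t),(0,x+t)$ is contained in $K$. $K_t=\{x:(t,x)\in K\}$; $K_0$ is the base; the height of $K$ is $\infty$ if $\{t:K_t\neq\emptyset\}$ is unbounded and otherwise the maximum of this set. ''Unbounded'' means that $K$ is an unbounded set. $[0,T)]$ denotes $[0,T]$ if $T<\infty$ and $[0,\infty)$ if $T=\infty$. $\mathscr H(K)$ (height $T_0$): all continuous $u:K\to\mathbb R^n$ whose weak derivatives $\partial_tu,\partial_xu$ exist (locally integrable) and belong to $C_b([0,T_0)];L^1(K_\cdot))$, meaning that their extensions by $0$ to $[0,T_0)]\times K_0$ are bounded continuous functions of $t$ with values in $L^1(K_0)$; norm $\|u\|_{\mathscr H(K)}=\sup_K|u|+\sup_t\int_{K_t}(|\partial_xu|+|\partial_tu|)\,dx$. $M\subset\mathbb R^n$ is a compact Riemannian manifold, isometrically embedded in $\mathbb R^n$; $\pi_p:\mathbb R^n\to T_pM$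 is the orthogonal projection. Forced wave map equation: $\partial_t^2u-\partial_x^2u=\sum_{j,k=1}^n\Gamma_{jk}(u)(\partial_tu_j\partial_tu_k-\partial_xu_j\partial_xu_k)+P(u)f$, which is the explicit form of the condition $\partial_t^2u-\partial_x^2u-f\perp T_uM$ for $M$-valued $u$. Here $\Gamma_{jk}:M\to\mathbb R^n$ and $P:M\to\mathcal L(\mathbb R^n)$ are Lipschitz, $P(p)=\pi_p$, and $\sum_{j,k}\Gamma_{jk}(p)a_jb_k=A_p(a,b)$ for $a,b\in T_pM$, where $A_p$ is the second fundamental form of $M\subset\mathbb R^n$ ($A_p(a,a)$ is the normal component of $\gamma''(0)$ for any curve $\gamma$ in $M$ with $\gamma(0)=p$, $\gamma'(0)=a$). $\Gamma_{jk}$ and $P$ are extended to bounded, globally Lipschitz functions on $\mathbb R^n$. For an interval $I$: $\dot W^{1,1}(I;\mathbb R^n)$ is the set of locally absolutely continuous $v:I\to\mathbb R^n$ with $Dv=v'\in L^1(I)$; $L^{1,1}(I;M)=(C(I;M)\cap\dot W^{1,1}(I;\mathbb R^n))\times L^1(I;\mathbb R^n)$, with norm $\|(g,h)\|_{L^{1,1}(I)}=\|g\|_{L^\infty(I)}+\|g'\|_{L^1(I)}+\|h\|_{L^1(I)}$. An $M$-valued mild solution on $K$ with initial data $(u_0,v_0)$ (satisfying the compatibility condition) and forcing $f$ is a continuous $u:K\to M$ such that: the weak derivatives $\partial_tu,\partial_xu$ exist as locally integrable functions; for every time $t$ of $K$, $\partial_tu(t,x)\in T_{u(t,x)}M$ for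 a.e. $x\in K_t$; and for every $(t,x)\in K$ (the double integral being of an integrable function) $$u(t,x)=\tfrac12\big(u_0(x+t)+u_0(x-t)\big)+\tfrac12\int_{x-t}^{x+t}v_0(y)\,dy+\tfrac12\int_0^t\int_{x-t+\tau}^{x+t-\tau}\Big[\sum_{j,k}\Gamma_{jk}(u)(\partial_tu_j\partial_tu_k-\partial_xu_j\partial_xu_k)+P(u)f\Big](\tau,y)\,dy\,d\tau.$$ *)

(* Defs.v *)
From HB Require Import structures.
From mathcomp Require Import all_boot all_order all_algebra.
From mathcomp Require Import all_classical all_reals all_analysis.

Set Implicit Arguments.
Unset Strict Implicit.
Unset Printing Implicit Defensive.

Import Order.TTheory GRing.Theory Num.Theory.
Import numFieldNormedType.Exports.

Local Open Scope classical_set_scope.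
Local Open Scope ring_scope.

(* Points of space-time are pairs [(t, x)], time first; vectors of R^n are row
   vectors, and an n x n matrix [A] acts on them by [v *m A].  The norm that the
   library puts on ['rV_n] is the sup norm; it is only used for topological
   notions, boundedness and Lipschitz continuity, where the choice of norm is
   immaterial.  [enorm] is the Euclidean norm. *)

Definition dot (R : realType) (n : nat) (v w : 'rV[R]_n) : R :=
  \sum_(i < n) v ord0 i * w ord0 i.

Definition enorm (R : realType) (n : nat) (v : 'rV[R]_n) : R :=
  Num.sqrt (dot v v).

Notation area R := (@lebesgue_measure R \x @lebesgue_measure R)%E.

Definition integrable_vec (R : realType) (n : nat) (d : measure_display)
    (T : measurableType d) (mu : set T -> \bar R) (D : set T)
    (g : T -> 'rV[R]_n) : Prop :=
  forall i : 'I_n, mu.-integrable D (fun z => (g z ord0 i)%:E).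

(* On an open subset of a finite-dimensional space, C^k in terms of iterated
   directional derivatives. *)
Fixpoint Ck (R : realType) (V W : normedModType R) (k : nat) (U : set V)
    (f : V -> W) : Prop :=
  (forall x, U x -> {for x, continuous f}) /\
  match k with
  | 0%N => True
  | k'.+1 => forall v : V,
      (forall x, U x -> derivable f x v) /\ Ck k' U (fun x => 'D_v f x)
  end.

Definition smooth (R : realType) (V W : normedModType R) (U : set V)
    (f : V -> W) : Prop :=
  forall k, Ck k U f.

(* [m]-dimensional embedded smooth submanifold without boundary, through charts
   [Phi] of R^n (with inverse [Psi]) flattening [M] to [R^m x 0].  Its
   Riemannian metric is the one induced by R^n. *)
Definition submanifold (R : realType) (n m : nat) (M : set 'rV[R]_n) : Prop :=
  (m <= n)%N /\
  forall p, M p ->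
    exists (U V : set 'rV[R]_n) (Phi Psi : 'rV[R]_n -> 'rV[R]_n),
      [/\ open U /\ U p, open V, smooth U Phi, smooth V Psi &
       [/\ forall x, U x -> V (Phi x) /\ Psi (Phi x) = x,
           forall y, V y -> U (Psi y) /\ Phi (Psi y) = y &
           forall x, U x ->
             (M x <-> forall i : 'I_n, (m <= i)%N -> Phi x ord0 i = 0)]].

Definition curve_through (R : realType) (n : nat) (M : set 'rV[R]_n)
    (p : 'rV[R]_n) (gam : R -> 'rV[R]_n) : Prop :=
  gam 0 = p /\
  exists2 e : R, 0 < e &
    smooth `]- e, e[ gam /\ forall s, s \in `]- e, e[ -> M (gam s).

Definition tangent (R : realType) (n : nat) (M : set 'rV[R]_n)
    (p : 'rV[R]_n) : set 'rV[R]_n :=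
  [set a | exists2 gam, curve_through M p gam & derive1 gam 0 = a].

Definition orthogonal_to (R : realType) (n : nat) (E : set 'rV[R]_n)
    (v : 'rV[R]_n) : Prop :=
  forall w, E w -> dot v w = 0.

Definition orthogonal_projection (R : realType) (n : nat) (E : set 'rV[R]_n)
    (A : 'M[R]_n) : Prop :=
  forall v, E (v *m A) /\ orthogonal_to E (v - v *m A).

(* [A p] is determined by its diagonal, the normal part of the acceleration of
   curves, and by being symmetric and bilinear on the tangent space; nothing is
   required off the tangent space. *)
Definition second_fundamental_form (R : realType) (n : nat) (M : set 'rV[R]_n)
    (A : 'rV[R]_n -> 'rV[R]_n -> 'rV[R]_n -> 'rV[R]_n) : Prop :=
  forall p, M p ->
  [/\ forall a b, tangent M p a -> tangent M p b -> A p a b = A p b a,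
      forall (c : R) a b d,
        tangent M p a -> tangent M p b -> tangent M p d ->
        A p (c *: a + b) d = c *: A p a d + A p b d &
      forall gam, curve_through M p gam ->
        let nu := A p (derive1 gam 0) (derive1 gam 0) in
        orthogonal_to (tangent M p) nu /\
        tangent M p (derive1n 2 gam 0 - nu)].

Definition wave_map_coefficients (R : realType) (n : nat) (M : set 'rV[R]_n)
    (Gamma : 'I_n -> 'I_n -> 'rV[R]_n -> 'rV[R]_n)
    (P : 'rV[R]_n -> 'M[R]_n) : Prop :=
  [/\ forall j k, lipschitz (Gamma j k) /\ [bounded Gamma j k p | p in setT],
      lipschitz P /\ [bounded P p | p in setT],
      second_fundamental_form M (fun p a b =>
        \sum_(j < n) \sum_(k < n) (a ord0 j * b ord0 k) *: Gamma j k p) &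
      forall p, M p -> orthogonal_projection (tangent M p) (P p)].

Definition triangle (R : realType) (a b c : R * R) : set (R * R) :=
  [set z | exists l : R * R * R,
     [/\ 0 <= l.1.1, 0 <= l.1.2, 0 <= l.2, l.1.1 + l.1.2 + l.2 = 1 &
         z = l.1.1 *: a + l.1.2 *: b + l.2 *: c]].

Definition backward_triangle (R : realType) (t x : R) : set (R * R) :=
  triangle (t, x) (0, x - t) (0, x + t).

Definition trapezoid (R : realType) (K : set (R * R)) : Prop :=
  [/\ closed K, convex_set K, (forall z, K z -> 0 <= z.1),
      (0 < area R K)%E &
      forall t x, K (t, x) -> backward_triangle t x `<=` K].

Definition slice (R : realType) (K : set (R * R)) (t : R) : set R :=
  [set x | K (t, x)].

Definition base (R : realType) (K : set (R * R)) : set R := slice K 0.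

(* The supremum is [+oo] when the set of times is unbounded, and its maximum
   when there is one; an unbounded trapezoid such as the region below the graph
   of [x / (1 + x)] over [0, +oo[ has bounded times and no maximum. *)
Definition height (R : realType) (K : set (R * R)) : \bar R :=
  ereal_sup [set t%:E | t in [set t | slice K t !=set0]].

(* [0, T] if T is finite, [0, +oo[ if T = +oo *)
Definition time_range (R : realType) (T : \bar R) : set R :=
  [set t | 0 <= t /\ (t%:E <= T)%E].

Definition test_function (R : realType) (U : set (R * R)) (phi : R * R -> R)
    : Prop :=
  [/\ smooth setT phi, compact (closure [set z | phi z != 0]) &
      closure [set z | phi z != 0] `<=` U].

(* [w] is a locally integrable weak derivative of [u] in direction [e], in the
   interior of [K]. *)
Definition weak_derivative (R : realType) (n : nat) (K : set (R * R))
    (e : R * R) (u w : R * R -> 'rV[R]_n) : Prop :=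
  (forall C, compact C -> C `<=` interior K -> integrable_vec (area R) C w) /\
  forall phi, test_function (interior K) phi -> forall i : 'I_n,
    \int[area R]_(z in interior K) (u z ord0 i * 'D_e phi z) =
    - \int[area R]_(z in interior K) (w z ord0 i * phi z).

(* Membership in C_b([0,T)]; L^1(K_.)).  The restriction [w \_ K] of the library
   extends by the default [point] of the type, hence the explicit [0]. *)
Definition Cb_L1 (R : realType) (n : nat) (K : set (R * R)) (T : \bar R)
    (w : R * R -> 'rV[R]_n) : Prop :=
  let W t x := patch (fun=> 0) K w (t, x) in
  [/\ forall t, time_range T t ->
        integrable_vec (@lebesgue_measure R) (base K) (W t),
      exists B : R, forall t, time_range T t ->
        \int[@lebesgue_measure R]_(x in base K) enorm (W t x) <= B &
      forall s, time_range T s ->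
        (fun t => \int[@lebesgue_measure R]_(x in base K) enorm (W t x - W s x))
          @ within (time_range T) (nbhs s) --> (0 : R)].

(* [u] belongs to H(K), where [T] is the height of [K], and [ut], [ux] are the
   representatives of its weak derivatives that are continuous in time with
   values in L^1; for each [t], these are unique up to a null set of [x]. *)
Definition in_H (R : realType) (n : nat) (K : set (R * R)) (T : \bar R)
    (u ut ux : R * R -> 'rV[R]_n) : Prop :=
  [/\ {within K, continuous u},
      exists B : R, forall z, K z -> enorm (u z) <= B,
      weak_derivative K (1, 0) u ut /\ Cb_L1 K T ut &
      weak_derivative K (0, 1) u ux /\ Cb_L1 K T ux].

Definition absolutely_continuous_on (R : realType) (n : nat) (a b : R)
    (v : R -> 'rV[R]_n) : Prop :=
  forall e : R, 0 < e -> exists2 d : R, 0 < d &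
    forall (N : nat) (l r : 'I_N -> R),
      (forall i, [/\ a <= l i, l i <= r i & r i <= b]) ->
      (forall i j, i != j -> r i <= l j \/ r j <= l i) ->
      \sum_(i < N) (r i - l i) < d ->
      \sum_(i < N) enorm (v (r i) - v (l i)) < e.

Definition homogeneous_W11 (R : realType) (n : nat) (I : set R)
    (v : R -> 'rV[R]_n) : Prop :=
  (forall a b, a <= b -> `[a, b] `<=` I -> absolutely_continuous_on a b v) /\
  exists2 Dv : R -> 'rV[R]_n,
    integrable_vec (@lebesgue_measure R) I Dv &
    {ae @lebesgue_measure R, forall x, I x -> is_derive x 1 v (Dv x)}.

Definition L11 (R : realType) (n : nat) (I : set R) (M : set 'rV[R]_n)
    (g h : R -> 'rV[R]_n) : Prop :=
  [/\ {within I, continuous g}, forall x, I x -> M (g x),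
      homogeneous_W11 I g & integrable_vec (@lebesgue_measure R) I h].

Definition compatible (R : realType) (n : nat) (I : set R) (M : set 'rV[R]_n)
    (u0 v0 : R -> 'rV[R]_n) : Prop :=
  {ae @lebesgue_measure R, forall x, I x -> tangent M (u0 x) (v0 x)}.

Definition wave_map_rhs (R : realType) (n : nat)
    (Gamma : 'I_n -> 'I_n -> 'rV[R]_n -> 'rV[R]_n) (P : 'rV[R]_n -> 'M[R]_n)
    (f u ut ux : R * R -> 'rV[R]_n) (z : R * R) : 'rV[R]_n :=
  \sum_(j < n) \sum_(k < n)
    (ut z ord0 j * ut z ord0 k - ux z ord0 j * ux z ord0 k) *: Gamma j k (u z)
  + f z *m P (u z).

Definition mild_solution (R : realType) (n : nat) (M : set 'rV[R]_n)
    (Gamma : 'I_n -> 'I_n -> 'rV[R]_n -> 'rV[R]_n) (P : 'rV[R]_n -> 'M[R]_n)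
    (K : set (R * R)) (u0 v0 : R -> 'rV[R]_n)
    (f u ut ux : R * R -> 'rV[R]_n) : Prop :=
  let F := wave_map_rhs Gamma P f u ut ux in
  [/\ {within K, continuous u} /\ (forall z, K z -> M (u z)),
      weak_derivative K (1, 0) u ut,
      weak_derivative K (0, 1) u ux,
      forall t, slice K t !=set0 ->
        {ae @lebesgue_measure R, forall x, slice K t x ->
           tangent M (u (t, x)) (ut (t, x))} &
      forall t x, K (t, x) ->
        integrable_vec (area R) (backward_triangle t x) F /\
        forall i : 'I_n,
          u (t, x) ord0 i =
            2^-1 * (u0 (x + t) ord0 i + u0 (x - t) ord0 i)
            + 2^-1 * \int[@lebesgue_measure R]_(y in `[x - t, x + t])
                v0 y ord0 i
            + 2^-1 * \int[@lebesgue_measure R]_(tau in `[0, t])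
                \int[@lebesgue_measure R]_(y in `[x - t + tau, x + t - tau])
                  F (tau, y) ord0 i].

(* Main.v *)
From HB Require Import structures.
Require Import Defs.
From mathcomp Require Import all_boot all_order all_algebra.
From mathcomp Require Import all_classical all_reals all_analysis.
From mathcomp Require Import measurable_realfun ring lra.
Import numFieldNormedType.Exports.

Set Implicit Arguments.
Unset Strict Implicit.
Unset Printing Implicit Defensive.

Import Order.TTheory GRing.Theory Num.Theory.

Local Open Scope classical_set_scope.
Local Open Scope ring_scope.

(** [K] contains the backward triangle of each of its points [(t0, x0)], and the
    mild formulation only involves the solution in that triangle; so the two
    solutions are compared there, and the coordinates are the characteristic ones,
    [xi = x + t] and [eta = x - t].  The triangle becomes [c0 < eta < xi < d0] with
    [c0 = x0 - t0] and [d0 = x0 + t0], and each component [U] of a solution is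
        [U(xi, eta) = al(xi) + be(eta) + 1/4 * (integral of F over eta < y < s < xi)],
    where [F] is the right-hand side of the equation and [al], [be] depend on the
    initial data only ([mild_representation]).

    Put [p = ut + ux] and [q = ut - ux], twice the derivatives of [U] in [xi] and
    [- eta].  Formally [p = 2 al'(xi) + 1/2 * (integral of F(xi, y) over
    eta < y < xi)].  This has two consequences.  First, [p] and [q] are bounded by
    integrable functions [A(xi)] and [B(eta)] of one variable
    ([derivative_along_characteristics], [derivative_bound]).  Second, for the
    difference of two solutions with the same data, [al] drops out and [p1 - p2] is
    half the integral of [F1 - F2] along a characteristic
    ([derivative_of_zero_data]).  Both are obtained from the weak derivatives by
    testing with products [chi1(xi) * chi2(eta)] of cut-off functions
    ([characteristic_solution_p]): the identities hold after integration against
    all these products, and this determines a function almost everywhere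
    ([ae_eq0_of_cutoffs]).  The reflection [x |-> - x] carries the results on [p]
    over to [q].

    The quadratic terms are a null form: the sum over [j, k] of
    [(ut_j ut_k - ux_j ux_k) Gamma_jk] equals that of
    [1/2 (p_j q_k + q_j p_k) Gamma_jk].  As [Gamma] and [P] are bounded and
    Lipschitz, [G = F1 - F2] satisfies
        [|G| <= C (|u1 - u2| (A(xi) B(eta) + |f|) + |p1 - p2| B(eta) + |q1 - q2| A(xi))]
    ([wave_map_rhs_difference]), and the three differences on the right are,
    up to constants, integrals of [G] over the triangle below [(xi, eta)] or over
    one of the characteristics that bound it.  Integrate this over a strip
    [s < xi - eta <= s + r].  If [G] vanishes for [xi - eta <= s] and [r] is so small
    that [A] and [B] have small integrals over segments of length [r], and [f] over
    the strip, the right-hand side is at most half the integral of [|G|] over the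
    strip, so that [G] vanishes up to [s + r]; as [r] does not depend on [s],
    finitely many strips give [G = 0] ([integral_inequality_zero]).  Hence
    [u1 = u2] in the open triangle, and at its apex by continuity. *)

(** * Integrability and Fubini for real-valued functions *)

Section Indicators.
Variable R : realType.

Lemma norm_indic_le1 T (A : set T) (x : T) : `|\1_A x : R| <= 1.
Proof. by rewrite indicE; case: (x \in A); rewrite ?normr1 ?normr0. Qed.

Lemma RintegralE_indic d (T : measurableType d) (m : {measure set T -> \bar R})
    (D : set T) (g : T -> R) :
  \int[m]_(x in D) g x = \int[m]_x (g x * \1_D x).
Proof.
rewrite Rintegral_mkcond; apply: eq_Rintegral => x _.
by rewrite patchE indicE; case: ifP => _; rewrite ?mulr1 ?mulr0.
Qed.

End Indicators.

Section Integrability.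
Context d (T : measurableType d) (R : realType).
Variable mu : {measure set T -> \bar R}.
Implicit Types (f g : T -> R) (D : set T).

Lemma measurable_of_integrable f :
  mu.-integrable setT (EFin \o f) -> measurable_fun setT f.
Proof. by move=> fi; apply/measurable_EFinP; exact: measurable_int fi. Qed.

Lemma integrable_addr f g : mu.-integrable setT (EFin \o f) ->
  mu.-integrable setT (EFin \o g) -> mu.-integrable setT (EFin \o (fun x => f x + g x)).
Proof. by move=> fi gi; exact: (integrableD measurableT fi gi). Qed.

Lemma integrable_subr f g : mu.-integrable setT (EFin \o f) ->
  mu.-integrable setT (EFin \o g) -> mu.-integrable setT (EFin \o (fun x => f x - g x)).
Proof. by move=> fi gi; exact: (integrableB measurableT fi gi). Qed.

Lemma integrable_scaler (c : R) f : mu.-integrable setT (EFin \o f) ->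
  mu.-integrable setT (EFin \o (fun x => c * f x)).
Proof. by move=> fi; exact: (integrableZl measurableT c fi). Qed.

Lemma integrable_sumr (I : finType) (h : I -> T -> R) :
  (forall i, mu.-integrable setT (EFin \o h i)) ->
  mu.-integrable setT (EFin \o (fun x => \sum_i h i x)).
Proof.
move=> hi; rewrite (_ : EFin \o _ = (fun x => \sum_i (h i x)%:E)%E).
  by apply: integrable_sum => // i _; exact: hi.
by apply/funext => x; rewrite /= sumEFin.
Qed.

Lemma integrable_mul_bounded f g (C : R) :
  mu.-integrable setT (EFin \o f) -> measurable_fun setT g ->
  (forall x, `|g x| <= C) -> mu.-integrable setT (EFin \o (fun x => f x * g x)).
Proof.
move=> fi mg gC; have mf := measurable_of_integrable fi.
apply: le_integrable (integrable_scaler C fi) => //.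
  by apply/measurable_EFinP; exact: measurable_funM.
move=> x _ /=; rewrite lee_fin !normrM mulrC ler_wpM2r//.
by apply: (le_trans (gC x)); rewrite ler_norm.
Qed.

Lemma integrable_mul_indic f D : mu.-integrable setT (EFin \o f) -> measurable D ->
  mu.-integrable setT (EFin \o (fun x => f x * \1_D x)).
Proof.
move=> fi mD; apply: (@integrable_mul_bounded _ _ 1) => //.
by move=> x; exact: norm_indic_le1.
Qed.

Lemma integrable_extend f D : measurable D -> mu.-integrable D (EFin \o f) ->
  mu.-integrable setT (EFin \o (fun x => f x * \1_D x)).
Proof.
move=> mD fi; rewrite (_ : EFin \o _ = (EFin \o f) \_ D).
  by apply/integrable_restrict => //; rewrite setTI.
by apply/funext => x; rewrite patchE /= indicE; case: ifP; rewrite ?mulr1 ?mulr0.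
Qed.

Lemma integrable_bounded_support (g : T -> R) (C : R) (D : set T) :
  measurable D -> (mu D < +oo)%E -> measurable_fun setT g ->
  (forall x, `|g x| <= C) -> (forall x, ~ D x -> g x = 0) ->
  mu.-integrable setT (EFin \o g).
Proof.
move=> mD Dfin mg gC g0.
have gE : EFin \o g = (EFin \o g) \_ D.
  apply/funext => x; rewrite patchE; case: ifPn => //.
  by rewrite notin_setE => /g0 /= ->.
rewrite gE; apply/(integrable_mkcond _ mD).
apply: measurable_bounded_integrable => //; first exact: measurable_funTS.
by exists C; split; [exact: num_real|move=> M /ltW CM x _; apply: le_trans CM].
Qed.

End Integrability.

Section RealFubini.
Context d1 d2 (T1 : measurableType d1) (T2 : measurableType d2) (R : realType).
Variable m1 : {sigma_finite_measure set T1 -> \bar R}.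
Variable m2 : {sigma_finite_measure set T2 -> \bar R}.
Variable f : T1 * T2 -> R.
Hypothesis intf : (m1 \x m2)%E.-integrable setT (EFin \o f).

Let fubini_F_ae : ae_eq m1 setT (fubini_F m2 (EFin \o f))
  (fun x => (\int[m2]_y f (x, y))%:E).
Proof.
have := ae_integrable1 intf; apply: filterS => x ix _.
by rewrite /Rintegral fineK// integrable_fin_num.
Qed.

Let fubini_G_ae : ae_eq m2 setT (fubini_G m1 (EFin \o f))
  (fun y => (\int[m1]_x f (x, y))%:E).
Proof.
have := ae_integrable2 intf; apply: filterS => y iy _.
by rewrite /Rintegral fineK// integrable_fin_num.
Qed.

Lemma integrable_Rintegral_snd :
  m1.-integrable setT (EFin \o fun x => \int[m2]_y f (x, y)).
Proof.
have mF : measurable_fun setT (fun x => \int[m2]_y f (x, y)).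
  by apply: (@measurableT_comp _ _ _ _ _ _ fine) => //; exact: measurable_fubini_F intf.
have iF := integrable_fubini_F intf.
apply/integrableP; split; first exact/measurable_EFinP.
move/integrableP : (iF) => [mF' ]; apply: le_lt_trans.
rewrite le_eqVlt; apply/orP; left; apply/eqP.
apply: ae_eq_integral => //; do ?[exact: measurableT_comp|by apply/measurable_EFinP; exact: measurableT_comp].
apply: filterS fubini_F_ae => x /(_ I) -> //.
Qed.

Lemma integrable_Rintegral_fst :
  m2.-integrable setT (EFin \o fun y => \int[m1]_x f (x, y)).
Proof.
have mF : measurable_fun setT (fun y => \int[m1]_x f (x, y)).
  by apply: (@measurableT_comp _ _ _ _ _ _ fine) => //; exact: measurable_fubini_G intf.
have mf : measurable_fun setT f.
  exact: measurable_of_integrable intf.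
have mG : measurable_fun setT (fun y => \int[m1]_x `|(f (x, y))%:E|)%E.
  apply: (measurable_fun_fubini_tonelli_G (fun z => `|(f z)%:E|)%E) => //.
  by apply/measurable_EFinP; exact: measurableT_comp.
apply/integrableP; split; first exact/measurable_EFinP.
apply: le_lt_trans ((integrable21ltyP m1 m2 (measurable_int _ intf)).1 intf).
apply: ge0_le_integral => //.
  by apply/measurable_EFinP; exact: measurableT_comp.
move=> y _; apply: le_trans (_ : `|\int[m1]_x (f (x, y))%:E| <= _)%E.
  by rewrite /= /Rintegral; case: (integral _ _ _) => [r||] //=; rewrite ?normr0 ?leey.
apply: le_abse_integral => //; apply/measurable_EFinP.
exact: measurableT_comp.
Qed.

Lemma Rfubini12 : \int[(m1 \x m2)%E]_z f z = \int[m1]_x \int[m2]_y f (x, y).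
Proof.
congr fine; rewrite -integral12_prod_meas1//.
apply: ae_eq_integral => //.
- exact: measurable_int (integrable_fubini_F intf).
- exact: measurable_int integrable_Rintegral_snd.
Qed.

Lemma Rfubini21 : \int[(m1 \x m2)%E]_z f z = \int[m2]_y \int[m1]_x f (x, y).
Proof.
congr fine; rewrite -integral21_prod_meas1//.
apply: ae_eq_integral => //.
- exact: measurable_fubini_G intf.
- exact: measurable_int integrable_Rintegral_fst.
Qed.

End RealFubini.

Section Tensor.
Context d1 d2 (T1 : measurableType d1) (T2 : measurableType d2) (R : realType).
Variable m1 : {sigma_finite_measure set T1 -> \bar R}.
Variable m2 : {sigma_finite_measure set T2 -> \bar R}.
Variables (f : T1 -> R) (g : T2 -> R).
Hypotheses (fi : m1.-integrable setT (EFin \o f))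
  (gi : m2.-integrable setT (EFin \o g)).

Lemma integrable_tensor :
  (m1 \x m2)%E.-integrable setT (EFin \o (fun z => f z.1 * g z.2)).
Proof.
have mf : measurable_fun setT f by exact: measurable_of_integrable fi.
have mg : measurable_fun setT g by exact: measurable_of_integrable gi.
have mfg : measurable_fun setT (EFin \o (fun z : T1 * T2 => f z.1 * g z.2)).
  by apply/measurable_EFinP; apply: measurable_funM; exact: measurableT_comp.
apply/(integrable12ltyP m1 m2 mfg).
under eq_integral => x _.
  under eq_integral => y _ do rewrite /= normrM EFinM.
  rewrite ge0_integralZl//; last by do 2 apply: measurableT_comp => //.
  over.
move/integrableP : fi => [_ fy]; move/integrableP : gi => [_ gy].
rewrite ge0_integralZr//; last 2 first.
  by do 2 apply: measurableT_comp => //.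
  exact: integral_ge0.
by apply: lte_mul_pinfty => //; [exact: integral_ge0|rewrite ge0_fin_numE//; exact: integral_ge0].
Qed.

Lemma Rintegral_tensor :
  \int[(m1 \x m2)%E]_z (f z.1 * g z.2) =
  (\int[m1]_x f x) * \int[m2]_y g y.
Proof.
rewrite (Rfubini12 integrable_tensor) /=.
under eq_Rintegral => x _ do rewrite RintegralZl//.
by rewrite RintegralZr.
Qed.

End Tensor.

Section ScaledImage.
Context d1 d2 (X : measurableType d1) (Y : measurableType d2) (R : realType).
Variables (phi : X -> Y) (mphi : measurable_fun setT phi).
Variables (mu : {measure set X -> \bar R}) (k : {nonneg R}).

(** A change of variables with constant Jacobian only has to be checked on the
    measure of sets; the statements about integrals follow through this image
    measure. *)
Definition scaled_image : {measure set Y -> \bar R}.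
Proof. by refine (mscale k (pushforward mu phi)). Defined.

Lemma scaled_imageE A : scaled_image A = (k%:num%:E * mu (phi @^-1` A))%E.
Proof. by []. Qed.

Lemma ge0_integral_scaled_image (nu : {measure set Y -> \bar R}) (f : Y -> \bar R) :
  (forall A, measurable A -> nu A = k%:num%:E * mu (phi @^-1` A))%E ->
  measurable_fun setT f -> (forall y, 0 <= f y)%E ->
  (\int[nu]_y f y = k%:num%:E * \int[mu]_x f (phi x))%E.
Proof.
move=> nuE mf f0.
rewrite (eq_measure_integral scaled_image) => [|A mA _]; last exact: nuE.
rewrite ge0_integral_mscale//; congr (_ * _)%E.
by rewrite (ge0_integral_pushforward mphi)// preimage_setT.
Qed.

Hypothesis k_gt0 : 0 < k%:num.
Variables (nu : {measure set Y -> \bar R}) (f : Y -> R).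
Hypothesis nuE : (forall A, measurable A -> nu A = k%:num%:E * mu (phi @^-1` A))%E.
Hypothesis fi : nu.-integrable setT (EFin \o f).

Lemma integrable_scaled_image : mu.-integrable setT (EFin \o (f \o phi)).
Proof.
move/integrableP : fi => [/measurable_EFinP mf fy]; apply/integrableP; split.
  by apply/measurable_EFinP; exact: measurableT_comp mphi.
move: fy; rewrite (ge0_integral_scaled_image (f := fun y => `|(f y)%:E|%E) nuE)//; last first.
  by apply: measurableT_comp => //; exact/measurable_EFinP.
have : (0 <= \int[mu]_x `|(f (phi x))%:E|)%E by exact: integral_ge0.
case: (integral _ _ _) => [r||] //= _; rewrite ?ltry//.
by rewrite mulry gtr0_sg// mul1e.
Qed.

Lemma Rintegral_scaled_image :
  \int[nu]_y f y = k%:num * \int[mu]_x f (phi x).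
Proof.
have mf : measurable_fun setT f.
  exact: measurable_of_integrable fi.
have gp := integrable_pos_fin_num measurableT integrable_scaled_image.
have gn := integrable_neg_fin_num measurableT integrable_scaled_image.
rewrite /Rintegral [in LHS]integralE [in RHS]integralE.
rewrite [X in fine (X - _)](_ : _ =
    k%:num%:E * \int[mu]_x (EFin \o (f \o phi))^\+ x)%E; last first.
  rewrite (ge0_integral_scaled_image nuE)//.
    by congr (_ * _)%E; apply: eq_integral => x _; rewrite !funeposE.
  exact/measurable_funepos/measurable_EFinP.
rewrite [X in fine (_ - X)](_ : _ =
    k%:num%:E * \int[mu]_x (EFin \o (f \o phi))^\- x)%E; last first.
  rewrite (ge0_integral_scaled_image nuE)//.
    by congr (_ * _)%E; apply: eq_integral => x _; rewrite !funenegE.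
  exact/measurable_funeneg/measurable_EFinP.
rewrite fineB ?fin_numM// !fineM// -mulrBr; congr (_ * _).
by rewrite -fineB.
Qed.

End ScaledImage.

Section Affine.
Variable R : realType.
Local Notation mu := (@lebesgue_measure R).

Let aff (a b x : R) : R := a * x + b.

Let maff a b : measurable_fun [set: measurableTypeR R]
  (aff a b : measurableTypeR R -> measurableTypeR R).
Proof. by apply: measurable_funD => //; exact: measurable_funM. Qed.

Lemma lebesgue_measure_affine (a b : R) (A : set (measurableTypeR R)) :
  a != 0 -> measurable A ->
  mu A = (`|a|%:E * mu ((fun x : R => (a * x + b)%R) @^-1` A))%E.
Proof.
move=> a0 mA.
apply: (@lebesgue_measure_unique R (scaled_image (maff a b) mu `|a|%:nng)) => //= _ [[u v]] _ <-.
rewrite [mscale _ _ _]scaled_imageE /aff /=.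
have [a_gt0|a_lt0|a_eq0] := ltrgtP a 0; last by rewrite a_eq0 eqxx in a0.
  rewrite (_ : _ @^-1` _ = `[(v - b) / a, (u - b) / a[%classic); last first.
    apply/seteqP; split => x; rewrite /= !in_itv /=.
      move=> /andP[h1 h2]; apply/andP; split.
        by rewrite ler_ndivrMr//; lra.
      by rewrite ltr_ndivlMr//; lra.
    rewrite ler_ndivrMr// ltr_ndivlMr// => /andP[h1 h2].
    by apply/andP; split; lra.
  rewrite !lebesgue_measure_itv /= !lte_fin.
  have -> : ((v - b) / a < (u - b) / a) = (u < v).
    by rewrite ltr_nM2r ?invr_lt0// ltrD2r.
  case: ifPn => _; last by rewrite mule0.
  rewrite -EFinB -EFinM ltr0_norm//; congr EFin; field.
  by rewrite lt_eqF.
rewrite (_ : _ @^-1` _ = `](u - b) / a, (v - b) / a]%classic); last first.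
  apply/seteqP; split => x; rewrite /= !in_itv /=.
    move=> /andP[h1 h2]; apply/andP; split.
      by rewrite ltr_pdivrMr//; lra.
    by rewrite ler_pdivlMr//; lra.
  rewrite ltr_pdivrMr// ler_pdivlMr// => /andP[h1 h2].
  by apply/andP; split; lra.
rewrite !lebesgue_measure_itv /= !lte_fin.
have -> : ((u - b) / a < (v - b) / a) = (u < v).
  by rewrite ltr_pM2r ?invr_gt0// ltrD2r.
case: ifPn => _; last by rewrite mule0.
rewrite -EFinB -EFinM gtr0_norm//; congr EFin; field.
by rewrite gt_eqF.
Qed.

Lemma ge0_integral_affine (a b : R) (f : R -> \bar R) :
  a != 0 -> measurable_fun setT f -> (forall x, 0 <= f x)%E ->
  (\int[mu]_x f (a * x + b)%R = `|a|^-1%:E * \int[mu]_x f x)%E.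
Proof.
move=> a0 mf f0.
have := @ge0_integral_scaled_image _ _ _ _ _ _ (maff a b) mu `|a|%:nng mu f.
move=> -> //; last by move=> A mA; exact: lebesgue_measure_affine.
by rewrite /= muleA -EFinM mulVf ?normr_eq0// mul1e.
Qed.

End Affine.

(** * Characteristic coordinates *)

(** [of_null] sends the characteristic coordinates [(x + t, x - t)] to [(t, x)],
    and [to_null] is its inverse. *)
Definition of_null (R : realType) (z : R * R) : R * R :=
  ((z.1 - z.2) / 2, (z.1 + z.2) / 2).
Definition to_null (R : realType) (z : R * R) : R * R :=
  (z.2 + z.1, z.2 - z.1).
(** The reflection [x |-> - x] of space-time, written in characteristic
    coordinates; it exchanges the two families of characteristics. *)
Definition mirror (R : realType) (z : R * R) : R * R := (- z.2, - z.1).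

Section NullCoordinates.
Variable R : realType.
Local Notation mu := (@lebesgue_measure R).
Local Notation plane := (measurableTypeR R * measurableTypeR R)%type.

Lemma of_nullK : cancel (@of_null R) (@to_null R).
Proof. by move=> [a b]; rewrite /of_null /to_null /=; congr pair; field. Qed.

Lemma to_nullK : cancel (@to_null R) (@of_null R).
Proof. by move=> [a b]; rewrite /of_null /to_null /=; congr pair; field. Qed.

Lemma measurable_of_null : measurable_fun setT (@of_null R : plane -> plane).
Proof.
apply: (@measurable_fun_pair _ _ _ _ _ _
  (fun z : plane => (z.1 - z.2) / 2) (fun z : plane => (z.1 + z.2) / 2)).
  by apply: measurable_funM => //; apply: measurable_funB.
by apply: measurable_funM => //; apply: measurable_funD.
Qed.

Lemma measurable_to_null : measurable_fun setT (@to_null R : plane -> plane).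
Proof.
apply: (@measurable_fun_pair _ _ _ _ _ _
  (fun z : plane => z.2 + z.1) (fun z : plane => z.2 - z.1)).
  exact: measurable_funD.
exact: measurable_funB.
Qed.

Lemma measurable_mirror : measurable_fun setT (@mirror R : plane -> plane).
Proof.
apply: (@measurable_fun_pair _ _ _ _ _ _
  (fun z : plane => - z.2) (fun z : plane => - z.1)).
  by apply: measurableT_comp.
by apply: measurableT_comp.
Qed.

(** Rectangles suffice, by uniqueness of the product measure.  At fixed first
    coordinate [x], the substitution [t = (x - y) / 2] contributes the factor 2;
    after exchanging the integrals, [x - t] is a translate of [x]. *)
Lemma area_of_null (X : set plane) : measurable X ->
  (area R X = 2^-1%:E * area R (@of_null R @^-1` X))%E.
Proof.
move=> mX.
apply: (@product_measure_unique _ _ _ _ _ mu mu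
  (scaled_image measurable_of_null (area R) (2^-1)%:nng)) => // A B mA mB.
rewrite scaled_imageE.
have mAB : measurable (@of_null R @^-1` (A `*` B)).
  rewrite -[X in measurable X]setTI; apply: measurable_of_null => //.
  exact: measurableX.
rewrite -[X in (_ * (_ X))%E]setIT -(integral_indic (area R)) ?setIT//.
pose h (x t : R) : R := \1_A t * \1_B (x - t).
have mh : measurable_fun [set: plane] (fun z : plane => h z.1 z.2).
  apply: measurable_funM => //.
    exact: (@measurableT_comp _ _ _ _ _ _ (\1_A : measurableTypeR R -> R)).
  apply: (@measurableT_comp _ _ _ _ _ _ (\1_B : measurableTypeR R -> R)) => //.
  exact: measurable_funB.
have h0 x t : 0 <= h x t by rewrite mulr_ge0.
have mhx x : measurable_fun setT (h x).
  apply: measurable_funM => //.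
  apply: (@measurableT_comp _ _ _ _ _ _ (\1_B : measurableTypeR R -> R)) => //.
  exact: measurable_funB.
rewrite fubini_tonelli1//=; last by apply/measurable_EFinP; exact: measurable_indic.
rewrite /fubini_F.
transitivity ((2^-1)%:E * \int[mu]_x (2%:E * \int[mu]_t (h x t)%:E))%E.
  congr (_ * _)%E; apply: eq_integral => x _.
  transitivity (\int[mu]_y (h x (- 2^-1 * y + x / 2)%R)%:E)%E.
    apply: eq_integral => y _; congr EFin.
    have -> : h x (- 2^-1 * y + x / 2) = \1_A ((x - y) / 2) * \1_B ((x + y) / 2).
      by rewrite /h; congr (\1_A _ * \1_B _); field.
    rewrite !indicE -natrM mulnb; congr (nat_of_bool _)%:R.
    by apply/idP/andP; rewrite !inE.
  rewrite (@ge0_integral_affine R (- 2^-1) (x / 2) (fun t => (h x t)%:E)) //.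
  - by rewrite normrN ger0_norm ?invr_ge0// invrK.
  - exact/measurable_EFinP.
  - by move=> t; rewrite lee_fin.
rewrite ge0_integralZl//; last 2 first.
- apply: (measurable_fun_fubini_tonelli_F (fun z : plane => (h z.1 z.2)%:E)) => //.
    exact/measurable_EFinP.
  by move=> z; rewrite lee_fin.
- by move=> x _; apply: integral_ge0 => t _; rewrite lee_fin.
rewrite muleA -EFinM mulVf// mul1e.
have -> : (\int[mu]_x \int[mu]_t (h x t)%:E = \int[mu]_t \int[mu]_x (h x t)%:E)%E.
  have mhE : measurable_fun [set: plane] (fun z => (h z.1 z.2)%:E).
    exact/measurable_EFinP.
  have hE0 (z : plane) : (0 <= (h z.1 z.2)%:E)%E by rewrite lee_fin.
  exact: (@fubini_tonelli _ _ _ _ R mu mu _ mhE hE0).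
transitivity (\int[mu]_t ((\1_A t)%:E * mu B))%E.
  apply: eq_integral => t _.
  transitivity (\int[mu]_x ((\1_A t)%:E * (\1_B (1 * x + - t)%R)%:E))%E.
    by apply: eq_integral => x _; rewrite /h EFinM mul1r.
  have mB' : measurable_fun [set: measurableTypeR R] (fun x : R => \1_B (1 * x - t) : R).
    apply: (@measurableT_comp _ _ _ _ _ _ (\1_B : measurableTypeR R -> R)) => //.
    by apply: measurable_funB => //; exact: measurable_funM.
  rewrite ge0_integralZl//; last exact/measurable_EFinP.
  congr (_ * _)%E.
  rewrite (@ge0_integral_affine R 1 (- t) (fun x => (\1_B x)%:E)) ?oner_eq0//.
    by rewrite normr1 invr1 mul1e integral_indic// setIT.
  exact/measurable_EFinP.
rewrite ge0_integralZr//; last exact/measurable_EFinP.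
by rewrite integral_indic// setIT.
Qed.

Lemma area_mirror (X : set plane) : measurable X ->
  (area R X = 1%:E * area R (@mirror R @^-1` X))%E.
Proof.
move=> mX.
apply: (@product_measure_unique _ _ _ _ _ mu mu
  (scaled_image measurable_mirror (area R) 1%:nng)) => // A B mA mB.
rewrite scaled_imageE mul1e.
pose N (C : set (measurableTypeR R)) := (fun x : R => (-1 * x + 0)%R) @^-1` C.
have mN C : measurable C -> measurable (N C).
  move=> mC; rewrite -[X in measurable X]setTI.
  suff : measurable_fun setT (fun x : measurableTypeR R => (-1 * x + 0)%R).
    by apply.
  by apply: measurable_funD => //; apply: measurable_funM.
rewrite (_ : _ @^-1` _ = N B `*` N A); last first.
  rewrite /N /mirror; apply/seteqP; split => -[x y] /=.
    by rewrite !addr0 !mulN1r => -[].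
  by rewrite !addr0 !mulN1r => -[].
rewrite [LHS]product_measure1E; [|exact: mN|exact: mN].
have muN C : measurable C -> mu (N C) = mu C.
  move=> mC; rewrite [RHS](@lebesgue_measure_affine R (-1) 0 C)//.
  by rewrite normrN1 mul1e.
transitivity (mu (N B) * mu (N A))%E => //.
by rewrite (muN _ mA) (muN _ mB) muleC.
Qed.

Lemma ge0_integral_of_null (f : plane -> \bar R) :
  measurable_fun setT f -> (forall z, 0 <= f z)%E ->
  (\int[area R]_z f (of_null z) = 2%:E * \int[area R]_z f z)%E.
Proof.
move=> mf f0.
rewrite (ge0_integral_scaled_image measurable_of_null (k := (2^-1)%:nng) area_of_null mf f0).
by rewrite muleA -EFinM /= mulfV// mul1e.
Qed.

Lemma integrable_of_null (f : plane -> R) :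
  (area R).-integrable setT (EFin \o f) <->
  (area R).-integrable setT (EFin \o (f \o @of_null R)).
Proof.
have fE : f = (f \o @of_null R) \o @to_null R.
  by apply/funext => z /=; rewrite to_nullK.
split=> /integrableP[/measurable_EFinP mf fy]; apply/integrableP; split.
- by apply/measurable_EFinP; exact: measurableT_comp measurable_of_null.
- rewrite (ge0_integral_of_null (f := fun z => `|(f z)%:E|%E))//; last first.
    by apply: measurableT_comp => //; exact/measurable_EFinP.
  by apply: lte_mul_pinfty.
- by apply/measurable_EFinP; rewrite fE; exact: measurableT_comp measurable_to_null.
- have mf' : measurable_fun setT f.
    by rewrite fE; exact: measurableT_comp measurable_to_null.
  move: fy; rewrite (ge0_integral_of_null (f := fun z => `|(f z)%:E|%E))//; last first.
    by apply: measurableT_comp => //; exact/measurable_EFinP.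
  have : (0 <= \int[area R]_z `|(f z)%:E|)%E by exact: integral_ge0.
  by case: (integral _ _ _) => [r||] //= _; rewrite ?ltry// mulry gtr0_sg// mul1e.
Qed.

Lemma Rintegral_of_null (f : plane -> R) :
  (area R).-integrable setT (EFin \o f) ->
  \int[area R]_z f (of_null z) = 2 * \int[area R]_z f z.
Proof.
move=> fi.
rewrite (Rintegral_scaled_image measurable_of_null _ (k := (2^-1)%:nng) area_of_null fi)//=.
by rewrite mulrA mulfV ?mul1r.
Qed.

Lemma mirrorK : involutive (@mirror R).
Proof. by move=> [a b]; rewrite /mirror /= !opprK. Qed.

Lemma integrable_mirror (f : plane -> R) :
  (area R).-integrable setT (EFin \o f) ->
  (area R).-integrable setT (EFin \o (f \o @mirror R)).
Proof.
exact: (integrable_scaled_image measurable_mirror _ (k := 1%:nng) area_mirror).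
Qed.

Lemma Rintegral_mirror (f : plane -> R) :
  (area R).-integrable setT (EFin \o f) ->
  \int[area R]_z f (mirror z) = \int[area R]_z f z.
Proof.
move=> fi; rewrite [RHS](Rintegral_scaled_image measurable_mirror _ (k := 1%:nng) area_mirror fi)//.
by rewrite mul1r.
Qed.

Lemma ae_mirror (P : set plane) :
  {ae area R, forall z, P z} -> {ae area R, forall z, P (mirror z)}.
Proof.
move=> [N [mN N0 PN]]; exists (@mirror R @^-1` N); split.
- by rewrite -[X in measurable X]setTI; exact: measurable_mirror.
- by rewrite -N0 (area_mirror mN) mul1e.
- by move=> z /= /PN.
Qed.

End NullCoordinates.

(** * Smooth cut-off functions *)

Section Flat.
Variable R : realType.

(** These functions are closed under differentiation, which acts on [p] as
    [flat_next]; smoothness of the cut-offs is then an induction on the order. *)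
Definition flat (p : {poly R}) (x : R) : R :=
  if 0 < x then p.[x^-1] * expR (- x^-1) else 0.

Definition flat_next (p : {poly R}) : {poly R} := 'X^2 * (p - p^`()).

Lemma horner_bound (p : {poly R}) :
  exists2 C, 0 <= C & forall y, 1 <= y -> `|p.[y]| <= C * y ^+ size p.
Proof.
exists (\sum_(i < size p) `|p`_i|); first exact: sumr_ge0.
move=> y y1; rewrite horner_coef mulr_suml (le_trans (ler_norm_sum _ _ _))//.
apply: ler_sum => i _; rewrite normrM ler_wpM2l// normrX ger0_norm; last lra.
by rewrite ler_weXn2l// ltnW.
Qed.

(** [expR x^-1] dominates every power of [x^-1]; the factor [x ^+ 2] that is left
    makes the derivative at 0 vanish. *)
Lemma flat_bound (p : {poly R}) :
  exists2 C, 0 <= C & forall x, `|x| <= 1 -> `|flat p x| <= C * x ^+ 2.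
Proof.
have [C C0 Cp] := horner_bound p.
exists (C * (size p).+2`!%:R); first by rewrite mulr_ge0.
move=> x; rewrite /flat ler_norml => /andP[_ x1]; case: ifPn => x0; last first.
  rewrite normr0; apply: mulr_ge0; [exact: mulr_ge0|exact: sqr_ge0].
have y1 : 1 <= x^-1 by rewrite invf_ge1.
have y0 : 0 < x^-1 by rewrite invr_gt0.
have fac0 : 0 < ((size p).+2`!%:R : R) by rewrite ltr0n fact_gt0.
have key : x^-1 ^+ (size p).+2 / (size p).+2`!%:R <= expR x^-1.
  by apply: le_trans (expR_ge1Dxn (size p).+1 (ltW y0)); rewrite lerDr.
rewrite normrM (ger0_norm (expR_ge0 _)) expRN.
apply: (le_trans (ler_wpM2r _ (Cp _ y1))); first by rewrite invr_ge0 expR_ge0.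
rewrite -!mulrA ler_wpM2l// ler_pdivrMr ?expR_gt0//.
rewrite -(ler_pM2l (_ : 0 < x^-1 ^+ 2)) ?exprn_gt0// mulrA -exprD addSn add1n.
apply: le_trans (_ : (size p).+2`!%:R * expR x^-1 <= _).
  by rewrite -ler_pdivrMl// mulrC.
rewrite [x^-1 ^+ 2 * _]mulrCA -exprMn mulVf ?gt_eqF// expr1n mulr1.
by [].
Qed.

Lemma is_derive_flat (p : {poly R}) (x : R) :
  is_derive x 1 (flat p) (flat (flat_next p) x).
Proof.
have [x0|x0|x0] := ltrgtP 0 x.
- have D : is_derive x 1 (fun x => p.[x^-1] * expR (- x^-1))
      (flat (flat_next p) x).
    have xn0 : x != 0 by rewrite gt_eqF.
    have dV : is_derive x 1 (fun x => x^-1) (- x ^- 2).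
      have := @is_deriveV _ id x 1 1 xn0 _; rewrite /GRing.scale /= mulr1.
      by apply; exact: is_derive_id.
    have d1 : is_derive x 1 (horner p \o (fun x => x^-1)) (p^`().[x^-1] * (- x ^- 2)).
      exact: is_derive1_comp.
    have d2 : is_derive x 1 (expR \o (fun x => - x^-1)) (expR (- x^-1) * (x ^- 2)).
      by apply: is_derive1_comp; rewrite -[x ^- 2]opprK; exact: is_deriveN.
    apply: is_derive_eq.
    rewrite /flat x0 /flat_next !hornerE /GRing.scale /=.
    by rewrite exprVn; ring.
  apply: near_eq_is_derive D => //.
  near=> z; rewrite /flat ifT//; near: z; exact: lt_nbhsr.
- apply: (@near_eq_is_derive _ _ _ (cst 0)).
  + near=> z; rewrite /flat ifF//; apply/negbTE; rewrite -leNgt ltW//.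
    near: z; exact: lt_nbhsl.
  + by rewrite /flat ifF ?ltNge ?(ltW x0)//; exact: is_derive_cst.
- rewrite -x0; have [C C0 Cp] := flat_bound p.
  have f0 q : flat q 0 = 0 by rewrite /flat ltxx.
  have cv : (fun h => h^-1 *: ((flat p \o shift 0) (h *: 1) - flat p 0)) @ 0^'
      --> (0 : R).
    apply/cvgr0Pnorm_le => e e0; near=> h.
    rewrite f0 subr0 /= addr0 /GRing.scale /= mulr1 normrM normfV.
    have hn0 : h != 0 by near: h; exact: nbhs_dnbhs_neq.
    have h1 : `|h| <= 1.
      by near: h; apply: dnbhs0_le.
    have h2 : `|h| <= e / (C + 1).
      near: h; apply: dnbhs0_le; first by rewrite divr_gt0// ltr_pwDr.
    rewrite ler_pdivrMl ?normr_gt0// (le_trans (Cp _ h1))//.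
    rewrite -real_normK ?num_real// expr2 mulrCA ler_wpM2l//.
    have : (C + 1) * `|h| <= e by rewrite -ler_pdivlMl ?ltr_pwDr// mulrC.
    by apply: le_trans; rewrite ler_wpM2r// lerDl.
  rewrite f0; apply: DeriveDef; first by apply/cvg_ex; exists 0.
  exact/cvg_lim.
Unshelve. all: by end_near. Qed.

Lemma derive1_line (V : normedModType R) (f : V -> R) (z v : V) (g : R -> R)
    (dg : R) :
  (forall h, f (h *: v + z) = g h) -> is_derive (0 : R) (1 : R) g dg -> is_derive z v f dg.
Proof.
move=> fg [dg1 <-].
have E : (fun h : R => h^-1 *: ((f \o shift z) (h *: v) - f z)) =
    (fun h => h^-1 *: ((g \o shift 0) (h *: 1) - g 0)).
  apply/funext => h /=; rewrite fg addr0 /GRing.scale /= mulr1.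
  by rewrite (_ : f z = g 0)// -fg scale0r add0r.
by apply: DeriveDef; rewrite /derivable /derive E.
Qed.

End Flat.

(** * Smooth functions on normed modules *)
Section Smooth.
Variables (R : realType) (V : normedModType R).
Implicit Types f g : V -> R.

Lemma Ck_S k f : Ck k.+1 setT f -> Ck k setT f.
Proof.
elim: k f => [|k IH] f [cf df]; split => // v.
by have [dv cv] := df v; split => //; exact: IH.
Qed.

Lemma Ck_add k f g : Ck k setT f -> Ck k setT g -> Ck k setT (fun z => f z + g z).
Proof.
elim: k f g => [|k IH] f g [cf df] [cg dg].
  by split => // z _; apply: cvgD; [exact: cf|exact: cg].
split=> [z _|v]; first by apply: cvgD; [exact: cf|exact: cg].
have [dfv cfv] := df v; have [dgv cgv] := dg v; split=> [z _|].
  by apply: derivableD; [exact: dfv|exact: dgv].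
rewrite (_ : (fun x => _) = (fun x => 'D_v f x + 'D_v g x)); first exact: IH.
by apply/funext => z; rewrite deriveD//; [exact: dfv|exact: dgv].
Qed.

Lemma Ck_mul k f g : Ck k setT f -> Ck k setT g -> Ck k setT (fun z => f z * g z).
Proof.
elim: k f g => [|k IH] f g sf sg.
  by case: sf sg => [cf _] [cg _]; split => // z _; apply: cvgM; [exact: cf|exact: cg].
have fk := Ck_S sf; have gk := Ck_S sg.
case: sf sg => cf df [cg dg].
split=> [z _|v]; first by apply: cvgM; [exact: cf|exact: cg].
have [dfv cfv] := df v; have [dgv cgv] := dg v; split=> [z _|].
  by apply: derivableM; [exact: dfv|exact: dgv].
rewrite (_ : (fun x => _) = (fun x => f x * 'D_v g x + g x * 'D_v f x)).
  by apply: Ck_add; exact: IH.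
by apply/funext => z; rewrite deriveM//; [exact: dfv|exact: dgv].
Qed.

(** [c v] is the slope of [l] in the direction [v]. *)
Definition affine_form (l : V -> R) (c : V -> R) :=
  continuous l /\ forall z v h, l (h *: v + z) = l z + h * c v.

Lemma is_derive_flat_affine (l c : V -> R) p z v : affine_form l c ->
  is_derive z v (fun z => flat p (l z)) (c v * flat (flat_next p) (l z)).
Proof.
move=> [_ lE]; apply: (derive1_line (g := flat p \o (fun h => l z + h * c v))).
  by move=> h; rewrite /= lE.
have -> : c v * flat (flat_next p) (l z) = flat (flat_next p) (l z + 0 * c v) * c v.
  by rewrite mul0r addr0 mulrC.
apply: is_derive1_comp; first exact: is_derive_flat.
apply: is_derive_eq; rewrite ?add0r /GRing.scale /=; ring.
Qed.

Lemma Ck_flat_affine k (l c : V -> R) p a : affine_form l c ->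
  Ck k setT (fun z => a * flat p (l z)).
Proof.
move=> lc; have cl : continuous (fun z => a * flat p (l z)).
  move=> z; apply: cvgM; first exact: cvg_cst.
  apply: (@continuous_cvg _ _ _ _ _ l (flat p)); last by case: lc => + _; apply.
  by apply/differentiable_continuous/derivable1_diffP; case: (is_derive_flat p (l z)).
elim: k a p cl => [|k IH] a p cl; first by split => // z _; exact: cl.
split=> [z _|v]; first exact: cl.
have D z : is_derive z v (fun z => a * flat p (l z))
    ((a * c v) * flat (flat_next p) (l z)).
  have := is_derive_flat_affine p z v lc => D1.
  rewrite -mulrA; exact: (@is_deriveZ _ _ _ _ a).
split=> [z _|]; first by case: (D z).
rewrite (_ : (fun x => _) = (fun z => (a * c v) * flat (flat_next p) (l z))).
  apply: IH; move=> z; apply: cvgM; first exact: cvg_cst.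
  apply: (@continuous_cvg _ _ _ _ _ l (flat (flat_next p))); last by case: lc => + _; apply.
  by apply/differentiable_continuous/derivable1_diffP;
    case: (is_derive_flat (flat_next p) (l z)).
by apply/funext => z; case: (D z).
Qed.

End Smooth.

Section Bump.
Variable R : realType.

(** Smooth, supported in the segment from [a] to [b], and converging to the
    indicator of its interior as [k] grows. *)
Definition cutoff (k : nat) (a b x : R) : R :=
  flat 1 (k.+1%:R * (x - a)) * flat 1 (k.+1%:R * (b - x)).

Definition cutoff' (k : nat) (a b x : R) : R :=
  k.+1%:R * (flat (flat_next 1) (k.+1%:R * (x - a)) * flat 1 (k.+1%:R * (b - x))
  - flat 1 (k.+1%:R * (x - a)) * flat (flat_next 1) (k.+1%:R * (b - x))).

Lemma flat1_ge0 (x : R) : 0 <= flat 1 x.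
Proof. by rewrite /flat; case: ifP => // _; rewrite hornerE mul1r expR_ge0. Qed.

Lemma flat1_le1 (x : R) : flat 1 x <= 1.
Proof.
rewrite /flat; case: ifP => // x0; rewrite hornerE mul1r -expR0 ler_expR.
by rewrite oppr_le0 invr_ge0 ltW.
Qed.

Lemma flat_le0 p (x : R) : x <= 0 -> flat p x = 0.
Proof. by move=> x0; rewrite /flat ltNge x0. Qed.

Lemma continuous_flat p : continuous (@flat R p).
Proof.
move=> x; apply/differentiable_continuous/derivable1_diffP.
by case: (is_derive_flat p x).
Qed.

Lemma cutoff_ge0 k a b x : 0 <= cutoff k a b x.
Proof. by rewrite mulr_ge0 ?flat1_ge0. Qed.

Lemma cutoff_le1 k a b x : cutoff k a b x <= 1.
Proof. by rewrite mulr_ile1 ?flat1_ge0 ?flat1_le1. Qed.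

Lemma cutoff2_le1 k a b c d x y : `|cutoff k a b x * cutoff k c d y| <= 1.
Proof.
rewrite normrM !ger0_norm ?cutoff_ge0//.
by apply: mulr_ile1; rewrite ?cutoff_ge0 ?cutoff_le1.
Qed.

Lemma cutoff_out k a b x : ~~ (a < x < b) -> cutoff k a b x = 0.
Proof.
rewrite negb_and -!leNgt => /orP[xa|bx]; rewrite /cutoff.
  by rewrite flat_le0 ?mul0r// mulr_ge0_le0// subr_le0.
by rewrite [X in _ * X]flat_le0 ?mulr0// mulr_ge0_le0// subr_le0.
Qed.

Lemma cutoff'_out k a b x : ~~ (a < x < b) -> cutoff' k a b x = 0.
Proof.
rewrite negb_and -!leNgt => /orP[xa|bx]; rewrite /cutoff'.
  have xa' : k.+1%:R * (x - a) <= 0 by rewrite mulr_ge0_le0// subr_le0.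
  by rewrite !(flat_le0 _ xa') !mul0r subrr mulr0.
have bx' : k.+1%:R * (b - x) <= 0 by rewrite mulr_ge0_le0// subr_le0.
by rewrite !(flat_le0 _ bx') !mulr0 subrr mulr0.
Qed.

Lemma is_derive_cutoff k a b (x : R) : is_derive x (1 : R) (cutoff k a b) (cutoff' k a b x).
Proof.
have E1 : is_derive x 1 (flat 1 \o (fun x => k.+1%:R * (x - a)))
    (flat (flat_next 1) (k.+1%:R * (x - a)) * k.+1%:R).
  apply: is_derive1_comp; first exact: is_derive_flat.
  by apply: is_derive_eq; rewrite /GRing.scale /=; ring.
have E2 : is_derive x 1 (flat 1 \o (fun x => k.+1%:R * (b - x)))
    (flat (flat_next 1) (k.+1%:R * (b - x)) * (- k.+1%:R)).
  apply: is_derive1_comp; first exact: is_derive_flat.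
  by apply: is_derive_eq; rewrite /GRing.scale /=; ring.
rewrite (_ : cutoff k a b = (flat 1 \o (fun x => k.+1%:R * (x - a))) *
   (flat 1 \o (fun x => k.+1%:R * (b - x)))) //.
by apply: is_derive_eq; rewrite /cutoff' /GRing.scale /=; ring.
Qed.

Lemma continuous_cutoff k a b : continuous (cutoff k a b).
Proof.
move=> x; apply/differentiable_continuous/derivable1_diffP.
by case: (is_derive_cutoff k a b x).
Qed.

Lemma continuous_cutoff' k a b : continuous (cutoff' k a b).
Proof.
have c1 p : continuous (fun x : R => flat p (k.+1%:R * (x - a))).
  move=> x; apply: continuous_cvg; first exact: continuous_flat.
  by apply: cvgM; [exact: cvg_cst|apply: cvgB; [exact: cvg_id|exact: cvg_cst]].
have c2 p : continuous (fun x : R => flat p (k.+1%:R * (b - x))).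
  move=> x; apply: continuous_cvg; first exact: continuous_flat.
  by apply: cvgM; [exact: cvg_cst|apply: cvgB; [exact: cvg_cst|exact: cvg_id]].
move=> x; apply: cvgM; first exact: cvg_cst.
by apply: cvgB; apply: cvgM; [exact: c1|exact: c2|exact: c1|exact: c2].
Qed.

Lemma cutoff'_bounded k a b : exists C, forall x, `|cutoff' k a b x| <= C.
Proof.
have : bounded_set (cutoff' k a b @` `[a, b]).
  apply: compact_bounded; apply: continuous_compact; last exact: segment_compact.
  by apply: continuous_subspaceT => x; exact: continuous_cutoff'.
move=> [M [Mr MP]]; exists (`|M| + 1) => x.
have M0 : 0 <= `|M| + 1 by rewrite addr_ge0.
have [xab|xab] := boolP (a < x < b); last by rewrite cutoff'_out// normr0.
apply: MP; first by rewrite (le_lt_trans (ler_norm M))// ltrDl.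
by exists x => //=; rewrite in_itv /=; case/andP: xab => /ltW-> /ltW->.
Qed.

Lemma cvg_cutoff a b x : cutoff k a b x @[k --> \oo] --> (\1_(`]a, b[%classic) x : R).
Proof.
rewrite indicE; have [xab|xab] := boolP (x \in `]a, b[%classic); last first.
  rewrite (_ : (fun k => _) = (cst 0)); first exact: cvg_cst.
  by apply/funext => k; rewrite cutoff_out//; move: xab; rewrite mem_setE in_itv.
move: xab; rewrite inE /= in_itv /= => /andP[ax xb].
have C (y : R) : 0 < y -> flat 1 (k.+1%:R * y) @[k --> \oo] --> (1 : R).
  move=> y0.
  have H : - (k.+1%:R^-1 * y^-1) @[k --> \oo] --> (- (0 * y^-1) : R).
    by apply: cvgN; apply: cvgM; [exact: cvg_harmonic|exact: cvg_cst].
  rewrite mul0r oppr0 in H.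
  have H2 : expR (- (k.+1%:R^-1 * y^-1)) @[k --> \oo] --> expR (0 : R).
    by apply: continuous_cvg => //; exact: continuous_expR.
  rewrite expR0 in H2; apply: cvg_trans H2; apply: near_eq_cvg; near=> k.
  by rewrite /flat mulr_gt0//= hornerE mul1r invfM.
rewrite -[X in _ --> X]mulr1; apply: cvgM; apply: C; rewrite subr_gt0//.
Unshelve. all: by end_near. Qed.

Lemma cutoff_opp k a b x : cutoff k a b (- x) = cutoff k (- b) (- a) x.
Proof.
rewrite /cutoff mulrC; congr (flat 1 (_ * _) * flat 1 (_ * _)); ring.
Qed.

Lemma cutoff'_opp k a b x : cutoff' k a b (- x) = - cutoff' k (- b) (- a) x.
Proof.
rewrite /cutoff'.
have -> : - x - a = - a - x by ring.
have -> : b - - x = x - - b by ring.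
by ring.
Qed.

End Bump.

(** * Functions orthogonal to all cut-off functions vanish *)

Section Vanishing.
Variable R : realType.
Local Notation mu := (@lebesgue_measure R).
Local Notation plane := (measurableTypeR R * measurableTypeR R)%type.

(** By Lebesgue differentiation. *)
Lemma ae_eq0_of_itv (f : R -> R) : mu.-integrable setT (EFin \o f) ->
  (forall a b, \int[mu]_(x in `]a, b[) f x = 0) ->
  {ae mu, forall x, f x = 0}.
Proof.
move=> fi f0.
have loc : locally_integrable setT f.
  exact: (open_integrable_locally openT fi).
have mf : measurable_fun setT f by exact: measurable_of_integrable fi.
apply: (@filterS _ _ (ae_filter_ringOfSetsType mu) _ _ _ (lebesgue_differentiation loc)) => x xl.
apply/eqP; rewrite -normr_le0 -lee_fin.
suff H : \forall r \near (0 : R)^'+, (`|f x|%:E <= davg f x r)%E.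
  exact: cvge_to_ge xl H.
near=> r.
have r0 : 0 < r by near: r; exact: nbhs_right_gt.
have mub : mu (ball x r) = (r *+ 2)%:E by rewrite lebesgue_measure_ball// ltW.
have mufin : (mu (ball x r) < +oo)%E by rewrite mub ltry.
have fib : mu.-integrable (ball x r) (EFin \o f).
  by apply: integrableS fi => //; exact: measurable_ball.
have cib : mu.-integrable (ball x r) (EFin \o cst (f x)).
  apply: measurable_bounded_integrable => //; first exact: measurable_ball.
  exact: bounded_cst.
rewrite /davg /iavg mub inver mulrn_eq0 /= gt_eqF// lee_pdivlMl ?mulrn_wgt0//.
apply: le_trans (_ : `|\int[mu]_(y in ball x r) ((f y)%:E - (f x)%:E)| <= _)%E.
  rewrite integralB//; last exact: measurable_ball.
  rewrite [X in `|X - _|%E](_ : _ = 0); last first.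
    have := f0 (x - r) (x + r); rewrite -ball_itv /Rintegral.
    have : (\int[mu]_(y in ball x r) (f y)%:E)%E \is a fin_num.
      by apply: integrable_fin_num => //; exact: measurable_ball.
    by case: (integral _ _ _) => //= a _ ->.
  rewrite integral_cst; last exact: measurable_ball.
  rewrite [X in (_ - _ * X)%E](_ : _ = (r *+ 2)%:E); last exact: mub.
  rewrite sub0e abseN -EFinM /= lee_fin normrM (gtr0_norm (_ : 0 < r *+ 2)) ?mulrn_wgt0//.
  by rewrite mulrC.
apply: le_abse_integral; first exact: measurable_ball.
by apply: measurable_funTS; apply/measurable_EFinP; exact: measurable_funB.
Unshelve. all: by end_near. Qed.

(** Fubini and the one-dimensional case extend the hypothesis from intervals to
    measurable sets, one variable at a time.  Rectangles generate the product
    sigma-algebra, so the charge of density [h] vanishes on all of it. *)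
Lemma ae_eq0_of_rectangles (h : plane -> R) :
  (area R).-integrable setT (EFin \o h) ->
  (forall a b c d, \int[area R]_z (h z * (\1_(`]a, b[%classic) z.1 * \1_(`]c, d[%classic) z.2)) = 0) ->
  {ae area R, forall z, h z = 0}.
Proof.
move=> hi h0.
have mh : measurable_fun setT h by exact: measurable_of_integrable hi.
have m1 (A : set (measurableTypeR R)) : measurable A ->
    measurable_fun [set: plane] (fun z : plane => \1_A z.1 : R).
  by move=> mA; apply: (@measurableT_comp _ _ _ _ _ _ (\1_A : measurableTypeR R -> R)).
have m2 (A : set (measurableTypeR R)) : measurable A ->
    measurable_fun [set: plane] (fun z : plane => \1_A z.2 : R).
  by move=> mA; apply: (@measurableT_comp _ _ _ _ _ _ (\1_A : measurableTypeR R -> R)).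
have ind1 := @norm_indic_le1 R.
have hAB A B : measurable A -> measurable B -> (area R).-integrable setT
    (EFin \o (fun z => h z * (\1_A z.1 * \1_B z.2))).
  move=> mA mB; apply: (@integrable_mul_bounded _ _ _ _ _ _ 1) => //.
    by apply: measurable_funM; [exact: m1|exact: m2].
  by move=> z; rewrite normrM mulr_ile1.
have hAJ A c d : measurable A ->
    \int[area R]_z (h z * (\1_A z.1 * \1_(`]c, d[%classic) z.2)) = 0.
  move=> mA.
  have hTJ := hAB setT `]c, d[%classic measurableT (measurable_itv _).
  pose G x := \int[mu]_y (h (x, y) * (\1_setT x * \1_(`]c, d[%classic) y)).
  have Gi : mu.-integrable setT (EFin \o G) := integrable_Rintegral_snd hTJ.
  have GE (C : set (measurableTypeR R)) x :
      \int[mu]_y (h (x, y) * (\1_C x * \1_(`]c, d[%classic) y)) = G x * \1_C x.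
    rewrite /G indicT [\1_C x]indicE; case: (x \in C).
      by rewrite mulr1.
    rewrite mulr0; under eq_Rintegral => y _ do rewrite mul0r mulr0.
    by rewrite Rintegral_cst// mul0r.
  have G0 : {ae mu, forall x, G x = 0}.
    apply: ae_eq0_of_itv => // a b; rewrite RintegralE_indic -[RHS](h0 a b c d).
    rewrite (Rfubini12 (hAB _ _ (measurable_itv `]a, b[) (measurable_itv `]c, d[))).
    by apply: eq_Rintegral => x _ /=; rewrite GE.
  rewrite (Rfubini12 (hAB _ _ mA (measurable_itv `]c, d[))).
  under eq_Rintegral => x _ do rewrite GE.
  have -> : \int[mu]_x (G x * \1_A x) = \int[mu]_x (0 : R).
    congr fine; apply: ae_eq_integral => //.
      apply/measurable_EFinP; apply: measurable_funM => //.
      exact: measurable_of_integrable Gi.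
    apply: (@filterS _ _ (ae_filter_ringOfSetsType mu) _ _ _ G0) => x /= -> _.
    by rewrite mul0r.
  by rewrite Rintegral_cst// mul0r.
have hABE A B : measurable A -> measurable B ->
    \int[area R]_z (h z * (\1_A z.1 * \1_B z.2)) = 0.
  move=> mA mB.
  have hAT := hAB A setT mA measurableT.
  pose G y := \int[mu]_x (h (x, y) * (\1_A x * \1_setT y)).
  have Gi : mu.-integrable setT (EFin \o G) := integrable_Rintegral_fst hAT.
  have GE (C : set (measurableTypeR R)) y :
      \int[mu]_x (h (x, y) * (\1_A x * \1_C y)) = G y * \1_C y.
    rewrite /G indicT [\1_C y]indicE; case: (y \in C).
      by rewrite mulr1.
    rewrite mulr0; under eq_Rintegral => x _ do rewrite mulr0 mulr0.
    by rewrite Rintegral_cst// mul0r.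
  have G0 : {ae mu, forall y, G y = 0}.
    apply: ae_eq0_of_itv => // a b; rewrite RintegralE_indic -[RHS](hAJ A a b mA).
    rewrite (Rfubini21 (hAB _ _ mA (measurable_itv `]a, b[))).
    by apply: eq_Rintegral => x _ /=; rewrite GE.
  rewrite (Rfubini21 (hAB _ _ mA mB)).
  under eq_Rintegral => y _ do rewrite GE.
  have -> : \int[mu]_y (G y * \1_B y) = \int[mu]_y (0 : R).
    congr fine; apply: ae_eq_integral => //.
      apply/measurable_EFinP; apply: measurable_funM => //.
      exact: measurable_of_integrable Gi.
    apply: (@filterS _ _ (ae_filter_ringOfSetsType mu) _ _ _ G0) => x /= -> _.
    by rewrite mul0r.
  by rewrite Rintegral_cst// mul0r.
pose nu : set plane -> \bar R := induced_charge hi.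
have nuAB A B : measurable A -> measurable B -> nu (A `*` B) = 0%E.
  move=> mA mB; rewrite /nu /induced_charge integral_mkcond.
  have := hABE A B mA mB; rewrite /Rintegral.
  have := integrable_fin_num measurableT (hAB A B mA mB).
  rewrite (_ : (\int[area R]_z (h z * (\1_A z.1 * \1_B z.2))%:E)%E =
    (\int[area R]_x ((fun t : plane => (h t)%:E) \_ (A `*` B)) x)%E); last first.
    apply: eq_integral => z _; rewrite patchE in_setX !indicE -natrM mulnb.
    by case: ifP => _; rewrite ?mulr1 ?mulr0.
  by case: (integral _ _ _) => //= r _ ->.
have nu0 X : measurable X -> nu X = 0%E.
  move=> mX.
  pose C : set (set plane) :=
    [set C | exists A, measurable A /\ exists B, measurable B /\ C = A `*` B].
  have CE : @measurable _ plane = <<s C >>.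
    rewrite measurable_prod_measurableType //; congr (<<s _ >>).
    rewrite predeqE => S; split => [[A mA [B mB <-]]|[A [mA [B [mB ->]]]]].
      by exists A; split => //; exists B.
    by exists A => //; exists B.
  have nuT : nu setT = 0%E by rewrite -setXTT nuAB.
  apply: (@dynkin_induction _ plane C (fun X => nu X = 0%E)) => //.
  - move=> _ _ [A1 [mA1 [B1 [mB1 ->]]]] [A2 [mA2 [B2 [mB2 ->]]]].
    rewrite -setXI; exists (A1 `&` A2); split; first exact: measurableI.
    by exists (B1 `&` B2); split => //; exact: measurableI.
  - by move=> _ [A [mA [B [mB ->]]]]; exact: nuAB.
  - move=> S mS nuS; have mSC := measurableC mS.
    have : nu setT = (nu S + nu (~` S))%E.
      rewrite -(setvU S) setUC; apply: (chargeU (induced_charge hi)) => //.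
      by rewrite setICr.
    by rewrite nuT nuS add0e.
  - move=> F mF tF nuF.
    have := @charge_semi_sigma_additive _ _ _ (induced_charge hi) F mF tF
      (bigcupT_measurable _ mF).
    rewrite [X in X @ \oo --> _](_ : _ = cst 0%E); last first.
      by apply/funext => n; rewrite big1// => k _; exact: nuF.
    move/cvg_lim => E; change (induced_charge hi (\bigcup_n F n) = 0%E).
    by rewrite -E// lim_cst.
  - by rewrite -CE.
have := @integral_ae_eq _ _ _ (area R) setT measurableT (cst 0%E) (EFin \o h) hi.
move=> /(_ (measurable_cst _)) H.
have {H} : ae_eq (area R) setT (EFin \o h) (cst 0%E).
  apply: H => E _ mE; rewrite integral_cst// mul0e.
  exact: nu0.
by apply: (@filterS _ _ (ae_filter_ringOfSetsType (area R))) => z /(_ I) /= [].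
Qed.

(** Dominated convergence turns cut-offs into indicators of rectangles. *)
Lemma ae_eq0_of_cutoffs (h : plane -> R) (a1 a2 b1 b2 : R) :
  (area R).-integrable setT (EFin \o h) ->
  (forall k a b c d, a1 <= a -> b <= a2 -> b1 <= c -> d <= b2 ->
    \int[area R]_z (h z * (cutoff k a b z.1 * cutoff k c d z.2)) = 0) ->
  {ae area R, forall z, a1 < z.1 < a2 -> b1 < z.2 < b2 -> h z = 0}.
Proof.
move=> hi h0.
have mh : measurable_fun setT h by exact: measurable_of_integrable hi.
have mI (a b : R) : measurable_fun [set: measurableTypeR R]
    (fun x : measurableTypeR R => \1_(`]a, b[%classic) x : R).
  by apply: measurable_indic.
have m1 (a b c d : R) : measurable_fun [set: plane]
   (fun z : plane => \1_(`]a, b[%classic) z.1 * \1_(`]c, d[%classic) z.2 : R).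
  by apply: measurable_funM; apply: (measurableT_comp (mI _ _)).
have ind1 := @norm_indic_le1 R.
have rect a b c d : a1 <= a -> b <= a2 -> b1 <= c -> d <= b2 ->
    \int[area R]_z (h z * (\1_(`]a, b[%classic) z.1 * \1_(`]c, d[%classic) z.2)) = 0.
  move=> aa bb cc dd.
  have mb k (u v : R) : measurable_fun [set: measurableTypeR R] (cutoff k u v).
    by apply: continuous_measurable_fun; exact: continuous_cutoff.
  have := @dominated_cvg _ plane R (area R) setT measurableT
    (fun k z => (h z * (cutoff k a b z.1 * cutoff k c d z.2))%:E)
    (fun z => (h z * (\1_(`]a, b[%classic) z.1 * \1_(`]c, d[%classic) z.2))%:E)
    (fun z => `|(h z)%:E|%E).
  move=> H.
  have {}H : (\int[area R]_z ((h z * (cutoff k a b z.1 * cutoff k c d z.2))%:E) @[k --> \oo]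
    --> \int[area R]_z (h z * (\1_(`]a, b[%classic) z.1 * \1_(`]c, d[%classic) z.2))%:E)%E.
    apply: H.
    - move=> k; apply/measurable_EFinP; apply: measurable_funM => //.
      by apply: measurable_funM; apply: (measurableT_comp (mb _ _ _)).
    - move=> z _; apply: cvg_EFin; first by near=> k.
      apply: cvgM; first exact: cvg_cst.
      by apply: cvgM; exact: cvg_cutoff.
    - by [].
    - exact: integrable_abse.
    - move=> k z _; rewrite /= lee_fin normrM ler_piMr//.
      exact: cutoff2_le1.
  rewrite /Rintegral; move/cvg_lim: H => <- //.
  rewrite (_ : (fun k => _) = cst 0%E) ?lim_cst//.
  apply/funext => k; have := h0 k a b c d aa bb cc dd; rewrite /Rintegral.
  have : (area R).-integrable setT (EFin \o (fun z : plane => h z * (cutoff k a b z.1 * cutoff k c d z.2))).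
    apply: (@integrable_mul_bounded _ _ _ _ _ _ 1) => //.
      by apply: measurable_funM; apply: (measurableT_comp (mb _ _ _)).
    by move=> z; exact: cutoff2_le1.
  by move=> /(integrable_fin_num measurableT); case: (integral _ _ _) => //= r _ ->.
pose g z := h z * (\1_(`]a1, a2[%classic) z.1 * \1_(`]b1, b2[%classic) z.2).
have gi : (area R).-integrable setT (EFin \o g).
  apply: (@integrable_mul_bounded _ _ _ _ _ _ 1) => //.
  by move=> z; rewrite normrM mulr_ile1.
have cap (a b u v x : R) : \1_(`]u, v[%classic) x * \1_(`]a, b[%classic) x =
    \1_(`]Num.max a u, Num.min b v[%classic) x :> R.
  rewrite !indicE -natrM mulnb; congr (nat_of_bool _)%:R.
  apply/idP/idP; rewrite !inE /= !in_itv /= gt_max lt_min.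
    by move=> /andP[/set_mem /= ]; rewrite in_itv /= => /andP[-> ->]
       /set_mem /=; rewrite in_itv /= => /andP[-> ->].
  move=> /andP[/andP[h1 h2] /andP[h3 h4]].
  by apply/andP; split; apply/mem_set; rewrite /= in_itv /= ?h1 ?h2 ?h3 ?h4.
have := ae_eq0_of_rectangles gi; move=> /(_ _) H.
have {H} : {ae area R, forall z, g z = 0}.
  apply: H => a b c d; rewrite -[RHS](rect (Num.max a a1) (Num.min b a2)
    (Num.max c b1) (Num.min d b2)) ?le_max ?ge_min ?lexx ?orbT//.
  by apply: eq_Rintegral => z _; rewrite -!cap /g; ring.
apply: (@filterS _ _ (ae_filter_ringOfSetsType (area R))) => z /= gz za zb.
by move: gz; rewrite /g !indicE !mem_set /= ?in_itv// !mulr1.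
Unshelve. all: by end_near. Qed.

End Vanishing.

(** * Triangles of dependence and Duhamel's integral *)

(** The domain of dependence of the interval from [c] to [d], in the coordinates
    [(x + t, x - t)]: the second is below the first at positive times. *)
Definition null_triangle (R : realType) (c d : R) : set (R * R) :=
  [set z | [/\ c < z.2, z.2 < z.1 & z.1 < d]].

Section MeasurableTools.
Variable R : realType.
Local Notation mu := (@lebesgue_measure R).
Local Notation plane := (measurableTypeR R * measurableTypeR R)%type.

Lemma measurable_set_ltr d (T : measurableType d) (f g : T -> R) :
  measurable_fun setT f -> measurable_fun setT g ->
  measurable [set x | f x < g x].
Proof.
move=> mf mg.
have := measurable_fun_ltr mf mg => /(_ measurableT [set true]).
by rewrite setTI; apply.
Qed.

Lemma measurable_null_triangle (c d : R) :
  measurable (null_triangle c d : set plane).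
Proof.
rewrite (_ : null_triangle c d = [set z : plane | c < z.2] `&`
  ([set z : plane | z.2 < z.1] `&` [set z : plane | z.1 < d])); last first.
  by apply/seteqP; split => z /= => [[]|[? []]].
apply: measurableI; first by apply: measurable_set_ltr.
by apply: measurableI; apply: measurable_set_ltr.
Qed.

Lemma measurable_Rintegral_snd d1 d2 (T1 : measurableType d1)
    (T2 : measurableType d2) (m2 : {sigma_finite_measure set T2 -> \bar R})
    (f : T1 * T2 -> R) :
  measurable_fun setT f ->
  measurable_fun setT (fun x => \int[m2]_y f (x, y)).
Proof.
move=> mf; apply: (@measurableT_comp _ _ _ _ _ _ fine) => //.
rewrite (_ : (fun x => _) = (fun x => (\int[m2]_y ((fun z => (f z)%:E)^\+ (x, y)) -
   \int[m2]_y ((fun z => (f z)%:E)^\- (x, y)))%E)); last first.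
  apply/funext => x; rewrite integralE; congr (_ - _)%E.
    by apply: eq_integral => y _; rewrite !funeposE.
  by apply: eq_integral => y _; rewrite !funenegE.
apply: emeasurable_funB.
  apply: (measurable_fun_fubini_tonelli_F (fun z => (f z)%:E)^\+%E) => //.
  exact/measurable_funepos/measurable_EFinP.
apply: (measurable_fun_fubini_tonelli_F (fun z => (f z)%:E)^\-%E) => //.
exact/measurable_funeneg/measurable_EFinP.
Qed.

Lemma abs_Rintegral_le d (T : measurableType d) (m : {measure set T -> \bar R})
    (f : T -> R) : measurable_fun setT f ->
  (`|\int[m]_x f x|%:E <= \int[m]_x `|f x|%:E)%E.
Proof.
move=> mf; apply: le_trans (_ : `|\int[m]_x (f x)%:E| <= _)%E.
  by rewrite /Rintegral; case: (integral _ _ _) => [r||] //=; rewrite ?normr0 ?leey.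
by apply: le_abse_integral => //; exact/measurable_EFinP.
Qed.

Lemma norm_mul_le1 (x y : R) : `|x| <= 1 -> `|y| <= 1 -> `|x * y| <= 1.
Proof. by move=> x1 y1; rewrite normrM mulr_ile1. Qed.

Lemma norm_cutoff_le1 k (a b x : R) : `|cutoff k a b x| <= 1.
Proof. by rewrite ger0_norm ?cutoff_ge0 ?cutoff_le1. Qed.

(** A triangle is a countable union of rectangles with rational vertices. *)
Lemma ae_null_triangle (c d : R) (P : set plane) :
  (forall a1 a2 b1 b2 : R, c < b1 -> b1 < b2 -> b2 < a1 -> a1 < a2 -> a2 < d ->
    {ae area R, forall z, a1 < z.1 < a2 -> b1 < z.2 < b2 -> P z}) ->
  {ae area R, forall z, null_triangle c d z -> P z}.
Proof.
move=> H.
pose ok (q : (rat * rat) * (rat * rat)) (z : plane) :=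
  [/\ c < ratr q.2.1, ratr q.2.2 < ratr q.1.1 :> R & ratr q.1.2 < d] ->
   ratr q.1.1 < z.1 < ratr q.1.2 -> ratr q.2.1 < z.2 < ratr q.2.2 -> P z.
have okae q : {ae area R, forall z, ok q z}.
  have [[h1 h2 h3]|h] := pselect
    [/\ c < ratr q.2.1, ratr q.2.2 < ratr q.1.1 :> R & ratr q.1.2 < d]; last first.
    by apply: aeW => z /h.
  have [h4|h4] := pselect (ratr q.2.1 < ratr q.2.2 :> R); last first.
    by apply: aeW => z _ _ /andP[/lt_trans h5 /h5 /h4].
  have [h6|h6] := pselect (ratr q.1.1 < ratr q.1.2 :> R); last first.
    by apply: aeW => z _ /andP[/lt_trans h5 /h5 /h6].
  apply: (@filterS _ _ (ae_filter_ringOfSetsType (area R)) _ _ _ (H _ _ _ _ h1 h4 h2 h6 h3)).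
  by move=> z h _; exact: h.
have : {ae area R, forall z, forall n, if unpickle n is Some q then ok q z else True}.
  apply: ae_foralln => n; case: (unpickle n) => [q|]; first exact: okae.
  by apply: aeW.
apply: (@filterS _ _ (ae_filter_ringOfSetsType (area R))) => -[x y] h [/= cy yx xd].
have [q1 /[!in_itv] /= /andP[l1 r1]] := rat_in_itvoo cy.
have [q2 /[!in_itv] /= /andP[l2 r2]] := rat_in_itvoo yx.
have [q3 /[!in_itv] /= /andP[l3 r3]] := rat_in_itvoo r2.
have [q4 /[!in_itv] /= /andP[l4 r4]] := rat_in_itvoo xd.
have := h (pickle ((q3, q4), (q1, q2))); rewrite pickleK; apply => //=.
- by rewrite r3 l4.
- by rewrite r1 l2.
Qed.

End MeasurableTools.

(** The product measure is sigma-finite; this makes it available as a factor of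
    further product measures. *)
Section Planar.
Variable R : realType.
Local Notation mu := (@lebesgue_measure R).
Local Notation plane := (measurableTypeR R * measurableTypeR R)%type.

Definition planar : set plane -> \bar R := area R.

HB.instance Definition _ := Measure.on planar.

Let sigma_finite_planar : sigma_finite setT planar.
Proof.
have /sigma_finiteP[F [TF ndF Foo]] := sigma_finiteT mu.
exists (fun n => F n `*` F n).
  rewrite -setXTT {1}TF TF predeqE => -[x y]; split.
    move=> [/= [n _ Fnx] [k _ Gky]]; exists (maxn n k) => //; split.
    - by move: x Fnx; exact/subsetPset/ndF/leq_maxl.
    - by move: y Gky; exact/subsetPset/ndF/leq_maxr.
  by move=> [n _ []/= ? ?]; split; exists n.
move=> k; have [? ?] := Foo k.
split; first exact: measurableX.
by rewrite /planar product_measure1E// lte_mul_pinfty// ge0_fin_numE.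
Qed.

HB.instance Definition _ :=
  Measure_isSigmaFinite.Build _ _ _ planar sigma_finite_planar.

End Planar.

Section CutoffIntegrals.
Variable R : realType.
Local Notation mu := (@lebesgue_measure R).

Lemma measurable_cutoff k (a b : R) :
  measurable_fun [set: measurableTypeR R] (cutoff k a b).
Proof. by apply: continuous_measurable_fun; exact: continuous_cutoff. Qed.

Lemma measurable_cutoff' k (a b : R) :
  measurable_fun [set: measurableTypeR R] (cutoff' k a b).
Proof. by apply: continuous_measurable_fun; exact: continuous_cutoff'. Qed.

Lemma integrable_cutoff k (a b : R) : mu.-integrable setT (EFin \o cutoff k a b).
Proof.
apply: (@integrable_bounded_support _ (measurableTypeR R) R mu (cutoff k a b) 1 `[a, b]%classic) => //.
- by rewrite /= lebesgue_measure_itv /=; case: ifP => // _; rewrite -EFinB ltry.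
- exact: measurable_cutoff.
- by move=> x; rewrite ger0_norm ?cutoff_ge0 ?cutoff_le1.
- move=> x xab; apply: cutoff_out; apply/negP => /andP[/ltW ax /ltW xb].
  by apply: xab; rewrite /= in_itv /= ax xb.
Qed.

Lemma integrable_cutoff' k (a b : R) : mu.-integrable setT (EFin \o cutoff' k a b).
Proof.
have [C HC] := cutoff'_bounded k a b.
apply: (@integrable_bounded_support _ (measurableTypeR R) R mu (cutoff' k a b) C `[a, b]%classic) => //.
- by rewrite /= lebesgue_measure_itv /=; case: ifP => // _; rewrite -EFinB ltry.
- exact: measurable_cutoff'.
- move=> x xab; apply: cutoff'_out; apply/negP => /andP[/ltW ax /ltW xb].
  by apply: xab; rewrite /= in_itv /= ax xb.
Qed.

Lemma Rintegral_cutoff'_right k (a b s : R) :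
  \int[mu]_x (cutoff' k a b x * \1_(`]s, +oo[%classic) x) = - cutoff k a b s.
Proof.
pose e := Num.max s b + 1.
have se : s < e by rewrite /e ltr_pwDr// le_max lexx.
have be : b < e by rewrite /e ltr_pwDr// le_max lexx orbT.
have -> : \int[mu]_x (cutoff' k a b x * \1_(`]s, +oo[%classic) x) =
    \int[mu]_(x in `]s, e]) cutoff' k a b x.
  rewrite [RHS]RintegralE_indic; apply: eq_Rintegral => x _.
  have [xe|ex] := leP x e.
    by rewrite !indicE !mem_setE !in_itv /= xe andbT.
  by rewrite cutoff'_out ?mul0r// negb_and -!leNgt (ltW (lt_trans be ex)) orbT.
rewrite Rintegral_itv_obnd_cbnd; last first.
  by apply: integrableS (integrable_cutoff' k a b) => //; exact: measurable_itv.
rewrite /Rintegral (@continuous_FTC2 _ _ (cutoff k a b)) //=.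
- rewrite [cutoff k a b e]cutoff_out ?sub0r//.
  by rewrite negb_and -!leNgt (ltW be) orbT.
- by apply: continuous_subspaceT => x; exact: continuous_cutoff'.
- split.
  + by move=> x _; case: (is_derive_cutoff k a b x).
  + by apply: cvg_at_right_filter; exact: continuous_cutoff.
  + by apply: cvg_at_left_filter; exact: continuous_cutoff.
- by move=> x _; rewrite derive1E; case: (is_derive_cutoff k a b x).
Qed.

Lemma Rintegral_cutoff' k (a b : R) : \int[mu]_x cutoff' k a b x = 0.
Proof.
have := Rintegral_cutoff'_right k a b (a - 1).
rewrite cutoff_out ?oppr0; last by rewrite negb_and -!leNgt gerBl ler01.
move=> <-; apply: eq_Rintegral => x _.
have [ax|xa] := ltP (a - 1) x.
  by rewrite indicE mem_setE in_itv /= ax mulr1.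
by rewrite cutoff'_out ?mul0r// negb_and -!leNgt (le_trans xa)// gerBl ler01.
Qed.

Lemma cutoff_mean_gt0 (a b : R) : a < b -> 0 < \int[mu]_x cutoff 0 a b x.
Proof.
move=> ab; rewrite lt_def Rintegral_ge0 ?andbT; last by move=> x _; exact: cutoff_ge0.
apply/negP => /eqP I0.
have fi := integrable_cutoff 0 a b.
have : (\int[mu]_x `|(cutoff 0 a b x)%:E| = 0)%E.
  under eq_integral => x _ do rewrite gee0_abs ?lee_fin ?cutoff_ge0//.
  by move: I0 (integrable_fin_num measurableT fi); rewrite /Rintegral; case: (integral _ _ _) => //= r ->.
move/(ae_eq_integral_abs _ measurableT (measurable_int _ fi)).
move=> [N [mN N0 sub]].
have : (mu `]a, b[%classic <= mu N)%E.
  apply: le_measure; rewrite ?inE//.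
  move=> x /=; rewrite in_itv /= => /andP[ax xb]; apply: sub => /= /(_ I) /eqP.
  rewrite eqe; apply/negP; rewrite gt_eqF// /cutoff !mul1r.
  have f0 (y : R) : 0 < y -> 0 < flat 1 y.
    by move=> y0; rewrite /flat y0 mulr_gt0 ?expR_gt0// hornerE.
  by rewrite mulr_gt0// f0// subr_gt0.
by rewrite N0 lebesgue_measure_itv /= lte_fin ab -EFinB lee_fin leNgt subr_gt0 ab.
Qed.

End CutoffIntegrals.

Section Duhamel.
Variable R : realType.
Local Notation mu := (@lebesgue_measure R).
Local Notation plane := (measurableTypeR R * measurableTypeR R)%type.

Definition triangle_integral (F : plane -> R) (z : plane) : R :=
  \int[area R]_w (F w * \1_(null_triangle z.2 z.1) w).

(** The derivative of [triangle_integral F] in the first coordinate. *)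
Definition ray_integral (F : plane -> R) (z : plane) : R :=
  \int[mu]_y (F (z.1, y) * \1_(`]z.2, z.1[%classic) y).

Variable F : plane -> R.
Hypothesis Fi : (area R).-integrable setT (EFin \o F).

Let mF : measurable_fun setT F.
Proof. exact: measurable_of_integrable Fi. Qed.

Lemma measurable_ray_integral : measurable_fun setT (ray_integral F).
Proof.
pose f (w : plane * measurableTypeR R) : R :=
  F (w.1.1, w.2) * \1_([set w : plane * measurableTypeR R | w.1.2 < w.2] `&`
     [set w : plane * measurableTypeR R | w.2 < w.1.1]) w.
have mf : measurable_fun setT f.
  apply: measurable_funM.
    apply: (@measurableT_comp _ _ _ _ _ _ F) => //.
    apply: (@measurable_fun_pair _ _ _ _ _ _ (fun w : plane * measurableTypeR R => w.1.1) snd) => //.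
    by apply: measurableT_comp.
  apply: measurable_indic.
  have m11 : measurable_fun setT (fun w : plane * measurableTypeR R => w.1.1).
    by apply: measurableT_comp.
  have m12 : measurable_fun setT (fun w : plane * measurableTypeR R => w.1.2).
    by apply: measurableT_comp.
  by apply: measurableI; apply: measurable_set_ltr.
have := measurable_Rintegral_snd mu mf; congr (measurable_fun _ _).
apply/funext => z; apply: eq_Rintegral => y _; rewrite /f; congr (_ * _).
rewrite !indicE; congr (nat_of_bool _)%:R; apply/idP/idP; rewrite !inE /= in_itv /=.
  by move=> [-> ->].
by move=> /andP[].
Qed.

Lemma ray_integral_le z :
  (`|ray_integral F z|%:E <= \int[mu]_y `|F (z.1, y)|%:E)%E.
Proof.
have mFz : measurable_fun [set: measurableTypeR R] (fun y => F (z.1, y)).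
  apply: (@measurableT_comp _ _ _ _ _ _ F) => //.
have mI : measurable_fun [set: measurableTypeR R]
    (fun y : R => \1_(`]z.2, z.1[%classic) y : R) by apply: measurable_indic.
apply: (le_trans (abs_Rintegral_le _ _)); first exact: measurable_funM.
apply: ge0_le_integral => //.
- apply/measurable_EFinP; apply: measurableT_comp => //; exact: measurable_funM.
- by apply/measurable_EFinP; apply: measurableT_comp.
- by move=> y _; rewrite lee_fin normrM ler_piMr// norm_indic_le1.
Qed.

Lemma integrable_ray_integral (g : R -> R) : mu.-integrable setT (EFin \o g) ->
  (area R).-integrable setT (EFin \o (fun z => ray_integral F z * g z.2)).
Proof.
move=> gi; have mg : measurable_fun setT g by exact: measurable_of_integrable gi.
have mrg : measurable_fun setT (fun z : plane => ray_integral F z * g z.2).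
  apply: measurable_funM; first exact: measurable_ray_integral.
  exact: measurableT_comp.
apply/(integrable12ltyP mu mu); first exact/measurable_EFinP.
pose Phi (x : R) : \bar R := (\int[mu]_y `|F (x, y)|%:E)%E.
have mPhi : measurable_fun setT Phi.
  apply: (measurable_fun_fubini_tonelli_F (fun z => `|F z|%:E)) => //.
  by apply/measurable_EFinP; exact: measurableT_comp.
have Phi0 x : (0 <= Phi x)%E by apply: integral_ge0.
have PhiL : (\int[mu]_x Phi x < +oo)%E.
  by move/(integrable12ltyP mu mu (measurable_int _ Fi)): Fi.
have g0 : (0 <= \int[mu]_y `|(g y)%:E|)%E by exact: integral_ge0.
have gL : (\int[mu]_y `|(g y)%:E| < +oo)%E by case/integrableP : gi.
apply: (@le_lt_trans _ _ (\int[mu]_x (Phi x * \int[mu]_y `|(g y)%:E|))%E).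
  apply: ge0_le_integral => //.
  - by move=> x _; exact: integral_ge0.
  - apply: (measurable_fun_fubini_tonelli_F (fun z => `|(ray_integral F z * g z.2)%:E|%E)) => //.
    by apply: measurableT_comp => //; exact/measurable_EFinP.
  - by apply: emeasurable_funM.
  - move=> x _; rewrite -ge0_integralZl//; last first.
      by apply: measurableT_comp => //; exact/measurable_EFinP.
    apply: ge0_le_integral => //.
    + apply: measurableT_comp => //; apply/measurable_EFinP.
      exact: (measurableT_comp mrg).
    + apply: emeasurable_funM => //.
      by apply: measurableT_comp => //; exact/measurable_EFinP.
    + move=> y _; rewrite /= normrM EFinM; apply: lee_wpmul2r => //.
      exact: (ray_integral_le (x, y)).
rewrite ge0_integralZr//; apply: lte_mul_pinfty => //; first exact: integral_ge0.
by rewrite ge0_fin_numE//; exact: integral_ge0.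
Qed.

Lemma measurable_triangle_integral : measurable_fun setT (triangle_integral F).
Proof.
pose f (v : plane * plane) : R := F v.2 * \1_([set v : plane * plane | v.1.2 < v.2.2] `&`
   ([set v : plane * plane | v.2.2 < v.2.1] `&` [set v : plane * plane | v.2.1 < v.1.1])) v.
have mf : measurable_fun setT f.
  have m1 : measurable_fun setT (fun v : plane * plane => v.1.1) by apply: measurableT_comp.
  have m2 : measurable_fun setT (fun v : plane * plane => v.1.2) by apply: measurableT_comp.
  have m3 : measurable_fun setT (fun v : plane * plane => v.2.1) by apply: measurableT_comp.
  have m4 : measurable_fun setT (fun v : plane * plane => v.2.2) by apply: measurableT_comp.
  apply: measurable_funM; first exact: (measurableT_comp mF).
  apply: measurable_indic; apply: measurableI; first exact: measurable_set_ltr.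
  by apply: measurableI; exact: measurable_set_ltr.
have := measurable_Rintegral_snd (@planar R) mf; congr (measurable_fun _ _).
apply/funext => z; apply: eq_Rintegral => w _; rewrite /f; congr (_ * _).
rewrite !indicE; congr (nat_of_bool _)%:R; apply/idP/idP => /set_mem /=.
  by move=> [h1 [h2 h3]]; apply/mem_set.
by move=> [h1 h2 h3]; apply/mem_set.
Qed.

Lemma triangle_integral_bound : exists C, forall z, `|triangle_integral F z| <= C.
Proof.
exists (\int[area R]_w `|F w|) => z.
have iz : (area R).-integrable setT
    (EFin \o (fun w => F w * \1_(null_triangle z.2 z.1) w)).
  by apply: integrable_mul_indic => //; exact: measurable_null_triangle.
apply: (le_trans (le_normr_Rintegral measurableT iz)).
apply: le_Rintegral => //.
- exact: integrable_norm iz.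
- exact: integrable_norm Fi.
- by move=> w _; rewrite normrM ler_piMr// norm_indic_le1.
Qed.

(** Weak form of the derivative of [triangle_integral F] in its first variable.
    By Fubini, the contribution of a source at [w] is an integral of [cutoff' k a b]
    over the half-line above [w.1], that is [- cutoff k a b w.1]. *)
Lemma triangle_integral_cutoff k l (a b c d : R) :
  \int[area R]_z (triangle_integral F z * (cutoff' k a b z.1 * cutoff l c d z.2)) =
  - \int[area R]_z (ray_integral F z * (cutoff k a b z.1 * cutoff l c d z.2)).
Proof.
pose psi (z : plane) := cutoff' k a b z.1 * cutoff l c d z.2.
have psii : (area R).-integrable setT (EFin \o psi).
  by apply: integrable_tensor; [exact: integrable_cutoff'|exact: integrable_cutoff].
have cI := @integrable_cutoff R l c d.
have mlt d0 (T : measurableType d0) (f g : T -> R) : measurable_fun setT f ->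
    measurable_fun setT g -> measurable_fun setT (\1_[set x | f x < g x] : T -> R).
  by move=> mf mg; apply: measurable_indic; exact: measurable_set_ltr.
(* [H] unfolds the integral over the ray and [E] the one over the triangle;
   integrating out the test variables leaves [G] and [- G] *)
pose X2 (y : R) : R := \int[mu]_x (cutoff l c d x * \1_(`]-oo, y[%classic) x).
pose H (v : plane * measurableTypeR R) : R :=
  F v.1 * cutoff l c d v.2 * (\1_[set v : plane * measurableTypeR R | v.1.2 < v.1.1] v *
   \1_[set v : plane * measurableTypeR R | v.2 < v.1.2] v * cutoff k a b v.1.1).
pose G (w : plane) := F w * (\1_[set w : plane | w.2 < w.1] w * cutoff k a b w.1 * X2 w.2).
have m11 : measurable_fun setT (fun w : plane * measurableTypeR R => w.1.1).
  by apply: measurableT_comp.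
have m12 : measurable_fun setT (fun w : plane * measurableTypeR R => w.1.2).
  by apply: measurableT_comp.
have Hi : (@planar R \x mu)%E.-integrable setT (EFin \o H).
  apply: (@integrable_mul_bounded _ _ _ _ _ _ 1).
  - exact: (@integrable_tensor _ _ _ _ R (@planar R) mu F (cutoff l c d) Fi cI).
  - apply: measurable_funM; last by apply: (measurableT_comp (measurable_cutoff _ _ _)).
    by apply: measurable_funM; apply: mlt.
  - by move=> v; apply: norm_mul_le1; [apply: norm_mul_le1; exact: norm_indic_le1|exact: norm_cutoff_le1].
have HGx w : \int[mu]_y H (w, y) = G w.
  rewrite /G /H /X2 /=.
  rewrite [RHS](_ : _ = (F w * \1_[set w : plane | w.2 < w.1] w * cutoff k a b w.1) *
    \int[mu]_x (cutoff l c d x * \1_(`]-oo, w.2[%classic) x)); last by ring.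
  rewrite -RintegralZl//; last first.
    exact: integrable_mul_indic.
  apply: eq_Rintegral => y _.
  have -> : \1_[set v : plane * measurableTypeR R | v.2 < v.1.2] (w, y) =
      \1_(`]-oo, w.2[%classic) y :> R.
    by rewrite !indicE; congr (nat_of_bool _)%:R; apply/idP/idP; rewrite !inE /= in_itv.
  have -> : \1_[set v : plane * measurableTypeR R | v.1.2 < v.1.1] (w, y) =
      \1_[set w : plane | w.2 < w.1] w :> R.
    by rewrite !indicE; congr (nat_of_bool _)%:R; apply/idP/idP; rewrite !inE.
  by ring.
have HG : \int[(@planar R \x mu)%E]_v H v = \int[@planar R]_w G w.
  by rewrite (Rfubini12 Hi); apply: eq_Rintegral => w _.
transitivity (- \int[@planar R]_w G w); last first.
  congr (- _); rewrite -HG (Rfubini12 Hi).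
  rewrite (Rfubini12 (integrable_Rintegral_snd Hi)) /=.
  have Ki : (area R).-integrable setT
     (EFin \o (fun z => ray_integral F z * (cutoff k a b z.1 * cutoff l c d z.2))).
    rewrite (_ : (fun z => _) = (fun z : plane => ray_integral F z * cutoff l c d z.2 * cutoff k a b z.1)).
      apply: (@integrable_mul_bounded _ _ _ _ _ _ 1).
      - exact: integrable_ray_integral.
      - by apply: (measurableT_comp (measurable_cutoff _ _ _)).
      - by move=> z; exact: norm_cutoff_le1.
    by apply/funext => z; ring.
  rewrite (Rfubini12 Ki) /=.
  congr fine; apply: ae_eq_integral => //.
  - exact: measurable_int (integrable_Rintegral_snd (integrable_Rintegral_snd Hi)).
  - exact: measurable_int (integrable_Rintegral_snd Ki).
  have := ae_integrable1 Fi.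
  apply: (@filterS _ _ (ae_filter_ringOfSetsType mu)) => x Fx _ /=; congr EFin.
  pose Hx (v : plane) : R := F (x, v.1) * cutoff l c d v.2 *
    (\1_[set v : plane | v.1 < x] v * \1_[set v : plane | v.2 < v.1] v * cutoff k a b x).
  have Hxi : (area R).-integrable setT (EFin \o Hx).
    apply: (@integrable_mul_bounded _ _ _ _ _ _ 1).
    - exact: (integrable_tensor Fx cI).
    - apply: measurable_funM => //.
      by apply: measurable_funM; apply: mlt.
    - by move=> v; apply: norm_mul_le1; [apply: norm_mul_le1; exact: norm_indic_le1|exact: norm_cutoff_le1].
  transitivity (\int[mu]_y \int[mu]_e Hx (y, e)).
    apply: eq_Rintegral => y _; apply: eq_Rintegral => e _.
    by rewrite /H /Hx /= !indicE.
  rewrite -(Rfubini12 Hxi) (Rfubini21 Hxi).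
  apply: eq_Rintegral => e _; rewrite /ray_integral /=.
  rewrite [RHS]mulrC -RintegralZl//; last first.
    exact: integrable_mul_indic.
  apply: eq_Rintegral => y _; rewrite /Hx /=.
  have -> : \1_(`]e, x[%classic) y = \1_[set v : plane | v.1 < x] (y, e) *
      \1_[set v : plane | v.2 < v.1] (y, e) :> R.
    rewrite !indicE -natrM mulnb; congr (nat_of_bool _)%:R.
    apply/idP/andP; rewrite !inE /= in_itv /=; first by move=> /andP[-> ->].
    by move=> [-> ->].
  by ring.
pose E (v : plane * plane) : R := F v.1 * psi v.2 *
  (\1_[set v : plane * plane | v.2.2 < v.1.2] v * \1_[set v : plane * plane | v.1.2 < v.1.1] v *
   \1_[set v : plane * plane | v.1.1 < v.2.1] v).
have mm : [/\ measurable_fun setT (fun v : plane * plane => v.1.1),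
    measurable_fun setT (fun v : plane * plane => v.1.2),
    measurable_fun setT (fun v : plane * plane => v.2.1) &
    measurable_fun setT (fun v : plane * plane => v.2.2)].
  by split; apply: measurableT_comp.
have Ei : (@planar R \x @planar R)%E.-integrable setT (EFin \o E).
  apply: (@integrable_mul_bounded _ _ _ _ _ _ 1).
  - exact: (@integrable_tensor _ _ _ _ R (@planar R) (@planar R) F psi Fi psii).
  - case: mm => *; apply: measurable_funM; last by apply: mlt.
    by apply: measurable_funM; apply: mlt.
  - by move=> v; apply: norm_mul_le1; [apply: norm_mul_le1; exact: norm_indic_le1|exact: norm_indic_le1].
transitivity (\int[@planar R]_z \int[@planar R]_w E (w, z)).
  apply: eq_Rintegral => z _; rewrite /triangle_integral mulrC -RintegralZl//; last first.
    by apply: integrable_mul_indic => //; exact: measurable_null_triangle.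
  apply: eq_Rintegral => w _; rewrite /E /= -/(psi z).
  have -> : \1_(null_triangle z.2 z.1) w =
     \1_[set v : plane * plane | v.2.2 < v.1.2] (w, z) * \1_[set v : plane * plane | v.1.2 < v.1.1] (w, z) *
   \1_[set v : plane * plane | v.1.1 < v.2.1] (w, z) :> R.
    rewrite !indicE -!natrM !mulnb; congr (nat_of_bool _)%:R.
    apply/idP/idP => [/set_mem [h1 h2 h3]|].
      by rewrite !mem_set.
    by move=> /andP[/andP[/set_mem /= h1 /set_mem /= h2] /set_mem /= h3]; apply/mem_set.
  by ring.
rewrite -(Rfubini21 Ei) (Rfubini12 Ei).
rewrite -mulN1r -RintegralZl//; last first.
  rewrite (_ : EFin \o G = EFin \o fun w => \int[mu]_x H (w, x)).
    exact: (integrable_Rintegral_snd Hi).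
  by apply/funext => w /=; rewrite HGx.
apply: eq_Rintegral => w _.
rewrite [LHS](_ : _ = \int[area R]_z ((F w * \1_[set w : plane | w.2 < w.1] w) *
   (cutoff' k a b z.1 * \1_(`]w.1, +oo[%classic) z.1 *
    (cutoff l c d z.2 * \1_(`]-oo, w.2[%classic) z.2)))); last first.
  apply: eq_Rintegral => z _; rewrite /E /psi /=.
  have -> : \1_(`]w.1, +oo[%classic) z.1 = \1_[set v : plane * plane | v.1.1 < v.2.1] (w, z) :> R.
    by rewrite !indicE; congr (nat_of_bool _)%:R; apply/idP/idP; rewrite !inE /= in_itv /= andbT.
  have -> : \1_(`]-oo, w.2[%classic) z.2 = \1_[set v : plane * plane | v.2.2 < v.1.2] (w, z) :> R.
    by rewrite !indicE; congr (nat_of_bool _)%:R; apply/idP/idP; rewrite !inE /= in_itv.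
  have -> : \1_[set w : plane | w.2 < w.1] w = \1_[set v : plane * plane | v.1.2 < v.1.1] (w, z) :> R.
    by rewrite !indicE; congr (nat_of_bool _)%:R; apply/idP/idP; rewrite !inE.
  by ring.
have i1 : mu.-integrable setT (EFin \o (fun x => cutoff' k a b x * \1_(`]w.1, +oo[%classic) x)).
  by apply: integrable_mul_indic => //; exact: integrable_cutoff'.
have i2 : mu.-integrable setT (EFin \o (fun x => cutoff l c d x * \1_(`]-oo, w.2[%classic) x)).
  exact: integrable_mul_indic.
rewrite RintegralZl//; last exact: (integrable_tensor i1 i2).
rewrite (Rintegral_tensor i1 i2) Rintegral_cutoff'_right /G -/(X2 w.2).
by ring.
Qed.

End Duhamel.

(** * Derivatives along characteristics *)

Section CharacteristicSolution.
Variable R : realType.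
Local Notation mu := (@lebesgue_measure R).
Local Notation plane := (measurableTypeR R * measurableTypeR R)%type.

(** One component of a mild solution, in characteristic coordinates on the triangle
    over the interval from [c0] to [d0].  [al] and [be] are the travelling waves of
    d'Alembert's formula, and [p] is the weak form of twice the derivative of [U]
    in the first coordinate. *)
Definition characteristic_solution (c0 d0 : R) (al be : R -> R)
    (U p F : plane -> R) : Prop :=
  [/\ mu.-integrable setT (EFin \o al) /\ mu.-integrable setT (EFin \o be),
      (area R).-integrable setT (EFin \o F),
      forall z, null_triangle c0 d0 z ->
        U z = al z.1 + be z.2 + 4^-1 * triangle_integral F z,
      forall a1 a2 b1 b2, c0 < b1 -> b2 < a1 -> a2 < d0 ->
        (area R).-integrable setT (EFin \o (fun z : plane =>
          p z * (\1_(`[a1, a2]%classic) z.1 * \1_(`[b1, b2]%classic) z.2))) &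
      forall k l a b c d, c0 < c -> c < d -> d < a -> a < b -> b < d0 ->
        \int[area R]_z (p z * (cutoff k a b z.1 * cutoff l c d z.2)) =
        - 2 * \int[area R]_z (U z * (cutoff' k a b z.1 * cutoff l c d z.2))].

Lemma cutoff_indic k (a b x : R) :
  cutoff k a b x = \1_(`[a, b]%classic) x * cutoff k a b x.
Proof.
rewrite indicE; have [_|] := boolP (x \in `[a, b]%classic); first by rewrite mul1r.
rewrite mem_setE in_itv /= => xab; rewrite mul0r cutoff_out//.
by apply: contra xab => /andP[/ltW-> /ltW->].
Qed.

Lemma integrable_indic_segment (a b : R) :
  mu.-integrable setT (EFin \o (\1_(`[a, b]%classic) : R -> R)).
Proof. exact: (integrable_indic_itv a b true false). Qed.

Lemma measurable_fst_fun (f : R -> R) : measurable_fun [set: measurableTypeR R] f ->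
  measurable_fun [set: plane] (fun z : plane => f z.1).
Proof. by move=> mf; apply: (measurableT_comp mf). Qed.

Lemma measurable_snd_fun (f : R -> R) : measurable_fun [set: measurableTypeR R] f ->
  measurable_fun [set: plane] (fun z : plane => f z.2).
Proof. by move=> mf; apply: (measurableT_comp mf). Qed.

Lemma integrable_cutoff_mul (h : plane -> R) k l (a b c d : R) :
  (area R).-integrable setT (EFin \o (fun z : plane =>
    h z * (\1_(`[a, b]%classic) z.1 * \1_(`[c, d]%classic) z.2))) ->
  (area R).-integrable setT (EFin \o (fun z : plane =>
    h z * (cutoff k a b z.1 * cutoff l c d z.2))).
Proof.
move=> hi.
rewrite (_ : (fun z => _) = (fun z : plane =>
    (h z * (\1_(`[a, b]%classic) z.1 * \1_(`[c, d]%classic) z.2)) *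
    (cutoff k a b z.1 * cutoff l c d z.2))); last first.
  by apply/funext => z; rewrite {1}(cutoff_indic k) {1}(cutoff_indic l); ring.
apply: (@integrable_mul_bounded _ _ _ _ _ _ 1) => //.
  apply: measurable_funM.
    exact: (measurable_fst_fun (measurable_cutoff _ _ _)).
  exact: (measurable_snd_fun (measurable_cutoff _ _ _)).
by move=> z; apply: norm_mul_le1; exact: norm_cutoff_le1.
Qed.

Lemma integrable_ray_rectangle (F : plane -> R) (a b c d : R) :
  (area R).-integrable setT (EFin \o F) ->
  (area R).-integrable setT (EFin \o (fun z : plane =>
    ray_integral F z * (\1_(`[a, b]%classic) z.1 * \1_(`[c, d]%classic) z.2))).
Proof.
move=> Fi.
rewrite (_ : (fun z => _) = (fun z : plane =>
    (ray_integral F z * \1_(`[c, d]%classic) z.2) * \1_(`[a, b]%classic) z.1)); last first.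
  by apply/funext => z; ring.
apply: (@integrable_mul_bounded _ _ _ _ _ _ 1).
- by apply: integrable_ray_integral => //; exact: integrable_indic_segment.
- by apply: (@measurable_fst_fun (\1_(`[a, b]%classic))); exact: measurable_indic.
- by move=> z; exact: norm_indic_le1.
Qed.

Section Core.
Variables (c0 d0 : R) (al be : R -> R) (U p F : plane -> R).
Hypothesis sol : characteristic_solution c0 d0 al be U p F.

Let r (z : plane) := p z - 2^-1 * ray_integral F z.

Lemma integrable_remainder_rectangle a1 a2 b1 b2 : c0 < b1 -> b2 < a1 -> a2 < d0 ->
  (area R).-integrable setT (EFin \o (fun z : plane =>
    r z * (\1_(`[a1, a2]%classic) z.1 * \1_(`[b1, b2]%classic) z.2))).
Proof.
case: sol => _ Fi _ pint _ cb ba ad.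
rewrite (_ : (fun z => _) = (fun z : plane =>
    p z * (\1_(`[a1, a2]%classic) z.1 * \1_(`[b1, b2]%classic) z.2) -
    2^-1 * (ray_integral F z * (\1_(`[a1, a2]%classic) z.1 * \1_(`[b1, b2]%classic) z.2)))).
  apply: integrable_subr; first exact: pint.
  by apply: integrable_scaler; exact: integrable_ray_rectangle.
by apply/funext => z; rewrite /r; ring.
Qed.

(* [S] is the part of the travelling waves, [T] that of the source *)
Let T k l a b c d (z : plane) :=
  triangle_integral F z * (cutoff' k a b z.1 * cutoff l c d z.2).
Let S k l a b c d (z : plane) := (al z.1 * cutoff' k a b z.1) * cutoff l c d z.2 +
     cutoff' k a b z.1 * (be z.2 * cutoff l c d z.2).

Lemma solution_cutoff' k l a b c d : c0 < c -> d < a -> b < d0 ->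
  [/\ (area R).-integrable setT (EFin \o S k l a b c d),
      (area R).-integrable setT (EFin \o T k l a b c d) &
      (fun z : plane => U z * (cutoff' k a b z.1 * cutoff l c d z.2)) =
      (fun z => S k l a b c d z + 4^-1 * T k l a b c d z)].
Proof.
move=> cc da bd.
have := sol => -[[ali bei] Fi UE pint pE].
have [C HC] := cutoff'_bounded k a b.
have al' : mu.-integrable setT (EFin \o (fun x => al x * cutoff' k a b x)).
  by apply: (@integrable_mul_bounded _ _ _ _ _ _ C) => //; exact: measurable_cutoff'.
have be' : mu.-integrable setT (EFin \o (fun x => be x * cutoff l c d x)).
  apply: (@integrable_mul_bounded _ _ _ _ _ _ 1) => //; first exact: measurable_cutoff.
  exact: norm_cutoff_le1.
have cI := @integrable_cutoff R l c d.
have cI' := @integrable_cutoff' R k a b.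
have t1 := integrable_tensor al' cI.
have t2 := integrable_tensor cI' be'.
split.
- exact: (integrable_addr t1 t2).
- have [C' HC'] := triangle_integral_bound Fi.
  rewrite (_ : T k l a b c d = fun z : plane => (cutoff' k a b z.1 * cutoff l c d z.2) * triangle_integral F z).
    apply: (@integrable_mul_bounded _ _ _ _ _ _ C') => //.
      exact: (integrable_tensor cI' cI).
    exact: measurable_triangle_integral.
  by apply/funext => z; rewrite /T mulrC.
apply/funext => z; have [zT|zT] := pselect (null_triangle c0 d0 z).
  by rewrite UE// /T /S; ring.
suff [z0|z0] : cutoff' k a b z.1 = 0 \/ cutoff l c d z.2 = 0.
- by rewrite /T /S z0; ring.
- by rewrite /T /S z0; ring.
have [z1|z1] := boolP (a < z.1 < b); last by left; exact: cutoff'_out.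
have [z2|z2] := boolP (c < z.2 < d); last by right; exact: cutoff_out.
exfalso; apply: zT; case/andP: z1 => z1 z1'; case/andP: z2 => z2 z2'.
by split; [exact: lt_trans cc z2|exact: (lt_trans z2' (lt_trans da z1))|exact: lt_trans z1' bd].
Qed.

Lemma integrable_solution_cutoff' k l a b c d : c0 < c -> d < a -> b < d0 ->
  (area R).-integrable setT (EFin \o (fun z : plane => U z * (cutoff' k a b z.1 * cutoff l c d z.2))).
Proof.
move=> cc da bd; have [Si Ti ->] := solution_cutoff' k l cc da bd.
exact: (integrable_addr Si (integrable_scaler _ Ti)).
Qed.

(** In the weak sense [r] is the derivative of [2 * al], hence a function of the
    first coordinate alone: [be] disappears because [cutoff'] has mean zero, and
    the source is compensated by [triangle_integral_cutoff]. *)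
Lemma remainder_cutoff k l a b c d :
  c0 < c -> c < d -> d < a -> a < b -> b < d0 ->
  \int[area R]_z (r z * (cutoff k a b z.1 * cutoff l c d z.2)) =
  - 2 * (\int[mu]_x (al x * cutoff' k a b x)) * \int[mu]_y cutoff l c d y.
Proof.
move=> cc cd da ab bd.
have := sol => -[[ali bei] Fi UE pint pE].
have [C HC] := cutoff'_bounded k a b.
have ri := integrable_cutoff_mul k l (integrable_ray_rectangle a b c d Fi).
have pi := integrable_cutoff_mul k l (pint a b c d cc da bd).
have al' : mu.-integrable setT (EFin \o (fun x => al x * cutoff' k a b x)).
  by apply: (@integrable_mul_bounded _ _ _ _ _ _ C) => //; exact: measurable_cutoff'.
have be' : mu.-integrable setT (EFin \o (fun x => be x * cutoff l c d x)).
  apply: (@integrable_mul_bounded _ _ _ _ _ _ 1) => //; first exact: measurable_cutoff.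
  exact: norm_cutoff_le1.
have cI := @integrable_cutoff R l c d.
have cI' := @integrable_cutoff' R k a b.
have t1 := integrable_tensor al' cI.
have t2 := integrable_tensor cI' be'.
have TE := triangle_integral_cutoff Fi k l a b c d.
have [t12 TiZ UT] := solution_cutoff' k l cc da bd.
have riZ : (area R).-integrable setT (EFin \o (fun z : plane =>
    2^-1 * (ray_integral F z * (cutoff k a b z.1 * cutoff l c d z.2)))).
  exact: integrable_scaler.
rewrite (_ : (fun z => _) = (fun z : plane => p z * (cutoff k a b z.1 * cutoff l c d z.2) -
   2^-1 * (ray_integral F z * (cutoff k a b z.1 * cutoff l c d z.2)))); last first.
  by apply/funext => z; rewrite /r; ring.
have TiZ' : (area R).-integrable setT (EFin \o (fun z => 4^-1 * T k l a b c d z)).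
  exact: integrable_scaler.
rewrite RintegralB// pE// UT RintegralD// [\int[_]_z S _ _ _ _ _ _ _]RintegralD// !RintegralZl//.
rewrite (Rintegral_tensor al' cI) (Rintegral_tensor cI' be') TE Rintegral_cutoff'.
by field.
Qed.

End Core.

Lemma cutoff_indic_sub k (a b a1 a2 x : R) : a1 <= a -> b <= a2 ->
  \1_(`[a1, a2]%classic) x * cutoff k a b x = cutoff k a b x.
Proof.
move=> aa bb; rewrite indicE; have [_|] := boolP (x \in `[a1, a2]%classic).
  by rewrite mul1r.
rewrite mem_setE in_itv /= => xab; rewrite mul0r cutoff_out//.
by apply: contra xab => /andP[/ltW ax /ltW xb]; rewrite (le_trans aa)// (le_trans xb).
Qed.

Lemma cutoff_degenerate k (a b x : R) : b <= a -> cutoff k a b x = 0.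
Proof.
move=> ba; apply: cutoff_out; apply/negP => /andP[ax xb].
by have := lt_trans ax xb; rewrite ltNge ba.
Qed.

Lemma ae_eq0_of_cutoffs_triangle (c0 d0 : R) (h : plane -> R) :
  (forall a1 a2 b1 b2, c0 < b1 -> b2 < a1 -> a2 < d0 ->
    (area R).-integrable setT (EFin \o (fun z : plane =>
      h z * (\1_(`[a1, a2]%classic) z.1 * \1_(`[b1, b2]%classic) z.2)))) ->
  (forall k a b c d, c0 < c -> c < d -> d < a -> a < b -> b < d0 ->
    \int[area R]_z (h z * (cutoff k a b z.1 * cutoff k c d z.2)) = 0) ->
  {ae area R, forall z, null_triangle c0 d0 z -> h z = 0}.
Proof.
move=> hint h0; apply: ae_null_triangle => a1 a2 b1 b2 cb b12 ba a12 ad.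
have hi := hint a1 a2 b1 b2 cb ba ad.
apply: (@filterS _ _ (ae_filter_ringOfSetsType (area R)) _ _ _
  (ae_eq0_of_cutoffs hi (a1 := a1) (a2 := a2) (b1 := b1) (b2 := b2) _)) => [z H za zb|].
  have := H za zb; case/andP: za => /ltW za1 /ltW za2; case/andP: zb => /ltW zb1 /ltW zb2.
  by rewrite !indicE !mem_setE !in_itv /= za1 za2 zb1 zb2 !mulr1.
move=> k a b c d aa bb cc dd.
rewrite (_ : (fun z => _) = (fun z : plane =>
    h z * (cutoff k a b z.1 * cutoff k c d z.2))); last first.
  apply/funext => z.
  rewrite -[in RHS](cutoff_indic_sub k z.1 aa bb) -[in RHS](cutoff_indic_sub k z.2 cc dd).
  by ring.
have [ab|ba'] := ltP a b; last first.
  rewrite (_ : (fun z => _) = (fun=> 0)) ?Rintegral_cst ?mul0r//.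
  by apply/funext => z; rewrite cutoff_degenerate// mul0r mulr0.
have [cd|dc'] := ltP c d; last first.
  rewrite (_ : (fun z => _) = (fun=> 0)) ?Rintegral_cst ?mul0r//.
  by apply/funext => z; rewrite [cutoff k c d _]cutoff_degenerate// mulr0 mulr0.
apply: h0 => //.
- exact: lt_le_trans cc.
- by apply: (le_lt_trans dd); exact: lt_le_trans aa.
- exact: le_lt_trans ad.
Qed.

(** Without initial data, the remainder is orthogonal to all cut-offs. *)
Lemma derivative_of_zero_data (c0 d0 : R) (U p F : plane -> R) :
  characteristic_solution c0 d0 (fun=> 0) (fun=> 0) U p F ->
  {ae area R, forall z, null_triangle c0 d0 z -> p z = 2^-1 * ray_integral F z}.
Proof.
move=> sol.
apply: (@filterS _ _ (ae_filter_ringOfSetsType (area R)) _ _ _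
  (@ae_eq0_of_cutoffs_triangle c0 d0 (fun z => p z - 2^-1 * ray_integral F z) _ _)).
- by move=> z h zT; apply/eqP; rewrite -subr_eq0; apply/eqP; exact: h.
- exact: integrable_remainder_rectangle sol.
- move=> k a b c d cc cd da ab bd; rewrite (remainder_cutoff sol)//.
  under eq_Rintegral => x _ do rewrite mul0r.
  by rewrite Rintegral_cst// mul0r mulr0 mul0r.
Qed.

(** Since the remainder depends on the first coordinate alone, it equals its
    average in the second one against any fixed cut-off, and this average is an
    integrable function of the first coordinate.  The cut-off is supported between
    [c0] and [c], where the remainder is controlled for all first coordinates
    between [c] and [d]. *)
Lemma derivative_along_characteristics (c0 d0 c d : R) al be (U p F : plane -> R) :
  c0 < c -> c < d -> d < d0 ->
  characteristic_solution c0 d0 al be U p F ->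
  exists2 A : R -> R, mu.-integrable setT (EFin \o A) &
    {ae area R, forall z, null_triangle c d z ->
      p z = A z.1 + 2^-1 * ray_integral F z}.
Proof.
move=> cc cd dd sol.
pose r (z : plane) := p z - 2^-1 * ray_integral F z.
pose e1 := c0 + (c - c0) / 3; pose e2 := c0 + (c - c0) / 3 * 2.
have ce1 : c0 < e1 by rewrite /e1; lra.
have e12 : e1 < e2 by rewrite /e1 /e2; lra.
have e2c : e2 < c by rewrite /e2; lra.
pose m := \int[mu]_y cutoff 0 e1 e2 y.
have m0 : 0 < m by exact: cutoff_mean_gt0.
pose q (z : plane) := r z * (\1_(`[c, d]%classic) z.1 * \1_(`[e1, e2]%classic) z.2) *
   cutoff 0 e1 e2 z.2.
have qi : (area R).-integrable setT (EFin \o q).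
  apply: (@integrable_mul_bounded _ _ _ _ _ _ 1).
  - exact: (integrable_remainder_rectangle sol).
  - exact: (measurable_snd_fun (measurable_cutoff _ _ _)).
  - by move=> z; exact: norm_cutoff_le1.
pose A x := m^-1 * \int[mu]_y q (x, y).
have Ai : mu.-integrable setT (EFin \o A).
  exact: (integrable_scaler _ (integrable_Rintegral_snd qi)).
exists A => //.
have AI (a b c' d' : R) : (area R).-integrable setT (EFin \o (fun z : plane =>
    A z.1 * (\1_(`[a, b]%classic) z.1 * \1_(`[c', d']%classic) z.2))).
  rewrite (_ : (fun z => _) = (fun z : plane =>
     (A z.1 * \1_(`[a, b]%classic) z.1) * \1_(`[c', d']%classic) z.2)).
    apply: (@integrable_tensor _ _ _ _ R mu mu (fun x => A x * \1_(`[a, b]%classic) x)); last exact: integrable_indic_segment.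
    exact: integrable_mul_indic.
  by apply/funext => z; rewrite mulrA.
apply: (@filterS _ _ (ae_filter_ringOfSetsType (area R)) _ _ _
  (@ae_eq0_of_cutoffs_triangle c d (fun z => r z - A z.1) _ _)).
- move=> z h zT; have := h zT; rewrite /r => /eqP; rewrite subr_eq0 subr_eq => /eqP ->.
  by [].
- move=> a1 a2 b1 b2 cb ba ad.
  rewrite (_ : (fun z => _) = (fun z : plane =>
     r z * (\1_(`[a1, a2]%classic) z.1 * \1_(`[b1, b2]%classic) z.2) -
     A z.1 * (\1_(`[a1, a2]%classic) z.1 * \1_(`[b1, b2]%classic) z.2))); last first.
    by apply/funext => z; rewrite mulrBl.
  apply: integrable_subr; last exact: AI.
  by apply: (integrable_remainder_rectangle sol) => //; [exact: lt_trans cb|exact: lt_trans dd].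
- move=> k a b c' d' cc' cd' da ab bd.
  have cc0 : c0 < c' := lt_trans cc cc'.
  have bd0 : b < d0 := lt_trans bd dd.
  have ca : c < a := lt_trans cc' (lt_trans cd' da).
  have i1 : (area R).-integrable setT (EFin \o (fun z : plane =>
      r z * (cutoff k a b z.1 * cutoff k c' d' z.2))).
    by apply: integrable_cutoff_mul; exact: (integrable_remainder_rectangle sol).
  have i2 : (area R).-integrable setT (EFin \o (fun z : plane =>
      A z.1 * (cutoff k a b z.1 * cutoff k c' d' z.2))).
    exact: integrable_cutoff_mul.
  have Ac : mu.-integrable setT (EFin \o (fun x => A x * cutoff k a b x)).
    apply: (@integrable_mul_bounded _ _ _ _ _ _ 1) => //; first exact: measurable_cutoff.
    exact: norm_cutoff_le1.
  rewrite (_ : (fun z => _) = (fun z : plane =>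
     r z * (cutoff k a b z.1 * cutoff k c' d' z.2) -
     A z.1 * (cutoff k a b z.1 * cutoff k c' d' z.2))); last first.
    by apply/funext => z; rewrite mulrBl.
  rewrite RintegralB// (remainder_cutoff sol)//.
  rewrite [X in _ - X](_ : _ = (\int[mu]_x (A x * cutoff k a b x)) *
      \int[mu]_y cutoff k c' d' y); last first.
    rewrite -(Rintegral_tensor Ac (integrable_cutoff k c' d')).
    by apply: eq_Rintegral => z _; rewrite mulrA.
  rewrite (_ : \int[mu]_x (A x * cutoff k a b x) =
      - 2 * \int[mu]_x (al x * cutoff' k a b x)) ?subrr//.
  have qc : (area R).-integrable setT (EFin \o (fun z : plane => q z * cutoff k a b z.1)).
    apply: (@integrable_mul_bounded _ _ _ _ _ _ 1) => //.
      exact: (measurable_fst_fun (measurable_cutoff _ _ _)).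
    by move=> z; exact: norm_cutoff_le1.
  have key : \int[mu]_x (A x * cutoff k a b x) =
      m^-1 * \int[area R]_z (q z * cutoff k a b z.1).
    rewrite (Rfubini12 qc) -RintegralZl//; last exact: (integrable_Rintegral_snd qc).
    have := ae_integrable1 qi => H.
    congr fine; apply: ae_eq_integral => //.
    + exact: measurable_int Ac.
    + apply/measurable_EFinP; apply: measurable_funM => //.
      exact: measurable_of_integrable (integrable_Rintegral_snd qc).
    apply: (@filterS _ _ (ae_filter_ringOfSetsType mu) _ _ _ H) => x qx _.
    congr EFin; rewrite /A -mulrA; congr (_ * _).
    exact: esym (RintegralZr _ measurableT qx).
  rewrite key (_ : (fun z => _) = (fun z : plane => r z * (cutoff k a b z.1 * cutoff 0 e1 e2 z.2))).
    rewrite (remainder_cutoff sol)//; last exact: lt_trans ca.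
    by rewrite -/m mulrCA mulrA -mulrA mulVf ?mulr1// gt_eqF.
  apply/funext => z; rewrite /q.
  rewrite -[in RHS](cutoff_indic_sub k z.1 (ltW ca) (ltW bd)).
  by rewrite [in RHS](cutoff_indic 0); ring.
Qed.

(** * Linearity and reflection *)

Lemma characteristic_solutionB c0 d0 al be (U1 p1 F1 U2 p2 F2 : plane -> R) :
  characteristic_solution c0 d0 al be U1 p1 F1 ->
  characteristic_solution c0 d0 al be U2 p2 F2 ->
  characteristic_solution c0 d0 (fun=> 0) (fun=> 0)
    (fun z => U1 z - U2 z) (fun z => p1 z - p2 z) (fun z => F1 z - F2 z).
Proof.
move=> sol1 sol2.
have [_ F1i U1E p1i p1E] := sol1; have [_ F2i U2E p2i p2E] := sol2.
split.
- by split; exact: integrable0.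
- exact: integrable_subr.
- move=> z zT; rewrite U1E// U2E//.
  have triB : triangle_integral (fun z => F1 z - F2 z) z =
      triangle_integral F1 z - triangle_integral F2 z.
    rewrite /triangle_integral -RintegralB//.
    - by apply: eq_Rintegral => w _; rewrite mulrBl.
    - by apply: integrable_mul_indic => //; exact: measurable_null_triangle.
    - by apply: integrable_mul_indic => //; exact: measurable_null_triangle.
  by rewrite triB; ring.
- move=> a1 a2 b1 b2 cb ba ad.
  rewrite (_ : (fun z => _) = (fun z : plane =>
     p1 z * (\1_(`[a1, a2]%classic) z.1 * \1_(`[b1, b2]%classic) z.2) -
     p2 z * (\1_(`[a1, a2]%classic) z.1 * \1_(`[b1, b2]%classic) z.2))).
    by apply: integrable_subr; [exact: p1i|exact: p2i].
  by apply/funext => z; rewrite mulrBl.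
- move=> k l a b c d cc cd da ab bd.
  under eq_Rintegral => z _ do rewrite mulrBl.
  rewrite RintegralB//; last 2 first.
    by apply: integrable_cutoff_mul; exact: p1i.
    by apply: integrable_cutoff_mul; exact: p2i.
  under [in RHS]eq_Rintegral => z _ do rewrite mulrBl.
  rewrite [in RHS]RintegralB//; last 2 first.
    exact: (integrable_solution_cutoff' sol1).
    exact: (integrable_solution_cutoff' sol2).
  by rewrite p1E// p2E//; ring.
Qed.

Lemma integrable_opp (f : R -> R) : mu.-integrable setT (EFin \o f) ->
  mu.-integrable setT (EFin \o (fun x => f (- x))).
Proof.
move=> fi.
have mN : measurable_fun [set: measurableTypeR R] ((fun x : R => - x) : _ -> measurableTypeR R).
  by apply: measurableT_comp.
apply: (@integrable_scaled_image _ _ _ _ _ _ mN mu 1%:nng _ mu f) => // A mA.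
by rewrite mul1e; apply/esym/lebesgue_measureN.
Qed.

Lemma triangle_integral_mirror (F : plane -> R) z :
  (area R).-integrable setT (EFin \o F) ->
  triangle_integral (fun w => F (mirror w)) z = triangle_integral F (mirror z).
Proof.
move=> Fi; rewrite /triangle_integral.
rewrite -[RHS]Rintegral_mirror; last first.
  by apply: integrable_mul_indic => //; exact: measurable_null_triangle.
apply: eq_Rintegral => w _; congr (_ * _); rewrite !indicE; congr (nat_of_bool _)%:R.
rewrite /mirror; apply/idP/idP => /set_mem [] /= h1 h2 h3; apply/mem_set; split => //=.
all: by move: h1 h2 h3; rewrite ?ltrN2.
Qed.

(** Reflection exchanges the two families of characteristics, so that the
    derivative [q] in the second characteristic direction is covered by the same
    results. *)
Lemma characteristic_solution_mirror c0 d0 al be (U q F : plane -> R) :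
  mu.-integrable setT (EFin \o al) -> mu.-integrable setT (EFin \o be) ->
  (area R).-integrable setT (EFin \o F) ->
  (forall z, null_triangle c0 d0 z ->
     U z = al z.1 + be z.2 + 4^-1 * triangle_integral F z) ->
  (forall a1 a2 b1 b2, c0 < b1 -> b2 < a1 -> a2 < d0 ->
    (area R).-integrable setT (EFin \o (fun z : plane =>
      q z * (\1_(`[a1, a2]%classic) z.1 * \1_(`[b1, b2]%classic) z.2)))) ->
  (forall k l a b c d, c0 < c -> c < d -> d < a -> a < b -> b < d0 ->
     (area R).-integrable setT (EFin \o (fun z : plane =>
        U z * (cutoff k a b z.1 * cutoff' l c d z.2))) /\
     \int[area R]_z (q z * (cutoff k a b z.1 * cutoff l c d z.2)) =
     2 * \int[area R]_z (U z * (cutoff k a b z.1 * cutoff' l c d z.2))) ->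
  characteristic_solution (- d0) (- c0) (fun x => be (- x)) (fun y => al (- y))
    (fun z => U (mirror z)) (fun z => q (mirror z)) (fun z => F (mirror z)).
Proof.
move=> ali bei Fi UE qi qE; split.
- by split; exact: integrable_opp.
- exact: integrable_mirror.
- move=> [x y] [/= h1 h2 h3]; rewrite UE; last first.
    by split; rewrite /mirror /= ?ltrN2//; rewrite ltrNl || rewrite ltrNr.
  rewrite triangle_integral_mirror// /mirror /=; ring.
- move=> a1 a2 b1 b2 cb ba ad.
  have h1 : c0 < - a2 by rewrite ltrNr.
  have h2 : - a1 < - b2 by rewrite ltrN2.
  have h3 : - b1 < d0 by rewrite ltrNl.
  have := integrable_mirror (qi (- b2) (- b1) (- a2) (- a1) h1 h2 h3).
  congr (_.-integrable _ _); apply/funext => z /=; congr EFin; congr (_ * _).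
  rewrite mulrC; congr (_ * _); rewrite !indicE; congr (nat_of_bool _)%:R;
    by rewrite !mem_setE !in_itv /= !lerN2 andbC.
- move=> k l a b c d cc cd da ab bd.
  have [||||| Ui E] := qE l k (- d) (- c) (- b) (- a).
  - by rewrite ltrNr.
  - by rewrite ltrN2.
  - by rewrite ltrN2.
  - by rewrite ltrN2.
  - by rewrite ltrNl.
  have qI : (area R).-integrable setT (EFin \o (fun z : plane =>
      q z * (cutoff l (- d) (- c) z.1 * cutoff k (- b) (- a) z.2))).
    by apply: integrable_cutoff_mul; apply: qi; rewrite ?ltrN2// ltrNr || rewrite ltrNl.
  transitivity (\int[area R]_z (q z * (cutoff l (- d) (- c) z.1 * cutoff k (- b) (- a) z.2))).
    rewrite -(Rintegral_mirror qI); apply: eq_Rintegral => z _.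
    rewrite /mirror /= !cutoff_opp !opprK; ring.
  rewrite E -(Rintegral_mirror Ui) mulNr -mulrN; congr (2 * _).
  have Ui' := integrable_mirror Ui.
  rewrite -[RHS]mulN1r -RintegralZl//; last first.
    have := integrable_scaler (-1) Ui'; congr (_.-integrable _ _); apply/funext => z /=.
    by rewrite cutoff_opp cutoff'_opp !opprK; congr EFin; ring.
  apply: eq_Rintegral => z _; rewrite /mirror /= cutoff_opp cutoff'_opp !opprK.
  by ring.
Qed.

Lemma ray_integral_mirror_le (F : plane -> R) z : measurable_fun setT F ->
  (`|ray_integral (fun w => F (mirror w)) (mirror z)|%:E <=
   \int[mu]_x `|F (x, z.2) * \1_(`]z.2, z.1[%classic) x|%:E)%E.
Proof.
move=> mF.
have mG : measurable_fun [set: measurableTypeR R]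
    (fun x => F (x, z.2) * \1_(`]z.2, z.1[%classic) x).
  by apply: measurable_funM; [exact: (measurableT_comp mF)|exact: measurable_indic].
have E (y : R) : F (mirror ((mirror z).1, y)) * \1_(`](mirror z).2, (mirror z).1[%classic) y =
    F (-1 * y + 0, z.2) * \1_(`]z.2, z.1[%classic) (-1 * y + 0).
  rewrite /mirror /= mulN1r addr0 opprK; congr (_ * _).
  rewrite !indicE; congr (nat_of_bool _)%:R; rewrite !mem_setE !in_itv /= ltrNr andbC ltrNl.
  by [].
rewrite /ray_integral; under eq_Rintegral => y _ do rewrite E.
have mGN : measurable_fun [set: measurableTypeR R]
    (fun y : R => F (-1 * y + 0, z.2) * \1_(`]z.2, z.1[%classic) (-1 * y + 0)).
  have mN : measurable_fun [set: measurableTypeR R]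
      ((fun y : R => -1 * y + 0) : _ -> measurableTypeR R).
    by apply: measurable_funD => //; exact: measurable_funM.
  exact: (measurableT_comp mG mN).
apply: (le_trans (abs_Rintegral_le _ mGN)).
rewrite (@ge0_integral_affine R (-1) 0 (fun x => `|F (x, z.2) * \1_(`]z.2, z.1[%classic) x|%:E)) //.
- by rewrite normrN1 invr1 mul1e.
- by apply/measurable_EFinP; exact: measurableT_comp.
Qed.

End CharacteristicSolution.

(** * A uniqueness principle for bilinear integral inequalities *)

Section Gronwall.
Variable R : realType.
Local Notation mu := (@lebesgue_measure R).
Local Notation plane := (measurableTypeR R * measurableTypeR R)%type.

Definition strip (s t : R) : set plane := [set z : plane | s < z.1 - z.2 <= t].

Lemma measurable_strip s t : measurable (strip s t).
Proof.
have md : measurable_fun [set: plane] (fun z : plane => z.1 - z.2).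
  exact: measurable_funB.
have := md measurableT `]s, t]%classic (measurable_itv _); rewrite setTI.
by congr measurable; apply/seteqP; split => z /=; rewrite in_itv.
Qed.

(** At fixed first coordinate, a strip is a segment of length [t - s]. *)
Lemma strip_row_le (s t e : R) (W : R -> \bar R) (B : R -> R) :
  measurable_fun [set: measurableTypeR R] W -> (forall x, 0 <= W x)%E ->
  measurable_fun [set: measurableTypeR R] B -> (forall x, 0 <= B x) ->
  0 <= e -> (forall u, \int[mu]_(y in `[u, (u + (t - s))%R]) (B y)%:E <= e%:E)%E ->
  (\int[area R]_z (W z.1 * (B z.2 * \1_(strip s t) z)%:E) <= e%:E * \int[mu]_x W x)%E.
Proof.
move=> mW W0 mB B0 e0 Be.
have mBi : measurable_fun [set: plane] (fun z : plane => (B z.2 * \1_(strip s t) z)%:E).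
  apply/measurable_EFinP; apply: measurable_funM; first exact: (measurableT_comp mB).
  by apply: measurable_indic; exact: measurable_strip.
have mWB : measurable_fun [set: plane] (fun z : plane => W z.1 * (B z.2 * \1_(strip s t) z)%:E)%E.
  by apply: emeasurable_funM => //; exact: (measurableT_comp mW).
rewrite (fubini_tonelli1 _ mWB); last by move=> z; rewrite mule_ge0// lee_fin mulr_ge0.
rewrite -ge0_integralZl//; apply: ge0_le_integral => //.
- by move=> x _; apply: integral_ge0 => y _; rewrite mule_ge0// lee_fin mulr_ge0.
- apply: (measurable_fun_fubini_tonelli_F (fun z : plane => W z.1 * (B z.2 * \1_(strip s t) z)%:E)%E) => //.
  by move=> z; rewrite mule_ge0// lee_fin mulr_ge0.
- exact: emeasurable_funM.
move=> x _; rewrite /fubini_F /= muleC.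
have mBx : measurable_fun [set: measurableTypeR R] (fun y => (B y * \1_(strip s t) (x, y))%:E).
  have mp : measurable_fun [set: measurableTypeR R] (fun y : measurableTypeR R => (x, y) : plane).
    exact: measurable_fun_pair.
  exact: (measurableT_comp mBi mp).
rewrite ge0_integralZl//; last by move=> y _; rewrite lee_fin mulr_ge0.
apply: lee_pmul => //.
  by apply: integral_ge0 => ? _; rewrite lee_fin mulr_ge0.
apply: le_trans (Be (x - t)).
rewrite [leRHS]integral_mkcond; apply: ge0_le_integral => //.
- by move=> y _; rewrite lee_fin mulr_ge0.
- apply/(measurable_restrictT _ _).1 => //; apply: measurable_funTS.
  exact/measurable_EFinP.
move=> y _; rewrite patchE indicE; have [/set_mem hs|_] := boolP (_ \in strip s t).
  move: hs; rewrite /strip /= => /andP[h1 h2].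
  rewrite mulr1 ifT//; apply/mem_set; rewrite /= in_itv /=.
  by apply/andP; split; lra.
by rewrite mulr0; case: ifP => // _; rewrite lee_fin.
Qed.

Lemma strip_col_le (s t e : R) (V : R -> \bar R) (A : R -> R) :
  measurable_fun [set: measurableTypeR R] V -> (forall x, 0 <= V x)%E ->
  measurable_fun [set: measurableTypeR R] A -> (forall x, 0 <= A x) ->
  0 <= e -> (forall u, \int[mu]_(y in `[u, (u + (t - s))%R]) (A y)%:E <= e%:E)%E ->
  (\int[area R]_z (V z.2 * (A z.1 * \1_(strip s t) z)%:E) <= e%:E * \int[mu]_x V x)%E.
Proof.
move=> mV V0 mA A0 e0 Ae.
have mAi : measurable_fun [set: plane] (fun z : plane => (A z.1 * \1_(strip s t) z)%:E).
  apply/measurable_EFinP; apply: measurable_funM; first exact: (measurableT_comp mA).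
  by apply: measurable_indic; exact: measurable_strip.
have mVA : measurable_fun [set: plane] (fun z : plane => V z.2 * (A z.1 * \1_(strip s t) z)%:E)%E.
  by apply: emeasurable_funM => //; exact: (measurableT_comp mV).
rewrite (fubini_tonelli2 _ mVA); last by move=> z; rewrite mule_ge0// lee_fin mulr_ge0.
rewrite -ge0_integralZl//; apply: ge0_le_integral => //.
- by move=> x _; apply: integral_ge0 => y _; rewrite mule_ge0// lee_fin mulr_ge0.
- apply: (measurable_fun_fubini_tonelli_G (fun z : plane => V z.2 * (A z.1 * \1_(strip s t) z)%:E)%E) => //.
  by move=> z; rewrite mule_ge0// lee_fin mulr_ge0.
- exact: emeasurable_funM.
move=> y _; rewrite /fubini_G /= muleC.
have mAy : measurable_fun [set: measurableTypeR R] (fun x => (A x * \1_(strip s t) (x, y))%:E).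
  have mp : measurable_fun [set: measurableTypeR R] (fun x : measurableTypeR R => (x, y) : plane).
    exact: measurable_fun_pair.
  exact: (measurableT_comp mAi mp).
rewrite ge0_integralZl//; last by move=> x _; rewrite lee_fin mulr_ge0.
apply: lee_pmul => //.
  by apply: integral_ge0 => ? _; rewrite lee_fin mulr_ge0.
apply: le_trans (Ae (y + s)).
rewrite [leRHS]integral_mkcond; apply: ge0_le_integral => //.
- by move=> x _; rewrite lee_fin mulr_ge0.
- apply/(measurable_restrictT _ _).1 => //; apply: measurable_funTS.
  exact/measurable_EFinP.
move=> x _; rewrite patchE indicE; have [/set_mem hs|_] := boolP (_ \in strip s t).
  move: hs; rewrite /strip /= => /andP[h1 h2].
  rewrite mulr1 ifT//; apply/mem_set; rewrite /= in_itv /=.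
  by apply/andP; split; lra.
by rewrite mulr0; case: ifP => // _; rewrite lee_fin.
Qed.

(** Absolute continuity of the integral, uniform in the position of the segment. *)
Lemma small_segment_integral (A : R -> R) (e : R) :
  mu.-integrable setT (EFin \o A) -> (forall x, 0 <= A x) -> 0 < e ->
  exists2 r : R, 0 < r &
    forall s, s < r -> forall u, (\int[mu]_(y in `[u, (u + s)%R]) (A y)%:E <= e%:E)%E.
Proof.
move=> Ai A0 e0; have [r [r0 H]] := integral_normr_continuous Ai e0.
exists r => // s sr u.
have Ais : mu.-integrable `[u, u + s]%classic (EFin \o A) by exact: integrableS Ai.
have lb : (mu `[u, (u + s)%R]%classic < r%:E)%E.
  rewrite lebesgue_measure_itv /= lte_fin ltrDl.
  by case: ifP => _; [rewrite -EFinD lte_fin; lra|rewrite lte_fin].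
have := H _ (measurable_itv _) lb.
move=> /ltW; rewrite -lee_fin /Rintegral.
under eq_integral => y _ do rewrite ger0_norm//.
by rewrite fineK//; apply: integrable_fin_num.
Qed.

Lemma area_strip_triangle_le (c d s t : R) : s <= t -> c <= d ->
  (area R (strip s t `&` null_triangle c d) <= ((t - s) * (d - c))%:E)%E.
Proof.
move=> st cd.
have mS := measurableI _ _ (measurable_strip s t) (measurable_null_triangle c d).
rewrite -[X in (area R X <= _)%E]setIT -(integral_indic (area R)) ?setIT//.
pose W (x : R) : \bar R := (\1_(`[c, d]%classic) x)%:E.
have := @strip_row_le s t (t - s) W (fun=> 1); rewrite EFinM => H.
have WI : (\int[mu]_x W x = (d - c)%:E)%E.
  rewrite integral_indic ?setIT//= lebesgue_measure_itv /= lte_fin.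
  move: cd; rewrite le_eqVlt => /orP[/eqP->|cd]; first by rewrite ltxx subrr.
  by rewrite cd EFinB.
rewrite -WI; apply: le_trans (H _ _ _ _ _ _) => //.
- apply: ge0_le_integral => //.
  + by apply/measurable_EFinP; apply: measurable_indic.
  + apply: emeasurable_funM.
      apply/measurable_EFinP.
      by apply: (@measurableT_comp _ _ _ _ _ _ (\1_(`[c, d]%classic) : measurableTypeR R -> R)).
    by apply/measurable_EFinP; apply: measurable_funM => //; apply: measurable_indic; exact: measurable_strip.
  move=> z _; rewrite /W -EFinM lee_fin mul1r.
  rewrite [leLHS]indicE; have [/set_mem [h1 [h2 h3 h4]]|_] := boolP (_ \in _ `&` _); last by rewrite mulr_ge0.
  by rewrite !indicE !mem_set ?mulr1//= in_itv /= (ltW h4) andbT (le_trans (ltW h2)) ?ltW.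
- by apply/measurable_EFinP; apply: measurable_indic.
- by move=> x; rewrite lee_fin.
- by rewrite subr_ge0.
move=> u; rewrite integral_cst//= mul1e lebesgue_measure_itv /= lte_fin ltrDl subr_gt0.
case: ifP => _; last by rewrite lee_fin subr_ge0.
by rewrite -EFinB lee_fin addrAC subrr add0r.
Qed.

Section Uniqueness.
Variables (c d C : R) (A B : R -> R) (phi g : plane -> R).
Hypotheses (C0 : 0 <= C) (A0 : forall x, 0 <= A x) (B0 : forall x, 0 <= B x)
  (phi0 : forall z, 0 <= phi z) (g0 : forall z, 0 <= g z).
Hypotheses (Ai : mu.-integrable setT (EFin \o A)) (Bi : mu.-integrable setT (EFin \o B))
  (phii : (area R).-integrable setT (EFin \o phi))
  (gi : (area R).-integrable setT (EFin \o g)).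
Hypothesis g_out : forall z, ~ null_triangle c d z -> g z = 0.

Let triI (z : plane) := (\int[area R]_w (g w * \1_(null_triangle z.2 z.1) w)%:E)%E.
Let rowI (z : plane) := (\int[mu]_y (g (z.1, y) * \1_(`]z.2, z.1[%classic) y)%:E)%E.
Let colI (z : plane) := (\int[mu]_x (g (x, z.2) * \1_(`]z.2, z.1[%classic) x)%:E)%E.

Hypothesis g_le : {ae area R, forall z, null_triangle c d z ->
  ((g z)%:E <= C%:E * (triI z * (A z.1 * B z.2 + phi z)%:E +
     rowI z * (B z.2)%:E + colI z * (A z.1)%:E))%E}.

Let S (s : R) : set plane := [set z : plane | z.1 - z.2 <= s].

Let mS s : measurable (S s).
Proof.
have md : measurable_fun [set: plane] (fun z : plane => z.1 - z.2).
  exact: measurable_funB.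
have := md measurableT `]-oo, s]%classic (measurable_itv _); rewrite setTI.
by congr measurable; apply/seteqP; split => z /=; rewrite in_itv.
Qed.

Let I s := (\int[area R]_z (g z * \1_(S s) z)%:E)%E.

Let mA : measurable_fun [set: measurableTypeR R] A.
Proof. exact: measurable_of_integrable Ai. Qed.
Let mB : measurable_fun [set: measurableTypeR R] B.
Proof. exact: measurable_of_integrable Bi. Qed.
Let mphi : measurable_fun setT phi.
Proof. exact: measurable_of_integrable phii. Qed.
Let mg : measurable_fun setT g.
Proof. exact: measurable_of_integrable gi. Qed.

Let mgS s : measurable_fun [set: plane] (fun z : plane => (g z * \1_(S s) z)%:E).
Proof.
by apply/measurable_EFinP; apply: measurable_funM => //; apply: measurable_indic; exact: mS.
Qed.

Let I_ge0 s : (0 <= I s)%E.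
Proof. by apply: integral_ge0 => z _; rewrite lee_fin mulr_ge0. Qed.

Let I_fin s : (I s < +oo)%E.
Proof.
have gS : (area R).-integrable setT (EFin \o (fun z => g z * \1_(S s) z)).
  by apply: integrable_mul_indic => //; exact: mS.
  rewrite -ge0_fin_numE//; exact: (integrable_fin_num measurableT gS).
Qed.

(** If [g] vanishes where [z.1 - z.2 <= s], the hypothesis on [g], integrated over
    the strip of width [r] that follows, bounds the integral [J] of [g] there by
    small multiples of [J]: the nonlocal factors only see the strip and the region
    before it, and [A], [B], [phi] have integral at most [E] on it.  Hence
    [J <= J / 2]. *)
Let I_step (E r s : R) : 0 < E -> 0 <= r ->
  C * (E * \int[mu]_x A x + 3 * E) <= 2^-1 ->
  (forall u, \int[mu]_(y in `[u, (u + r)%R]) (A y)%:E <= E%:E)%E ->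
  (forall u, \int[mu]_(y in `[u, (u + r)%R]) (B y)%:E <= E%:E)%E ->
  (\int[area R]_(z in strip s (s + r) `&` null_triangle c d) (phi z)%:E <= E%:E)%E ->
  I s = 0%E -> I (s + r) = 0%E.
Proof.
move=> E0 r0 CE AE BE phiE Is0.
pose h (z : plane) := g z * \1_(S (s + r)) z.
have h0 z : 0 <= h z by rewrite mulr_ge0.
have mh : measurable_fun [set: plane] (fun z : plane => (h z)%:E) by exact: mgS.
pose W (x : R) := (\int[mu]_y (h (x, y))%:E)%E.
pose V (y : R) := (\int[mu]_x (h (x, y))%:E)%E.
have hE0 (z : plane) : (0 <= (h z)%:E)%E by rewrite lee_fin.
have mW : measurable_fun [set: measurableTypeR R] W.
  exact: (measurable_fun_fubini_tonelli_F (fun z : plane => (h z)%:E)).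
have mV : measurable_fun [set: measurableTypeR R] V.
  exact: (measurable_fun_fubini_tonelli_G (fun z : plane => (h z)%:E)).
have W0 x : (0 <= W x)%E by apply: integral_ge0.
have V0 x : (0 <= V x)%E by apply: integral_ge0.
have WI : (\int[mu]_x W x = I (s + r))%E by rewrite -(fubini_tonelli1 _ mh).
have VI : (\int[mu]_x V x = I (s + r))%E by rewrite -(fubini_tonelli2 _ mh).
pose D := strip s (s + r).
have mD : measurable D := measurable_strip _ _.
pose DT := D `&` null_triangle c d.
have mDT : measurable DT by apply: measurableI => //; exact: measurable_null_triangle.
have mA1 : measurable_fun [set: plane] (fun z : plane => A z.1) by apply: (measurableT_comp mA).
have mB2 : measurable_fun [set: plane] (fun z : plane => B z.2) by apply: (measurableT_comp mB).
have mW1 : measurable_fun [set: plane] (fun z : plane => W z.1) by apply: (measurableT_comp mW).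
have mV2 : measurable_fun [set: plane] (fun z : plane => V z.2) by apply: (measurableT_comp mV).
have mi (X : set plane) : measurable X -> measurable_fun [set: plane] (\1_X : plane -> R).
  exact: measurable_indic.
pose X1 (z : plane) := ((A z.1)%:E * (B z.2 * \1_D z)%:E)%E.
pose X2 (z : plane) := (phi z * \1_DT z)%:E.
pose X3 (z : plane) := (W z.1 * (B z.2 * \1_D z)%:E)%E.
pose X4 (z : plane) := (V z.2 * (A z.1 * \1_D z)%:E)%E.
have X10 z : (0 <= X1 z)%E by rewrite mule_ge0// lee_fin ?mulr_ge0.
have X20 z : (0 <= X2 z)%E by rewrite lee_fin mulr_ge0.
have X30 z : (0 <= X3 z)%E by rewrite mule_ge0// lee_fin mulr_ge0.
have X40 z : (0 <= X4 z)%E by rewrite mule_ge0// lee_fin mulr_ge0.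
have mX1 : measurable_fun [set: plane] X1.
  by apply: emeasurable_funM; apply/measurable_EFinP => //; apply: measurable_funM => //; exact: mi.
have mX2 : measurable_fun [set: plane] X2.
  by apply/measurable_EFinP; apply: measurable_funM => //; exact: mi.
have mX3 : measurable_fun [set: plane] X3.
  by apply: emeasurable_funM => //; apply/measurable_EFinP; apply: measurable_funM => //; exact: mi.
have mX4 : measurable_fun [set: plane] X4.
  by apply: emeasurable_funM => //; apply/measurable_EFinP; apply: measurable_funM => //; exact: mi.
have Er : s + r - s = r by rewrite addrAC subrr add0r.
have AI : (\int[mu]_x (A x)%:E = (\int[mu]_x A x)%:E)%E.
  by rewrite /Rintegral fineK//; exact: (integrable_fin_num measurableT Ai).
have b1 : (\int[area R]_z X1 z <= (E * \int[mu]_x A x)%:E)%E.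
  rewrite EFinM -AI; apply: strip_row_le => //; last by rewrite Er.
  - exact/measurable_EFinP.
  - exact: ltW.
have b2 : (\int[area R]_z X2 z <= E%:E)%E.
  apply: le_trans phiE; rewrite [leRHS]integral_mkcond.
  rewrite le_eqVlt; apply/orP; left; apply/eqP; apply: eq_integral => z _.
  rewrite patchE /X2 indicE -/DT; case: (z \in DT); first by rewrite mulr1.
  by rewrite mulr0.
have b3 : (\int[area R]_z X3 z <= E%:E * I (s + r))%E.
  by rewrite -WI; apply: strip_row_le => //; [exact: ltW|rewrite Er].
have b4 : (\int[area R]_z X4 z <= E%:E * I (s + r))%E.
  by rewrite -VI; apply: strip_col_le => //; [exact: ltW|rewrite Er].
have gS0 : {ae area R, forall z, g z * \1_(S s) z = 0}.
  have : (\int[area R]_z `|(g z * \1_(S s) z)%:E| = 0)%E.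
    by rewrite -[RHS]Is0; apply: eq_integral => z _; rewrite gee0_abs// lee_fin mulr_ge0.
  move/(ae_eq_integral_abs _ measurableT (mgS s)).
  by apply: (@filterS _ _ (ae_filter_ringOfSetsType (area R))) => z /(_ Logic.I) [].
pose J := I (s + r).
have J0 : (0 <= J)%E := I_ge0 _.
have mX12 : measurable_fun [set: plane] (fun z => X1 z + X2 z)%E by exact: emeasurable_funD.
have mJX : measurable_fun [set: plane] (fun z => J * (X1 z + X2 z))%E.
  exact: (emeasurable_funM (measurable_cst J) mX12).
have mJX3 : measurable_fun [set: plane] (fun z => J * (X1 z + X2 z) + X3 z)%E.
  exact: (emeasurable_funD mJX mX3).
have mJX4 : measurable_fun [set: plane] (fun z => J * (X1 z + X2 z) + X3 z + X4 z)%E.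
  exact: (emeasurable_funD mJX3 mX4).
have hle : (J <= \int[area R]_z (C%:E * (J * (X1 z + X2 z) + X3 z + X4 z)))%E.
  apply: ae_ge0_le_integral => //.
  - by move=> z _; rewrite lee_fin mulr_ge0.
  - move=> z _; apply: mule_ge0; first by rewrite lee_fin.
    by rewrite !adde_ge0// mule_ge0// adde_ge0.
  - exact: (emeasurable_funM (measurable_cst C%:E) mJX4).
  have := @filterI _ _ (ae_filter_ringOfSetsType (area R)) _ _ g_le gS0.
  apply: (@filterS _ _ (ae_filter_ringOfSetsType (area R))) => z [gz gSz] _.
  have rhs0 : (0 <= C%:E * (J * (X1 z + X2 z) + X3 z + X4 z))%E.
    apply: mule_ge0; first by rewrite lee_fin.
    by rewrite !adde_ge0// mule_ge0// adde_ge0.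
  rewrite -/(h z); have [zT|zT] := pselect (null_triangle c d z); last first.
    by rewrite /h g_out// mul0r.
  have [zs|zs] := leP (z.1 - z.2) s.
    by move: gSz; rewrite /h indicE mem_set//= mulr1 => ->; rewrite mul0r.
  have [zr|zr] := leP (z.1 - z.2) (s + r); last first.
    by rewrite /h indicE memNset ?mulr0//= /S /=; apply/negP; rewrite -ltNge.
  have zD : \1_D z = 1 :> R by rewrite indicE mem_set//= /D /strip /= zs zr.
  have zDT : \1_DT z = 1 :> R by rewrite indicE mem_set//= /DT /D /strip /=; split => //; rewrite zs zr.
  have hz : h z = g z by rewrite /h indicE mem_set ?mulr1.
  rewrite hz; apply: (le_trans (gz zT)); apply: lee_pmul => //.
    by rewrite !adde_ge0// mule_ge0// ?lee_fin// ?addr_ge0 ?mulr_ge0//;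
      apply: integral_ge0 => ? _; rewrite lee_fin mulr_ge0.
  have sub (w : plane) : z.2 < w.2 -> w.1 < z.1 -> g w = h w.
    move=> h1 h2; rewrite /h indicE mem_set ?mulr1// /S /=; lra.
  apply: leeD; first apply: leeD.
  - rewrite /X1 /X2 zD zDT !mulr1 -EFinM -EFinD; apply: lee_pmul => //.
    + by apply: integral_ge0 => ? _; rewrite lee_fin mulr_ge0.
    + by rewrite lee_fin addr_ge0// mulr_ge0.
    + apply: ge0_le_integral => //.
      * by move=> ? _; rewrite lee_fin mulr_ge0.
      * apply/measurable_EFinP; apply: measurable_funM => //.
        by apply: measurable_indic; exact: measurable_null_triangle.
      * move=> w _; rewrite lee_fin indicE; have [/set_mem [w1 w2 w3]|_] := boolP (w \in _).
          by rewrite mulr1 -/(h w) -sub.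
        by rewrite mulr0 mulr_ge0.
  - rewrite /X3 zD mulr1; apply: lee_pmul => //.
    + by apply: integral_ge0 => ? _; rewrite lee_fin mulr_ge0.
    + by rewrite lee_fin.
    + apply: ge0_le_integral => //.
      * by move=> ? _; rewrite lee_fin mulr_ge0.
      * apply/measurable_EFinP; apply: measurable_funM => //.
          apply: (measurableT_comp mg); exact: measurable_fun_pair.
      * apply: (measurableT_comp mh); exact: measurable_fun_pair.
      * move=> y _; rewrite lee_fin indicE; have [|_] := boolP (y \in _); last by rewrite mulr0.
        rewrite mem_setE in_itv /= => /andP[y1 y2]; rewrite mulr1.
        by rewrite /h indicE mem_set ?mulr1//= /S /=; lra.
  - rewrite /X4 zD mulr1; apply: lee_pmul => //.
    + by apply: integral_ge0 => ? _; rewrite lee_fin mulr_ge0.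
    + by rewrite lee_fin.
    + apply: ge0_le_integral => //.
      * by move=> ? _; rewrite lee_fin mulr_ge0.
      * apply/measurable_EFinP; apply: measurable_funM => //.
          apply: (measurableT_comp mg); exact: measurable_fun_pair.
      * apply: (measurableT_comp mh); exact: measurable_fun_pair.
      * move=> x _; rewrite lee_fin indicE; have [|_] := boolP (x \in _); last by rewrite mulr0.
        rewrite mem_setE in_itv /= => /andP[y1 y2]; rewrite mulr1.
        by rewrite /h indicE mem_set ?mulr1//= /S /=; lra.
have Jfin : J \is a fin_num by rewrite ge0_fin_numE// I_fin.
have Jle : (J <= C%:E * (J * ((E * \int[mu]_x A x)%:E + E%:E) + E%:E * J + E%:E * J))%E.
  apply: (le_trans hle).
  rewrite ge0_integralZl//; last first.
  - by move=> z _; rewrite !adde_ge0// mule_ge0// adde_ge0.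
  apply: lee_pmul => //.
    by apply: integral_ge0 => z _; rewrite !adde_ge0// mule_ge0// adde_ge0.
  rewrite ge0_integralD//; last first.
  - by move=> z _; rewrite adde_ge0// mule_ge0// adde_ge0.
  apply: leeD => //.
  rewrite ge0_integralD//; last first.
  - by move=> z _; rewrite mule_ge0// adde_ge0.
  apply: leeD => //.
  rewrite ge0_integralZl//; last first.
  - by move=> z _; rewrite adde_ge0.
  apply: lee_pmul => //.
    by apply: integral_ge0 => z _; rewrite adde_ge0.
  by rewrite ge0_integralD//; apply: leeD.
have [j jE] : exists j : R, J = j%:E by exists (fine J); rewrite fineK.
move: Jle J0; rewrite -/J {}jE => Jle; rewrite lee_fin => J0.
have {}Jle : j <= C * (j * (E * \int[mu]_x A x + E) + E * j + E * j) by rewrite -lee_fin.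
congr EFin.
apply/eqP; rewrite eq_le J0 andbT.
have : j <= (C * (E * \int[mu]_x A x + 3 * E)) * j.
  by apply: (le_trans Jle); rewrite le_eqVlt; apply/orP; left; apply/eqP; ring.
move=> H; have : j <= 2^-1 * j by apply: (le_trans H); rewrite ler_wpM2r.
by lra.
Qed.

(** A Gronwall argument in the time variable [z.1 - z.2]: the triangle is exhausted
    by finitely many strips, whose width is chosen from [A], [B], [phi] only. *)
Lemma integral_inequality_zero : (\int[area R]_z (g z)%:E = 0)%E.
Proof.
have IA0 : 0 <= \int[mu]_x A x by apply: Rintegral_ge0.
(* the constant of the strip estimate is then at most 1/2 *)
pose E := (2 * (C * (\int[mu]_x A x + 3) + 1))^-1.
have den : 0 < 2 * (C * (\int[mu]_x A x + 3) + 1).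
  by rewrite mulr_gt0// ltr_pwDr// mulr_ge0// addr_ge0.
have E0 : 0 < E by rewrite invr_gt0.
have CE : C * (E * \int[mu]_x A x + 3 * E) <= 2^-1.
  rewrite (_ : C * _ = (C * (\int[mu]_x A x + 3)) * E); last by ring.
  rewrite /E ler_pdivrMr// mulrA mulVf// mul1r; lra.
have [rA rA0 HA] := small_segment_integral Ai A0 E0.
have [rB rB0 HB] := small_segment_integral Bi B0 E0.
have [rp [rp0 Hp]] := integral_normr_continuous phii E0.
have [dc|cd] := leP d c.
  apply: integral0_eq => z _; rewrite g_out// => -[z1 z2 z3].
  by have := lt_trans z1 (lt_trans z2 z3); rewrite ltNge dc.
pose r := Num.min (Num.min rA rB) (rp / (d - c)) / 2.
have dc0 : 0 < d - c by rewrite subr_gt0.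
have m0 : 0 < Num.min (Num.min rA rB) (rp / (d - c)).
  by rewrite !lt_min rA0 rB0 divr_gt0.
have r0 : 0 < r by rewrite divr_gt0.
have rm : r < Num.min (Num.min rA rB) (rp / (d - c)).
  by rewrite /r ltr_pdivrMr// ltr_pMr// ltr1n.
have /andP[/andP[rrA rrB] rrp] : (r < rA) && (r < rB) && (r < rp / (d - c)).
  by move: rm; rewrite !lt_min.
have In n : I (n%:R * r) = 0%E.
  elim: n => [|n IH].
    apply: integral0_eq => z _; rewrite mul0r.
    have [zT|zT] := pselect (null_triangle c d z); last by rewrite g_out// mul0r.
    rewrite indicE memNset ?mulr0//= /S /=; apply/negP; rewrite -ltNge subr_gt0.
    by case: zT.
  have -> : n.+1%:R * r = n%:R * r + r by rewrite -natr1 mulrDl mul1r.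
  apply: (I_step E0 (ltW r0) CE (HA _ rrA) (HB _ rrB) _ IH).
  set D := strip _ _ `&` _.
  have mD : measurable D.
    by apply: measurableI; [exact: measurable_strip|exact: measurable_null_triangle].
  have := Hp D mD; have : (area R D < rp%:E)%E.
    apply: le_lt_trans (area_strip_triangle_le _ (ltW cd)) _; first by rewrite lerDl ltW.
    by rewrite addrAC subrr add0r lte_fin -ltr_pdivlMr.
  move=> H /(_ H) /ltW; rewrite -lee_fin /Rintegral.
  under eq_integral => z _ do rewrite ger0_norm//.
  rewrite fineK//; apply: integrable_fin_num => //.
  exact: integrableS phii.
have [n Hn] : exists n : nat, d - c <= n%:R * r.
  exists (Num.bound ((d - c) / r)).
  rewrite -ler_pdivrMr//; apply: ltW; apply: archi_boundP; apply: divr_ge0; exact: ltW.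
rewrite -(In n); apply: eq_integral => z _; congr EFin.
have [zT|zT] := pselect (null_triangle c d z); last by rewrite g_out// mul0r.
rewrite indicE mem_set ?mulr1//= /S /=; case: zT => z1 z2 z3.
by apply: le_trans Hn; rewrite lerB ?ltW.
Qed.

End Uniqueness.

End Gronwall.

(** * Weak derivatives in characteristic coordinates *)

Section NullTestFunctions.
Variable R : realType.

Lemma continuous_to_null : continuous (@to_null R).
Proof.
move=> z; apply: (@cvg_pair _ _ _ _ (nbhs (z.2 + z.1)) (nbhs (z.2 - z.1))).
  by apply: cvgD; [exact: cvg_snd|exact: cvg_fst].
by apply: cvgB; [exact: cvg_snd|exact: cvg_fst].
Qed.

Lemma continuous_of_null : continuous (@of_null R).
Proof.
move=> z; apply: (@cvg_pair _ _ _ _ (nbhs ((z.1 - z.2) / 2)) (nbhs ((z.1 + z.2) / 2))).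
  apply: cvgM; last exact: cvg_cst.
  by apply: cvgB; [exact: cvg_fst|exact: cvg_snd].
apply: cvgM; last exact: cvg_cst.
by apply: cvgD; [exact: cvg_fst|exact: cvg_snd].
Qed.

Lemma open_null_triangle (c d : R) : open (null_triangle c d).
Proof.
rewrite (_ : null_triangle c d = (fun z : R * R => z.2 - c) @^-1` [set x | 0 < x] `&`
   ((fun z : R * R => z.1 - z.2) @^-1` [set x | 0 < x] `&`
    (fun z : R * R => d - z.1) @^-1` [set x | 0 < x])); last first.
  apply/seteqP; split => z /=; first by move=> [h1 h2 h3]; rewrite !subr_gt0.
  by rewrite !subr_gt0 => -[h1 [h2 h3]].
apply: openI; [|apply: openI]; apply: open_comp; rewrite ?(open_gt, @open_gt R 0)//;
  move=> z _; apply: cvgB; try exact: cvg_cst; try exact: cvg_fst; exact: cvg_snd.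
Qed.

Definition null_box (a b c d : R) : set (R * R) :=
  @to_null R @^-1` (`[a, b] `*` `[c, d]).

Lemma compact_null_box a b c d : compact (null_box a b c d).
Proof.
rewrite (_ : null_box a b c d = @of_null R @` (`[a, b] `*` `[c, d])).
  apply: continuous_compact; last by apply: compact_setX; exact: segment_compact.
  by apply: continuous_subspaceT => z; exact: continuous_of_null.
apply/seteqP; split => [z zb|_ [z zb <-]]; first by exists (to_null z) => //; rewrite to_nullK.
by change ((`[a, b] `*` `[c, d]) (to_null (of_null z))); rewrite of_nullK.
Qed.

Lemma null_box_interior (K : set (R * R)) c0 d0 a b c d :
  (forall z, null_triangle c0 d0 z -> K (of_null z)) ->
  c0 < c -> d < a -> b < d0 -> null_box a b c d `<=` interior K.
Proof.
move=> TK cc da bd.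
have oT : open (@to_null R @^-1` null_triangle c0 d0).
  apply: open_comp; last exact: open_null_triangle.
  by move=> z _; exact: continuous_to_null.
apply: subset_trans (_ : @to_null R @^-1` null_triangle c0 d0 `<=` _).
  move=> z [/=]; rewrite !in_itv /= => /andP[h1 h2] /andP[h3 h4]; split.
  - exact: lt_le_trans h3.
  - exact: le_lt_trans h4 (lt_le_trans da h1).
  - exact: le_lt_trans bd.
by rewrite -open_subsetE// => z /TK; rewrite to_nullK.
Qed.

Definition null_test k l (a b c d : R) (z : R * R) : R :=
  cutoff k a b (to_null z).1 * cutoff l c d (to_null z).2.

Lemma null_test_out k l (a b c d : R) z :
  ~ null_box a b c d z -> null_test k l a b c d z = 0.
Proof.
move=> zb; rewrite /null_test cutoff_indic [cutoff l _ _ _]cutoff_indic !indicE.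
have [|_] := boolP (_ \in `[a, b]%classic); last by rewrite !mul0r.
have [|_] := boolP (_ \in `[c, d]%classic); last by rewrite mul0r mulr0.
by move=> /set_mem h1 /set_mem h2; exfalso; apply: zb; split.
Qed.

Lemma is_derive_null_test k l (a b c d : R) (z v : R * R) :
  is_derive z v (null_test k l a b c d)
    ((v.2 + v.1) * (cutoff' k a b (to_null z).1 * cutoff l c d (to_null z).2) +
     (v.2 - v.1) * (cutoff k a b (to_null z).1 * cutoff' l c d (to_null z).2)).
Proof.
pose m1 (h : R) := (to_null z).1 + h * (v.2 + v.1).
pose m2 (h : R) := (to_null z).2 + h * (v.2 - v.1).
have sE (x y : R) : x *: y = x * y by [].
apply: (derive1_line (g := fun h => cutoff k a b (m1 h) * cutoff l c d (m2 h))).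
  move=> h; rewrite /null_test /to_null /= /m1 /m2 /= !sE.
  by congr (cutoff _ _ _ _ * cutoff _ _ _ _); ring.
have E1 : is_derive (0 : R) (1 : R) (cutoff k a b \o m1)
    (cutoff' k a b (m1 0) * (v.2 + v.1)).
  apply: is_derive1_comp; first exact: is_derive_cutoff.
  by apply: is_derive_eq; rewrite /GRing.scale /=; ring.
have E2 : is_derive (0 : R) (1 : R) (cutoff l c d \o m2)
    (cutoff' l c d (m2 0) * (v.2 - v.1)).
  apply: is_derive1_comp; first exact: is_derive_cutoff.
  by apply: is_derive_eq; rewrite /GRing.scale /=; ring.
rewrite (_ : (fun h => _) = (cutoff k a b \o m1) * (cutoff l c d \o m2))//.
apply: is_derive_eq; rewrite /m1 /m2 /GRing.scale /= !mul0r !addr0; ring.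
Qed.

Lemma smooth_null_test k l (a b c d : R) : smooth setT (null_test k l a b c d).
Proof.
move=> m.
have cf : continuous (fun z : R * R => z.1) by move=> z; exact: cvg_fst.
have cs : continuous (fun z : R * R => z.2) by move=> z; exact: cvg_snd.
have aff (s s0 : R) (e : R) : affine_form
    (fun z : R * R => s * (z.2 + e * z.1 - s0)) (fun z => s * (z.2 + e * z.1)).
  have sE (x y : R) : x *: y = x * y by [].
  split; last by move=> z v h; rewrite /= !sE; ring.
  move=> z; apply: cvgM; first exact: cvg_cst.
  apply: cvgB; last exact: cvg_cst.
  by apply: cvgD; [exact: cvg_snd|apply: cvgM; [exact: cvg_cst|exact: cvg_fst]].
have F (s s0 e : R) : Ck m setT (fun z : R * R => 1 * flat 1 (s * (z.2 + e * z.1 - s0))).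
  exact: Ck_flat_affine (aff s s0 e).
rewrite (_ : null_test _ _ _ _ _ _ = fun z : R * R =>
  (1 * flat 1 (k.+1%:R * (z.2 + 1 * z.1 - a)) * (1 * flat 1 ((- k.+1%:R) * (z.2 + 1 * z.1 - b)))) *
  (1 * flat 1 (l.+1%:R * (z.2 + (-1) * z.1 - c)) * (1 * flat 1 ((- l.+1%:R) * (z.2 + (-1) * z.1 - d))))).
  by apply: Ck_mul; apply: Ck_mul; exact: F.
apply/funext => z; rewrite /null_test /cutoff /to_null /= !mul1r !mulN1r.
by congr (flat 1 _ * flat 1 _ * (flat 1 _ * flat 1 _)); ring.
Qed.

Lemma test_function_null_test (K : set (R * R)) c0 d0 k l (a b c d : R) :
  (forall z, null_triangle c0 d0 z -> K (of_null z)) ->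
  c0 < c -> d < a -> b < d0 -> test_function (interior K) (null_test k l a b c d).
Proof.
move=> TK cc da bd.
have sub : closure [set z | null_test k l a b c d z != 0] `<=` null_box a b c d.
  have -> : null_box a b c d = closure (null_box a b c d).
    by apply/closure_id; apply: compact_closed; [exact: norm_hausdorff|exact: compact_null_box].
  apply: closure_subset => z /=; apply: contraNP => /null_test_out ->.
  by rewrite eqxx.
split; first exact: smooth_null_test.
  apply: (subclosed_compact _ (@compact_null_box a b c d) sub); exact: closed_closure.
exact: subset_trans sub (null_box_interior TK cc da bd).
Qed.

End NullTestFunctions.

Section WeakDerivatives.
Variable R : realType.
Local Notation mu := (@lebesgue_measure R).
Local Notation plane := (measurableTypeR R * measurableTypeR R)%type.

Lemma Rintegral_support (D : set plane) (g : plane -> R) :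
  (forall z, ~ D z -> g z = 0) ->
  \int[area R]_(z in D) g z = \int[area R]_z g z.
Proof.
move=> gD; rewrite Rintegral_mkcond; apply: eq_Rintegral => z _.
by rewrite patchE; case: ifPn => // /negP zD; rewrite gD// => /mem_set.
Qed.

(** Against a test function supported in the triangle, [U] may be replaced by its
    representation, each term of which is integrable. *)
Lemma integrable_represented (c0 d0 C1 C2 : R) (al be g1 g2 : R -> R) (U F : plane -> R) :
  mu.-integrable setT (EFin \o al) -> mu.-integrable setT (EFin \o be) ->
  (area R).-integrable setT (EFin \o F) ->
  (forall z, null_triangle c0 d0 z ->
     U z = al z.1 + be z.2 + 4^-1 * triangle_integral F z) ->
  mu.-integrable setT (EFin \o g1) -> (forall x, `|g1 x| <= C1) ->
  mu.-integrable setT (EFin \o g2) -> (forall x, `|g2 x| <= C2) ->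
  (forall z, ~ null_triangle c0 d0 z -> g1 z.1 * g2 z.2 = 0) ->
  (area R).-integrable setT (EFin \o (fun z : plane => U z * (g1 z.1 * g2 z.2))).
Proof.
move=> ali bei Fi UE g1i g1C g2i g2C g0.
have mg1 : measurable_fun [set: measurableTypeR R] g1.
  exact: measurable_of_integrable g1i.
have mg2 : measurable_fun [set: measurableTypeR R] g2.
  exact: measurable_of_integrable g2i.
have al' : mu.-integrable setT (EFin \o (fun x => al x * g1 x)).
  by apply: (@integrable_mul_bounded _ _ _ _ _ _ C1).
have be' : mu.-integrable setT (EFin \o (fun x => be x * g2 x)).
  by apply: (@integrable_mul_bounded _ _ _ _ _ _ C2).
have t1 := integrable_tensor al' g2i.
have t2 := integrable_tensor g1i be'.
have [C' HC'] := triangle_integral_bound Fi.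
have t3 : (area R).-integrable setT (EFin \o (fun z : plane =>
    (g1 z.1 * g2 z.2) * triangle_integral F z)).
  apply: (@integrable_mul_bounded _ _ _ _ _ _ C') => //.
    exact: (integrable_tensor g1i g2i).
  exact: measurable_triangle_integral.
rewrite (_ : (fun z => _) = (fun z : plane => ((al z.1 * g1 z.1) * g2 z.2 +
     g1 z.1 * (be z.2 * g2 z.2)) + 4^-1 * ((g1 z.1 * g2 z.2) * triangle_integral F z))).
  exact: (integrable_addr (integrable_addr t1 t2) (integrable_scaler _ t3)).
apply/funext => z.
have [zT|/g0 z0] := pselect (null_triangle c0 d0 z); first by rewrite UE//; ring.
rewrite /= z0 mul0r mulr0 [X in _ = X + _](_ : _ = (al z.1 + be z.2) * (g1 z.1 * g2 z.2)); last by ring.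
by rewrite z0 !mulr0 addr0.
Qed.

Lemma integrable_null_box (h : plane -> R) a b c d :
  (area R).-integrable (null_box a b c d) (EFin \o h) ->
  (area R).-integrable setT (EFin \o (fun z : plane =>
    h (of_null z) * (\1_(`[a, b]%classic) z.1 * \1_(`[c, d]%classic) z.2))).
Proof.
have mb : measurable (null_box a b c d : set plane).
  rewrite -[X in measurable X]setTI; apply: measurable_to_null => //.
  by apply: measurableX; exact: measurable_itv.
move=> hi.
have hi' := integrable_extend mb hi.
have := (integrable_of_null (fun z : plane => h z * \1_(null_box a b c d) z)).1 hi'.
congr (_.-integrable _ _); apply/funext => z /=; congr EFin; congr (_ * _).
rewrite !indicE -natrM mulnb; congr (nat_of_bool _)%:R.
apply/idP/andP => [/set_mem|[/set_mem h1 /set_mem h2]].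
  move=> h'; have : (`[a, b] `*` `[c, d]) (to_null (of_null z)) by exact: h'.
  by rewrite of_nullK => -[h1 h2]; split; exact/mem_set.
by apply/mem_set; change ((`[a, b] `*` `[c, d]) (to_null (of_null z))); rewrite of_nullK.
Qed.

Section OneComponent.
Variables (n : nat) (K : set (R * R)) (c0 d0 : R) (u ut ux : R * R -> 'rV[R]_n)
  (i : 'I_n) (al be : R -> R) (F : plane -> R).
Hypotheses (TK : forall z, null_triangle c0 d0 z -> K (of_null z))
  (wt : weak_derivative K (1, 0) u ut) (wx : weak_derivative K (0, 1) u ux)
  (ali : mu.-integrable setT (EFin \o al)) (bei : mu.-integrable setT (EFin \o be))
  (Fi : (area R).-integrable setT (EFin \o F)).
Hypothesis UE : forall z, null_triangle c0 d0 z ->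
  u (of_null z) ord0 i = al z.1 + be z.2 + 4^-1 * triangle_integral F z.

Let U (z : plane) : R := u (of_null z) ord0 i.
Let Ut (z : plane) : R := ut (of_null z) ord0 i.
Let Ux (z : plane) : R := ux (of_null z) ord0 i.

Let integrable_weak (w : R * R -> 'rV[R]_n) e a1 a2 b1 b2 : weak_derivative K e u w ->
  c0 < b1 -> b2 < a1 -> a2 < d0 ->
  (area R).-integrable setT (EFin \o (fun z : plane =>
     w (of_null z) ord0 i * (\1_(`[a1, a2]%classic) z.1 * \1_(`[b1, b2]%classic) z.2))).
Proof.
move=> [wi _] cb ba ad; apply: (@integrable_null_box (fun z => w z ord0 i)).
by apply: wi; [exact: compact_null_box|exact: null_box_interior TK cb ba ad].
Qed.

(** The weak derivative tested with [null_test]; the Jacobian of the change of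
    variables multiplies both sides. *)
Let weak_cutoff (w : R * R -> 'rV[R]_n) (e : R * R) k l a b c d :
  weak_derivative K e u w -> c0 < c -> d < a -> b < d0 ->
  [/\ (area R).-integrable setT (EFin \o (fun z : plane =>
        U z * (cutoff' k a b z.1 * cutoff l c d z.2))),
      (area R).-integrable setT (EFin \o (fun z : plane =>
        U z * (cutoff k a b z.1 * cutoff' l c d z.2))),
      (area R).-integrable setT (EFin \o (fun z : plane =>
        w (of_null z) ord0 i * (cutoff k a b z.1 * cutoff l c d z.2))) &
      \int[area R]_z (w (of_null z) ord0 i * (cutoff k a b z.1 * cutoff l c d z.2)) =
      - ((e.2 + e.1) * \int[area R]_z (U z * (cutoff' k a b z.1 * cutoff l c d z.2))
        + (e.2 - e.1) * \int[area R]_z (U z * (cutoff k a b z.1 * cutoff' l c d z.2)))].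
Proof.
move=> ww cc da bd.
have out (g1 g2 : R -> R) : (forall x, ~~ (a < x < b) -> g1 x = 0) ->
    (forall x, ~~ (c < x < d) -> g2 x = 0) ->
    forall z : plane, ~ null_triangle c0 d0 z -> g1 z.1 * g2 z.2 = 0.
  move=> g10 g20 z zT.
  have [/andP[z1 z2]|/g10 ->] := boolP (a < z.1 < b); last by rewrite mul0r.
  have [/andP[z3 z4]|/g20 ->] := boolP (c < z.2 < d); last by rewrite mulr0.
  exfalso; apply: zT; split; [exact: lt_trans z3|exact: lt_trans z4 (lt_trans da z1)|
    exact: lt_trans z2 bd].
have [C1 HC1] := cutoff'_bounded k a b.
have [C2 HC2] := cutoff'_bounded l c d.
have i1 : (area R).-integrable setT (EFin \o (fun z : plane =>
    U z * (cutoff' k a b z.1 * cutoff l c d z.2))).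
  apply: (integrable_represented ali bei Fi UE (integrable_cutoff' k a b) HC1
    (integrable_cutoff l c d) (norm_cutoff_le1 l c d)).
  by apply: out => x; [exact: cutoff'_out|exact: cutoff_out].
have i2 : (area R).-integrable setT (EFin \o (fun z : plane =>
    U z * (cutoff k a b z.1 * cutoff' l c d z.2))).
  apply: (integrable_represented ali bei Fi UE (integrable_cutoff k a b) (norm_cutoff_le1 k a b)
    (integrable_cutoff' l c d) HC2).
  by apply: out => x; [exact: cutoff_out|exact: cutoff'_out].
have i3 : (area R).-integrable setT (EFin \o (fun z : plane =>
    w (of_null z) ord0 i * (cutoff k a b z.1 * cutoff l c d z.2))).
  by apply: integrable_cutoff_mul; exact: integrable_weak ww cc da bd.
split=> //.
pose phi := null_test k l a b c d.
have phiE z : phi (of_null z) = cutoff k a b z.1 * cutoff l c d z.2.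
  by rewrite /phi /null_test of_nullK.
have dphi z : 'D_e phi z = (e.2 + e.1) * (cutoff' k a b (to_null z).1 * cutoff l c d (to_null z).2)
   + (e.2 - e.1) * (cutoff k a b (to_null z).1 * cutoff' l c d (to_null z).2).
  by case: (is_derive_null_test k l a b c d z e).
have KI := null_box_interior TK cc da bd.
have ru : \int[area R]_(z in interior K) (u z ord0 i * 'D_e phi z) =
    \int[area R]_z (u z ord0 i * 'D_e phi z).
  apply: Rintegral_support => z zK; rewrite dphi.
  have zb : ~ null_box a b c d z by move=> /KI.
  have zb' : ~~ (a < (to_null z).1 < b) \/ ~~ (c < (to_null z).2 < d).
    apply/orP; rewrite -negb_and; apply/negP => /andP[/andP[h1 h2] /andP[h3 h4]].
    by apply: zb; split; rewrite /= in_itv /= !ltW.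
  case: zb' => h; first by rewrite (cutoff_out _ h) (cutoff'_out _ h) !mul0r !mulr0 addr0 mulr0.
  by rewrite (cutoff_out _ h) (cutoff'_out _ h) !mulr0 addr0 mulr0.
have rw : \int[area R]_(z in interior K) (w z ord0 i * phi z) =
    \int[area R]_z (w z ord0 i * phi z).
  apply: Rintegral_support => z zK; rewrite /phi null_test_out ?mulr0// => /KI.
  exact: zK.
have := ww.2 phi (test_function_null_test k l TK cc da bd) i.
rewrite ru rw.
have j1 : (area R).-integrable setT (EFin \o (fun z : plane => w z ord0 i * phi z)).
  by apply/integrable_of_null; move: i3; congr (_.-integrable _ _); apply/funext => z /=; rewrite phiE.
have j2' : (area R).-integrable setT (EFin \o (fun z : plane =>
    (e.2 + e.1) * (U z * (cutoff' k a b z.1 * cutoff l c d z.2)) +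
    (e.2 - e.1) * (U z * (cutoff k a b z.1 * cutoff' l c d z.2)))).
  exact: (integrable_addr (integrable_scaler _ i1) (integrable_scaler _ i2)).
have E2 (z : plane) : u (of_null z) ord0 i * 'D_e phi (of_null z) =
    (e.2 + e.1) * (U z * (cutoff' k a b z.1 * cutoff l c d z.2)) +
    (e.2 - e.1) * (U z * (cutoff k a b z.1 * cutoff' l c d z.2)).
  by rewrite dphi of_nullK /U; ring.
have j2 : (area R).-integrable setT (EFin \o (fun z : plane => u z ord0 i * 'D_e phi z)).
  by apply/integrable_of_null; move: j2'; congr (_.-integrable _ _); apply/funext => z /=; rewrite -E2.
move=> H; have {}H : 2 * \int[area R]_z (u z ord0 i * 'D_e phi z) =
    - (2 * \int[area R]_z (w z ord0 i * phi z)) by rewrite H mulrN.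
move: H; rewrite -(Rintegral_of_null j1) -(Rintegral_of_null j2).
under eq_Rintegral => z _ do rewrite E2.
under [X in _ = - X -> _]eq_Rintegral => z _ do rewrite phiE.
have k1 := integrable_scaler (e.2 + e.1) i1.
have k2 := integrable_scaler (e.2 - e.1) i2.
by rewrite (RintegralD measurableT k1 k2) (RintegralZl _ measurableT i1)
  (RintegralZl _ measurableT i2) => ->; rewrite opprK.
Qed.

(** In the sum of the two identities, the derivative of the second cut-off cancels. *)
Lemma characteristic_solution_p :
  characteristic_solution c0 d0 al be U (fun z => Ut z + Ux z) F.
Proof.
split=> //.
- move=> a1 a2 b1 b2 cb ba ad.
  rewrite (_ : (fun z => _) = (fun z : plane =>
     Ut z * (\1_(`[a1, a2]%classic) z.1 * \1_(`[b1, b2]%classic) z.2) +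
     Ux z * (\1_(`[a1, a2]%classic) z.1 * \1_(`[b1, b2]%classic) z.2))).
    exact: (integrable_addr (integrable_weak wt cb ba ad) (integrable_weak wx cb ba ad)).
  by apply/funext => z; rewrite mulrDl.
- move=> k l a b c d cc cd da ab bd.
  have [i1 i2 i3 E1] := weak_cutoff k l wt cc da bd.
  have [_ _ i4 E2] := weak_cutoff k l wx cc da bd.
  under eq_Rintegral => z _ do rewrite mulrDl.
  by rewrite RintegralD// E1 E2 /=; ring.
Qed.

(** In their difference, the derivative of the first cut-off cancels. *)
Lemma characteristic_solution_q :
  characteristic_solution (- d0) (- c0) (fun x => be (- x)) (fun y => al (- y))
    (fun z => U (mirror z)) (fun z => Ut (mirror z) - Ux (mirror z)) (fun z => F (mirror z)).
Proof.
apply: (@characteristic_solution_mirror R c0 d0 al be U (fun z => Ut z - Ux z) F) => //.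
- move=> a1 a2 b1 b2 cb ba ad.
  rewrite (_ : (fun z => _) = (fun z : plane =>
     Ut z * (\1_(`[a1, a2]%classic) z.1 * \1_(`[b1, b2]%classic) z.2) -
     Ux z * (\1_(`[a1, a2]%classic) z.1 * \1_(`[b1, b2]%classic) z.2))).
    exact: (integrable_subr (integrable_weak wt cb ba ad) (integrable_weak wx cb ba ad)).
  by apply/funext => z; rewrite mulrBl.
- move=> k l a b c d cc cd da ab bd.
  have [i1 i2 i3 E1] := weak_cutoff k l wt cc da bd.
  have [_ _ i4 E2] := weak_cutoff k l wx cc da bd.
  split=> //; under eq_Rintegral => z _ do rewrite mulrBl.
  by rewrite RintegralB// E1 E2 /=; ring.
Qed.

End OneComponent.
End WeakDerivatives.

(** * The mild formulation in characteristic coordinates *)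

Section MildFormulation.
Variable R : realType.
Local Notation mu := (@lebesgue_measure R).
Local Notation plane := (measurableTypeR R * measurableTypeR R)%type.

Lemma backward_triangleE (t x : R) : 0 < t ->
  backward_triangle t x =
  [set z | 0 <= z.1 /\ x - t + z.1 <= z.2 <= x + t - z.1].
Proof.
move=> t0; have sE (a b : R) : a *: b = a * b by [].
apply/seteqP; split => [z [[[l0 l1] l2] /= [h0 h1 h2 hs ->]]|[s y] /= [s0 /andP[h1 h2]]].
  rewrite /= !sE !mulr0 !addr0; split; first by rewrite mulr_ge0// ltW.
  have -> : l0 = 1 - l1 - l2 by rewrite -hs; ring.
  have h1' : 0 <= l1 * t by rewrite mulr_ge0// ltW.
  have h2' : 0 <= l2 * t by rewrite mulr_ge0// ltW.
  by apply/andP; split; nra.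
have tn0 : t != 0 by rewrite gt_eqF.
exists (s / t, ((t - s) - (y - x)) / (2 * t), ((t - s) + (y - x)) / (2 * t)) => /=; split.
- by rewrite divr_ge0// ltW.
- by apply: divr_ge0; lra.
- by apply: divr_ge0; lra.
- by field.
- by congr pair; rewrite /= !sE; field.
Qed.

Lemma measurable_backward_triangle (t x : R) : 0 < t ->
  measurable (backward_triangle t x : set plane).
Proof.
move=> t0; rewrite backward_triangleE//.
have m1 : measurable_fun setT (fun z : plane => z.1) by exact: measurable_fst.
have m2 : measurable_fun setT (fun z : plane => z.2) by exact: measurable_snd.
rewrite (_ : [set z | _] = ~` [set z : plane | z.1 < 0] `&`
  (~` [set z : plane | z.2 < x - t + z.1] `&` ~` [set z : plane | x + t - z.1 < z.2])).
  apply: measurableI; [|apply: measurableI]; apply: measurableC; apply: measurable_set_ltr => //.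
    exact: measurable_funD.
  exact: measurable_funB.
apply/seteqP; split => z /=; first by move=> [h /andP[h1 h2]]; split; [|split]; apply/negP; rewrite -leNgt.
by move=> [/negP h [/negP h1 /negP h2]]; rewrite -!leNgt in h h1 h2; split => //; apply/andP.
Qed.

Lemma null_triangle_backward (t x : R) (z : R * R) : 0 < t ->
  null_triangle (x - t) (x + t) z -> backward_triangle t x (of_null z).
Proof.
move=> t0 [h1 h2 h3]; rewrite backward_triangleE//= ; split; first lra.
by apply/andP; split; lra.
Qed.

(** Fubini, closed intervals being replaced by open ones up to null sets. *)
Lemma iterated_triangle_integral (g : plane -> R) (t x : R) :
  (area R).-integrable setT (EFin \o (fun z : plane =>
    g z * \1_(null_triangle (x - t) (x + t)) (to_null z))) ->
  \int[mu]_(s in `[0, t]) \int[mu]_(y in `[x - t + s, x + t - s]) g (s, y) =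
  \int[area R]_z (g z * \1_(null_triangle (x - t) (x + t)) (to_null z)).
Proof.
set h := (fun z => _); move=> hi.
have mh : measurable_fun setT h by exact: measurable_of_integrable hi.
pose G (s : R) := \int[mu]_y h (s, y).
have mG : measurable_fun [set: measurableTypeR R] G by exact: measurable_Rintegral_snd.
have hE (s y : R) : h (s, y) = g (s, y) * (\1_(`]0, t[%classic) s * \1_(`]x - t + s, x + t - s[%classic) y).
  rewrite /h /to_null /= !indicE -natrM mulnb; congr (_ * (nat_of_bool _)%:R).
  apply/idP/andP => [/set_mem [/= h1 h2 h3]|[/set_mem + /set_mem]].
    by split; apply/mem_set; rewrite /= in_itv /=; apply/andP; split; lra.
  rewrite /= !in_itv /= => /andP[h1 h2] /andP[h3 h4]; apply/mem_set; split => /=; lra.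
have inner (s : R) : s \in `]0, t[%classic ->
    \int[mu]_(y in `[x - t + s, x + t - s]) g (s, y) = G s.
  move=> s0; have hs (y : R) : h (s, y) = g (s, y) * \1_(`]x - t + s, x + t - s[%classic) y.
    by rewrite hE [\1_(`]0, t[%classic) s]indicE s0 mul1r.
  rewrite /G /Rintegral; congr fine.
  have mgs : measurable_fun `]x - t + s, x + t - s[ (fun y => (g (s, y))%:E).
    apply: (@eq_measurable_fun _ _ _ _ _ (fun y => (h (s, y))%:E)).
      by move=> y yD; rewrite hs indicE yD mulr1.
    apply: measurable_funTS; apply/measurable_EFinP; apply: (measurableT_comp mh).
    exact: measurable_fun_pair.
  rewrite (integral_itv_bndoo true false mgs).
  rewrite [LHS]integral_mkcond; apply: eq_integral => y _; rewrite hs patchE indicE.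
  by case: ifP => _; rewrite ?mulr1 ?mulr0.
rewrite (Rfubini12 hi) -/G.
transitivity (\int[mu]_(s in `[0, t]) G s).
  rewrite /Rintegral; congr fine.
  have mG' : measurable_fun `]0, t[ (EFin \o G).
    by apply: measurable_funTS; exact/measurable_EFinP.
  rewrite (integral_itv_bndoo true false mG') integral_itv_bndoo; last first.
    apply: (@eq_measurable_fun _ _ _ _ _ (EFin \o G)).
      by move=> s s0; rewrite /= -(inner s s0).
    exact: mG'.
  by apply: eq_integral => s s0; rewrite /= -(inner s s0).
rewrite Rintegral_mkcond; apply: eq_Rintegral => s _; rewrite patchE.
case: ifPn => // s0; transitivity (\int[mu]_(y in setT) (cst 0 y)); first by rewrite Rintegral_cst// mul0r.
apply: eq_Rintegral => y _; rewrite hE [\1_(`]0, t[%classic) s]indicE.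
suff -> : (s \in `]0, t[%classic) = false by rewrite mul0r mulr0.
apply/negP => /set_mem /= h0; apply: (negP s0); apply/mem_set => /=.
by move: h0; rewrite !in_itv /= => /andP[/ltW-> /ltW->].
Qed.

(** The two travelling waves of d'Alembert's formula, cut off outside the base of
    the triangle so as to be integrable on the line. *)
Definition forward_data (c0 d0 : R) (g h : R -> R) (x : R) : R :=
  2^-1 * (g x + \int[mu]_(y in `[c0, x]) h y) * \1_(`[c0, d0]%classic) x.
Definition backward_data (c0 d0 : R) (g h : R -> R) (x : R) : R :=
  2^-1 * (g x - \int[mu]_(y in `[c0, x]) h y) * \1_(`[c0, d0]%classic) x.

Section Data.
Variables (c0 d0 : R) (g h : R -> R).
Hypotheses (cd : c0 <= d0) (cg : {within `[c0, d0], continuous g})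
  (hi : mu.-integrable `[c0, d0]%classic (EFin \o h)).

Let integrable_continuous (k : R -> R) : {within `[c0, d0], continuous k} ->
  mu.-integrable setT (EFin \o (fun x => 2^-1 * k x * \1_(`[c0, d0]%classic) x)).
Proof.
move=> ck; have ki : mu.-integrable `[c0, d0]%classic (EFin \o k).
  by apply: continuous_compact_integrable => //; exact: segment_compact.
rewrite (_ : (fun x => _) = (fun x => 2^-1 * (k x * \1_(`[c0, d0]%classic) x))).
  by apply: integrable_scaler; exact: integrable_extend.
by apply/funext => x; rewrite mulrA.
Qed.

Let continuous_primitive : {within `[c0, d0], continuous (fun x => \int[mu]_(y in `[c0, x]) h y)}.
Proof. exact: parameterized_integral_continuous. Qed.

Lemma integrable_forward_data : mu.-integrable setT (EFin \o forward_data c0 d0 g h).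
Proof.
by apply: integrable_continuous => x; apply: cvgD; [exact: cg|exact: continuous_primitive].
Qed.

Lemma integrable_backward_data : mu.-integrable setT (EFin \o backward_data c0 d0 g h).
Proof.
by apply: integrable_continuous => x; apply: cvgB; [exact: cg|exact: continuous_primitive].
Qed.

Lemma dalembert (a b : R) : c0 < a -> a < b -> b < d0 ->
  2^-1 * (g b + g a) + 2^-1 * \int[mu]_(y in `[a, b]) h y =
  forward_data c0 d0 g h b + backward_data c0 d0 g h a.
Proof.
move=> ca ab bd; have cb := lt_trans ca ab; have ad := lt_trans ab bd.
rewrite /forward_data /backward_data !indicE !mem_set ?mulr1; last 2 first.
- by rewrite /= in_itv /= !ltW.
- by rewrite /= in_itv /= !ltW.
have hib : mu.-integrable `[c0, b]%classic (EFin \o h).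
  by apply: integrableS hi => //; apply: subset_itvl; rewrite bnd_simp ltW.
have := @Rintegral_itvB R h (BLeft c0) (BRight b) a hib.
rewrite !bnd_simp => /(_ (ltW ca) (ltW ab)).
rewrite Rintegral_itv_obnd_cbnd; last first.
  by apply: integrableS hib => //; apply: subset_itvr; rewrite bnd_simp ltW.
by move=> <-; ring.
Qed.

End Data.

(** D'Alembert's formula in characteristic coordinates; 1/4 is the product of the
    factor 1/2 of the source term and of the Jacobian 1/2. *)
Lemma mild_representation (n : nat) (M : set 'rV[R]_n) Gamma P (K : set (R * R))
    (u0 v0 : R -> 'rV[R]_n) (f u ut ux : R * R -> 'rV[R]_n) (t0 x0 : R) (i : 'I_n) :
  trapezoid K -> K (t0, x0) -> 0 < t0 -> L11 (base K) M u0 v0 ->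
  mild_solution M Gamma P K u0 v0 f u ut ux ->
  let F (z : plane) := wave_map_rhs Gamma P f u ut ux (of_null z) ord0 i *
    \1_(null_triangle (x0 - t0) (x0 + t0)) z in
  let al := forward_data (x0 - t0) (x0 + t0) (fun x => u0 x ord0 i) (fun x => v0 x ord0 i) in
  let be := backward_data (x0 - t0) (x0 + t0) (fun x => u0 x ord0 i) (fun x => v0 x ord0 i) in
  [/\ mu.-integrable setT (EFin \o al), mu.-integrable setT (EFin \o be),
      (area R).-integrable setT (EFin \o F) &
      forall z, null_triangle (x0 - t0) (x0 + t0) z ->
        u (of_null z) ord0 i = al z.1 + be z.2 + 4^-1 * triangle_integral F z].
Proof.
move=> Ktr Kz t00 data mild F al be.
have BK : backward_triangle t0 x0 `<=` K by case: Ktr => _ _ _ _; apply.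
have [_ _ _ _ mildE] := mild.
pose g (z : plane) := wave_map_rhs Gamma P f u ut ux z ord0 i.
have open_integrable t x : K (t, x) -> 0 < t ->
   (area R).-integrable setT (EFin \o (fun z : plane =>
    g z * \1_(null_triangle (x - t) (x + t)) (to_null z))).
  move=> Ktx t1; have [/(_ i) gi _] := mildE _ _ Ktx.
  have mT : measurable (@to_null R @^-1` null_triangle (x - t) (x + t) : set plane).
    rewrite -[X in measurable X]setTI; apply: measurable_to_null => //.
    exact: measurable_null_triangle.
  have gT : (area R).-integrable (@to_null R @^-1` null_triangle (x - t) (x + t)) (EFin \o g).
    apply: integrableS gi => //; first exact: measurable_backward_triangle.
    by move=> z /(null_triangle_backward t1); rewrite to_nullK.
  exact: (integrable_extend mT gT).
have baseI : `[x0 - t0, x0 + t0]%classic `<=` base K.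
  move=> y /=; rewrite in_itv /= => yI; apply: BK; rewrite backward_triangleE//=.
  by rewrite addr0 subr0.
have [cu0 _ _ v0i] := data.
have cd : x0 - t0 <= x0 + t0 by lra.
have cg : {within `[x0 - t0, x0 + t0], continuous (fun x => u0 x ord0 i)}.
  have cu := continuous_subspaceW baseI cu0.
  by move=> x; apply: (continuous_cvg _ (@coord_continuous _ _ _ ord0 i _)); exact: cu.
have hi : mu.-integrable `[x0 - t0, x0 + t0]%classic (EFin \o (fun x => v0 x ord0 i)).
  apply: integrableS (v0i i) => //.
  apply: closed_measurable; apply: (closed_comp (f := fun x : R => (0 : R, x))).
    by move=> y _; apply: (@cvg_pair _ _ _ _ (nbhs (0 : R)) (nbhs y)); [exact: cvg_cst|exact: cvg_id].
  by case: Ktr.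
have Fi : (area R).-integrable setT (EFin \o F).
  have := (integrable_of_null _).1 (open_integrable _ _ Kz t00).
  by congr (_.-integrable _ _); apply/funext => z /=; rewrite of_nullK.
split=> //.
- exact: integrable_forward_data.
- exact: integrable_backward_data.
move=> [b a] zT; have [/= ca ab bd] := zT.
have Kba : K (of_null (b, a)) by apply: BK; exact: null_triangle_backward.
have tpos : 0 < (b - a) / 2 by lra.
have [_ /(_ i) uE] := mildE _ _ Kba.
have oi := open_integrable _ _ Kba tpos.
rewrite [LHS]uE (iterated_triangle_integral oi).
have E1 : (b + a) / 2 + (b - a) / 2 = b by field.
have E2 : (b + a) / 2 - (b - a) / 2 = a by field.
rewrite /= E1 E2 in oi *.
have dal : 2^-1 * (u0 b ord0 i + u0 a ord0 i) + 2^-1 * \int[mu]_(y in `[a, b]) v0 y ord0 i =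
    al b + be a := dalembert (fun x => u0 x ord0 i) hi ca ab bd.
rewrite dal; congr (_ + _).
have -> : triangle_integral F (b, a) = 2 * \int[area R]_z (g z * \1_(null_triangle a b) (to_null z)).
  rewrite -(Rintegral_of_null oi); apply: eq_Rintegral => z _.
  rewrite of_nullK /F /= -mulrA; congr (_ * _).
  rewrite !indicE; have [/set_mem [h1 h2 h3]|_] := boolP (z \in null_triangle a b); last by rewrite mulr0.
  by rewrite mem_set ?mulr1//; split => //; [exact: lt_trans h1|exact: lt_trans bd].
by rewrite mulrA; congr (_ * _); field.
Qed.

End MildFormulation.

(** * The difference of two right-hand sides *)

Section RightHandSide.
Variables (R : realType) (n : nat).

Lemma entry_le_norm k l (A : 'M[R]_(k, l)) i j : `|A i j| <= `|A|.
Proof.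
have -> : `|A| = \big[Num.max/0]_ij `|A ij.1 ij.2| by rewrite -mx_normrE.
by have := @le_bigmax _ _ _ 0 (fun ij : 'I_k * 'I_l => `|A ij.1 ij.2|) (i, j).
Qed.

Lemma norm_le_entries k l (A : 'M[R]_(k, l)) w : 0 <= w ->
  (forall i j, `|A i j| <= w) -> `|A| <= w.
Proof.
move=> w0 Aw; have -> : `|A| = \big[Num.max/0]_ij `|A ij.1 ij.2| by rewrite -mx_normrE.
by apply/bigmax_leP; split => // ij _; exact: Aw.
Qed.

Lemma lipschitz_const (V W : normedModType R) (g : V -> W) :
  lipschitz g -> exists2 C, 0 <= C & forall x y, `|g x - g y| <= C * `|x - y|.
Proof.
by move=> /pinfty_ex_gt0[C C0 H]; exists C; [exact: ltW|move=> x y; exact: (H (x, y))].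
Qed.

Lemma bounded_const (V W : normedModType R) (g : V -> W) :
  [bounded g x | x in setT] -> exists2 C, 0 <= C & forall x, `|g x| <= C.
Proof.
by move=> /pinfty_ex_gt0[C C0 H]; exists C; [exact: ltW|move=> x; exact: H].
Qed.

Lemma uniform_const (T : finType) (Q : T -> R -> Prop) :
  (forall t (x y : R), x <= y -> Q t x -> Q t y) ->
  (forall t, exists2 C, 0 <= C & Q t C) -> exists2 C, 0 <= C & forall t, Q t C.
Proof.
move=> Qmono QC; have [C HC] := choice (fun t => let: ex_intro2 C C0 QC := QC t in ex_intro _ C (conj C0 QC)).
exists (\sum_t C t); first by apply: sumr_ge0 => t _; case: (HC t).
move=> t; apply: (Qmono t (C t)); last by case: (HC t).
by rewrite (bigD1 t)//= lerDl; apply: sumr_ge0 => s _; case: (HC s).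
Qed.

(** One factor changes at a time. *)
Lemma triple_product_le (a1 a2 b1 b2 g1 g2 A B G da db dg : R) :
  `|b1| <= B -> `|a2| <= A -> `|b2| <= B -> `|g1| <= G ->
  `|a1 - a2| <= da -> `|b1 - b2| <= db -> `|g1 - g2| <= dg ->
  `|a1 * b1 * g1 - a2 * b2 * g2| <= G * (da * B) + G * (A * db) + dg * (A * B).
Proof.
move=> b1B a2A b2B g1G da' db' dg'.
rewrite (_ : _ - _ = g1 * ((a1 - a2) * b1) + g1 * (a2 * (b1 - b2)) + (g1 - g2) * (a2 * b2)); last by ring.
apply: (le_trans (ler_normD _ _)); apply: lerD; last first.
  by rewrite !normrM; apply: ler_pM => //; apply: ler_pM.
apply: (le_trans (ler_normD _ _)); apply: lerD;
  by rewrite !normrM; apply: ler_pM => //; apply: ler_pM.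
Qed.

(** In characteristic coordinates every product in the null form couples one
    derivative [p = ut + ux] with one derivative [q = ut - ux]; its variation is
    therefore controlled without any product of two derivatives of the same
    family. *)
Lemma wave_map_rhs_difference (M : set 'rV[R]_n)
    (Gamma : 'I_n -> 'I_n -> 'rV[R]_n -> 'rV[R]_n) (P : 'rV[R]_n -> 'M[R]_n) :
  wave_map_coefficients M Gamma P ->
  exists2 C, 0 <= C &
    forall (f u1 ut1 ux1 u2 ut2 ux2 : R * R -> 'rV[R]_n) z (A B w dp dq phi : R) i,
      0 <= w ->
      (forall j, `|u1 z ord0 j - u2 z ord0 j| <= w) ->
      (forall j, `|ut1 z ord0 j + ux1 z ord0 j| <= A /\ `|ut2 z ord0 j + ux2 z ord0 j| <= A) ->
      (forall j, `|ut1 z ord0 j - ux1 z ord0 j| <= B /\ `|ut2 z ord0 j - ux2 z ord0 j| <= B) ->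
      (forall j, `|(ut1 z ord0 j + ux1 z ord0 j) - (ut2 z ord0 j + ux2 z ord0 j)| <= dp) ->
      (forall j, `|(ut1 z ord0 j - ux1 z ord0 j) - (ut2 z ord0 j - ux2 z ord0 j)| <= dq) ->
      (forall j, `|f z ord0 j| <= phi) ->
      `|wave_map_rhs Gamma P f u1 ut1 ux1 z ord0 i - wave_map_rhs Gamma P f u2 ut2 ux2 z ord0 i|
        <= C * (w * (A * B + phi) + dp * B + dq * A).
Proof.
move=> [HG [HPl _] _ _].
have [G G0 HGb] : exists2 C, 0 <= C & forall t : 'I_n * 'I_n, forall x, `|Gamma t.1 t.2 x| <= C.
  apply: uniform_const; first by move=> t x y xy H z; exact: le_trans (H z) xy.
  by move=> t; apply: bounded_const; case: (HG t.1 t.2).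
have [L L0 HGl] : exists2 C, 0 <= C & forall t : 'I_n * 'I_n,
    forall x y, `|Gamma t.1 t.2 x - Gamma t.1 t.2 y| <= C * `|x - y|.
  apply: uniform_const; first by move=> t x y xy H a b; apply: (le_trans (H a b)); exact: ler_wpM2r.
  by move=> t; apply: lipschitz_const; case: (HG t.1 t.2).
have [Lp Lp0 HP] := lipschitz_const HPl.
pose N := n%:R : R.
have N0 : 0 <= N by exact: ler0n.
exists (N * N * (G + L) + N * Lp).
  by rewrite addr_ge0// !mulr_ge0// addr_ge0.
move=> f u1 ut1 ux1 u2 ut2 ux2 z A B w dp dq phi i w0 Hw HA HB Hdp Hdq Hphi.
pose p1 j := ut1 z ord0 j + ux1 z ord0 j; pose q1 j := ut1 z ord0 j - ux1 z ord0 j.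
pose p2 j := ut2 z ord0 j + ux2 z ord0 j; pose q2 j := ut2 z ord0 j - ux2 z ord0 j.
pose g1 j k := Gamma j k (u1 z) ord0 i; pose g2 j k := Gamma j k (u2 z) ord0 i.
have rhsE (u ut ux : R * R -> 'rV[R]_n) : wave_map_rhs Gamma P f u ut ux z ord0 i =
    \sum_(j < n) \sum_(k < n) 2^-1 *
     ((ut z ord0 j + ux z ord0 j) * (ut z ord0 k - ux z ord0 k) * Gamma j k (u z) ord0 i +
      (ut z ord0 k + ux z ord0 k) * (ut z ord0 j - ux z ord0 j) * Gamma j k (u z) ord0 i) +
    \sum_(k < n) f z ord0 k * P (u z) k i.
  rewrite /wave_map_rhs mxE; congr (_ + _); last by rewrite mxE.
  rewrite summxE; apply: eq_bigr => j _; rewrite summxE; apply: eq_bigr => k _.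
  by rewrite mxE; field.
have uw : `|u1 z - u2 z| <= w.
  by apply: norm_le_entries => // a j; rewrite ord1 !mxE; exact: Hw.
have gd j k : `|g1 j k - g2 j k| <= L * w.
  have := HGl (j, k) (u1 z) (u2 z); have := entry_le_norm (Gamma j k (u1 z) - Gamma j k (u2 z)) ord0 i.
  rewrite !mxE => h1 h2; apply: (le_trans h1); apply: (le_trans h2); exact: ler_wpM2l.
have gb j k : `|g1 j k| <= G.
  apply: le_trans (HGb (j, k) (u1 z)); exact: entry_le_norm.
rewrite !rhsE.
have -> : forall a b c d : R, a + b - (c + d) = (a - c) + (b - d) by move=> *; ring.
rewrite -!sumrB.
apply: (le_trans (ler_normD _ _)).
have A0 : 0 <= A by apply: le_trans (HA i).1.
have B0 : 0 <= B by apply: le_trans (HB i).1.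
have phi0 : 0 <= phi by apply: le_trans (Hphi i).
have dp0 : 0 <= dp by apply: le_trans (Hdp i).
have dq0 : 0 <= dq by apply: le_trans (Hdq i).
have cst_sum (F : 'I_n -> R) c : (forall j, `|F j| <= c) -> `|\sum_j F j| <= N * c.
  move=> Fc; apply: (le_trans (ler_norm_sum _ _ _)).
  apply: (le_trans (ler_sum _ (fun j _ => Fc j))).
  by rewrite sumr_const card_ord -[leLHS]mulr_natl.
have b1 : `|\sum_(j < n) (\sum_(k < n) 2^-1 * (p1 j * q1 k * g1 j k + p1 k * q1 j * g1 j k) -
     \sum_(k < n) 2^-1 * (p2 j * q2 k * g2 j k + p2 k * q2 j * g2 j k))|
    <= N * (N * (G * (dp * B) + G * (A * dq) + L * w * (A * B))).
  apply: (cst_sum _ _) => j; rewrite -sumrB; apply: (cst_sum _ _) => k.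
  have t1 := triple_product_le (HB k).1 (HA j).2 (HB k).2 (gb j k) (Hdp j) (Hdq k) (gd j k).
  have t2 := triple_product_le (HB j).1 (HA k).2 (HB j).2 (gb j k) (Hdp k) (Hdq j) (gd j k).
  rewrite -mulrBr normrM ger0_norm//.
  rewrite ler_pdivrMl//.
  rewrite (_ : _ - _ = (p1 j * q1 k * g1 j k - p2 j * q2 k * g2 j k) +
      (p1 k * q1 j * g1 j k - p2 k * q2 j * g2 j k)); last by ring.
  apply: (le_trans (ler_normD _ _)); apply: (le_trans (lerD t1 t2)).
  by rewrite [leRHS]mulr_natl mulr2n.
have b2 : `|\sum_(k < n) (f z ord0 k * P (u1 z) k i - f z ord0 k * P (u2 z) k i)|
    <= N * (phi * (Lp * w)).
  apply: cst_sum => k; rewrite -mulrBr normrM; apply: ler_pM => //.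
  have := entry_le_norm (P (u1 z) - P (u2 z)) k i; rewrite !mxE => h1.
  apply: (le_trans h1); apply: (le_trans (HP _ _)); exact: ler_wpM2l.
apply: (le_trans (lerD b1 b2)).
have e1 : 0 <= N * N * G * w * (A * B) by rewrite !mulr_ge0.
have e2 : 0 <= N * N * (G + L) * w * phi by rewrite !mulr_ge0// addr_ge0.
have e3 : 0 <= N * N * L * (dp * B + dq * A) by rewrite !mulr_ge0// addr_ge0// mulr_ge0.
have e4 : 0 <= N * Lp * (w * (A * B) + dp * B + dq * A).
  by rewrite !mulr_ge0// !addr_ge0// !mulr_ge0.
rewrite -subr_ge0.
rewrite (_ : _ - _ = N * N * G * w * (A * B) + N * N * (G + L) * w * phi +
   N * N * L * (dp * B + dq * A) + N * Lp * (w * (A * B) + dp * B + dq * A)); last by ring.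
by rewrite !addr_ge0.
Qed.

End RightHandSide.

(** * Uniqueness in characteristic coordinates *)

Section CharacteristicUniqueness.
Variable R : realType.
Local Notation mu := (@lebesgue_measure R).
Local Notation plane := (measurableTypeR R * measurableTypeR R)%type.

Lemma ae_fst (Q : set R) :
  {ae mu, forall x, Q x} -> {ae area R, forall z, Q z.1}.
Proof.
move=> [N [mN N0 QN]]; exists (N `*` [set: measurableTypeR R]); split.
- exact: measurableX.
- have E : (mu N * mu [set: measurableTypeR R] = 0)%E by rewrite N0 mul0e.
  exact: etrans (product_measure1E mu mu mN measurableT) E.
- by move=> z /= /QN.
Qed.

(** By Fubini, [F] is integrable on almost every characteristic. *)
Lemma ray_integral_ae_bound (F : plane -> R) :
  (area R).-integrable setT (EFin \o F) ->
  exists H : R -> R, [/\ forall x, 0 <= H x, mu.-integrable setT (EFin \o H) &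
    {ae area R, forall z, `|ray_integral F z| <= H z.1}].
Proof.
move=> Fi; have Fn := integrable_norm Fi.
have mF : measurable_fun setT F by exact: measurable_of_integrable Fi.
exists (fun x => \int[mu]_y `|F (x, y)|); split.
- by move=> x; exact: Rintegral_ge0.
- exact: integrable_Rintegral_snd Fn.
apply: (@filterS _ _ (ae_filter_ringOfSetsType (area R)) _ _ _ (ae_fst (ae_integrable1 Fn))).
move=> z iz; rewrite -lee_fin /Rintegral fineK; last exact: integrable_fin_num.
have mFz : measurable_fun [set: measurableTypeR R] (fun y => F (z.1, y)).
  by apply: (measurableT_comp mF); exact: measurable_fun_pair.
have mFzi : measurable_fun [set: measurableTypeR R]
    (fun y => F (z.1, y) * \1_(`]z.2, z.1[%classic) y).
  by apply: measurable_funM => //; exact: measurable_indic.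
apply: (le_trans (abs_Rintegral_le _ mFzi)); apply: ge0_le_integral => //.
- by apply/measurable_EFinP; exact: measurableT_comp.
- by apply/measurable_EFinP; exact: measurableT_comp.
- by move=> y _; rewrite lee_fin normrM ler_piMr// norm_indic_le1.
Qed.

Lemma derivative_bound (c0 d0 c d : R) (al be : R -> R) (U p F : plane -> R) :
  c0 < c -> c < d -> d < d0 -> characteristic_solution c0 d0 al be U p F ->
  exists A : R -> R, [/\ forall x, 0 <= A x, mu.-integrable setT (EFin \o A) &
    {ae area R, forall z, null_triangle c d z -> `|p z| <= A z.1}].
Proof.
move=> cc cd dd sol; have [A0 A0i A0E] := derivative_along_characteristics cc cd dd sol.
have [_ Fi _ _ _] := sol; have [H [H0 Hi HE]] := ray_integral_ae_bound Fi.
exists (fun x => `|A0 x| + H x); split.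
- by move=> x; rewrite addr_ge0.
- exact: (integrable_addr (integrable_norm A0i) Hi).
apply: (@filterS2 _ _ (ae_filter_ringOfSetsType (area R)) _ _ _ _ A0E HE).
move=> z Az Hz zT; rewrite Az//; apply: (le_trans (ler_normD _ _)).
rewrite lerD2l normrM ger0_norm//; apply: le_trans Hz.
by rewrite ler_piMl//; lra.
Qed.

Lemma derivative_bound_mirror (c0 d0 c d : R) (al be : R -> R) (U q F : plane -> R) :
  c0 < c -> c < d -> d < d0 ->
  characteristic_solution (- d0) (- c0) al be (fun z => U (mirror z))
    (fun z => q (mirror z)) (fun z => F (mirror z)) ->
  exists B : R -> R, [/\ forall x, 0 <= B x, mu.-integrable setT (EFin \o B) &
    {ae area R, forall z, null_triangle c d z -> `|q z| <= B z.2}].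
Proof.
move=> cc cd dd sol.
have [|||B [B0 Bi BE]] := @derivative_bound (- d0) (- c0) (- d) (- c) _ _ _ _ _ _ _ _ sol;
  rewrite ?ltrN2//.
exists (fun x => B (- x)); split => //; first exact: integrable_opp.
apply: (@filterS _ _ (ae_filter_ringOfSetsType (area R)) _ _ _ (ae_mirror BE)) => z + [h1 h2 h3].
rewrite mirrorK; apply; split; by rewrite /mirror /= ltrN2.
Qed.

Lemma bigmax_EFin_le n (x : 'I_n -> R) (r : \bar R) : (0 <= r)%E ->
  (forall j, (x j)%:E <= r)%E -> ((\big[Num.max/0]_j x j)%:E <= r)%E.
Proof.
move=> r0 xr; apply: (big_ind (fun y : R => (y%:E <= r)%E)) => // a b ha hb.
by rewrite /Num.max; case: ifP.
Qed.

Lemma ray_integral_le_slice (F G : plane -> R) (z : plane) (c d : R) :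
  measurable_fun setT F -> measurable_fun setT G ->
  null_triangle c d z -> (forall w, null_triangle c d w -> `|F w| <= G w) -> (forall w, 0 <= G w) ->
  (`|ray_integral F z|%:E <= \int[mu]_y (G (z.1, y) * \1_(`]z.2, z.1[%classic) y)%:E)%E /\
  (`|ray_integral (fun w => F (mirror w)) (mirror z)|%:E <=
     \int[mu]_x (G (x, z.2) * \1_(`]z.2, z.1[%classic) x)%:E)%E.
Proof.
move=> mF mG [z1 z2 z3] FG G0.
have m1 (k : plane -> R) : measurable_fun setT k -> measurable_fun [set: measurableTypeR R]
    (fun y => k (z.1, y) * \1_(`]z.2, z.1[%classic) y).
  move=> mk; apply: measurable_funM; last exact: measurable_indic.
  by apply: (measurableT_comp mk); exact: measurable_fun_pair.
have m2 (k : plane -> R) : measurable_fun setT k -> measurable_fun [set: measurableTypeR R]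
    (fun x => k (x, z.2) * \1_(`]z.2, z.1[%classic) x).
  move=> mk; apply: measurable_funM; last exact: measurable_indic.
  by apply: (measurableT_comp mk); exact: measurable_fun_pair.
split.
  apply: (le_trans (abs_Rintegral_le _ (m1 _ mF))); apply: ge0_le_integral => //.
  - by apply/measurable_EFinP; apply: measurableT_comp => //; exact: m1.
  - by apply/measurable_EFinP; exact: m1.
  - move=> y _; rewrite lee_fin indicE; have [|_] := boolP (y \in _); last by rewrite !mulr0 normr0.
    rewrite mem_setE in_itv /= !mulr1 => /andP[y1 y2]; apply: FG; split => //=.
    exact: lt_trans y1.
apply: (le_trans (ray_integral_mirror_le z mF)); apply: ge0_le_integral => //.
- by apply/measurable_EFinP; apply: measurableT_comp => //; exact: m2.
- by apply/measurable_EFinP; exact: m2.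
- move=> x _; rewrite lee_fin indicE; have [|_] := boolP (x \in _); last by rewrite !mulr0 normr0.
  rewrite mem_setE in_itv /= !mulr1 => /andP[y1 y2]; apply: FG; split => //=.
  exact: lt_trans z3.
Qed.

Section Families.
Variables (n : nat) (c0 d0 c d C : R) (phi : plane -> R).
Variables (al be al' be' : 'I_n -> R -> R) (U1 p1 q1 F1 U2 p2 q2 F2 : 'I_n -> plane -> R).
Hypotheses (cc : c0 < c) (cd : c < d) (dd : d < d0) (C0 : 0 <= C)
  (phi0 : forall z, 0 <= phi z) (phii : (area R).-integrable setT (EFin \o phi)).
Hypotheses
  (sp1 : forall i, characteristic_solution c0 d0 (al i) (be i) (U1 i) (p1 i) (F1 i))
  (sp2 : forall i, characteristic_solution c0 d0 (al i) (be i) (U2 i) (p2 i) (F2 i))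
  (sq1 : forall i, characteristic_solution (- d0) (- c0) (al' i) (be' i)
     (fun z => U1 i (mirror z)) (fun z => q1 i (mirror z)) (fun z => F1 i (mirror z)))
  (sq2 : forall i, characteristic_solution (- d0) (- c0) (al' i) (be' i)
     (fun z => U2 i (mirror z)) (fun z => q2 i (mirror z)) (fun z => F2 i (mirror z))).
Hypothesis rhs_le : forall z (A B w dp dq : R), null_triangle c d z ->
  0 <= w -> (forall j, `|U1 j z - U2 j z| <= w) ->
  (forall j, `|p1 j z| <= A /\ `|p2 j z| <= A) ->
  (forall j, `|q1 j z| <= B /\ `|q2 j z| <= B) ->
  (forall j, `|p1 j z - p2 j z| <= dp) -> (forall j, `|q1 j z - q2 j z| <= dq) ->
  forall i, `|F1 i z - F2 i z| <= C * (w * (A * B + phi z) + dp * B + dq * A).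

Let G i (z : plane) := F1 i z - F2 i z.
Let g (z : plane) := (\sum_i `|G i z|) * \1_(null_triangle c d) z.

Let Gi i : (area R).-integrable setT (EFin \o G i).
Proof. by have [_ + _ _ _] := characteristic_solutionB (sp1 i) (sp2 i). Qed.

Let mGi i : measurable_fun setT (G i).
Proof. exact: measurable_of_integrable (Gi i). Qed.

Let gi : (area R).-integrable setT (EFin \o g).
Proof.
apply: integrable_mul_indic; last exact: measurable_null_triangle.
by apply: integrable_sumr => i; exact: (integrable_norm (Gi i)).
Qed.

Let mg : measurable_fun setT g.
Proof. exact: measurable_of_integrable gi. Qed.

Let g0 z : 0 <= g z.
Proof. by rewrite mulr_ge0// sumr_ge0. Qed.

Let G_le_g i z : null_triangle c d z -> `|G i z| <= g z.
Proof.
move=> zT; rewrite /g indicE mem_set// mulr1 (bigD1 i)//= lerDl; exact: sumr_ge0.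
Qed.

Let triI (z : plane) := (\int[area R]_w (g w * \1_(null_triangle z.2 z.1) w)%:E)%E.
Let rowI (z : plane) := (\int[mu]_y (g (z.1, y) * \1_(`]z.2, z.1[%classic) y)%:E)%E.
Let colI (z : plane) := (\int[mu]_x (g (x, z.2) * \1_(`]z.2, z.1[%classic) x)%:E)%E.

Let triI_ge0 z : (0 <= triI z)%E.
Proof. by apply: integral_ge0 => w _; rewrite lee_fin mulr_ge0. Qed.
Let rowI_ge0 z : (0 <= rowI z)%E.
Proof. by apply: integral_ge0 => w _; rewrite lee_fin mulr_ge0. Qed.
Let colI_ge0 z : (0 <= colI z)%E.
Proof. by apply: integral_ge0 => w _; rewrite lee_fin mulr_ge0. Qed.

Let mtri z : measurable_fun setT (\1_(null_triangle z.2 z.1) : plane -> R).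
Proof. by apply: measurable_indic; exact: measurable_null_triangle. Qed.

Let sub_triangle z : null_triangle c d z -> null_triangle z.2 z.1 `<=` null_triangle c d.
Proof.
by move=> [h1 h2 h3] w [k1 k2 k3]; split => //; [exact: lt_trans k1|exact: lt_trans h3].
Qed.

Let half_le (x y : R) : x = 2^-1 * y -> `|x| <= `|y|.
Proof. by move=> ->; rewrite normrM ger0_norm// ler_piMl//; lra. Qed.

Let U_le i z : null_triangle c d z -> (`|U1 i z - U2 i z|%:E <= triI z)%E.
Proof.
move=> zT; have [_ _ + _ _] := characteristic_solutionB (sp1 i) (sp2 i).
have zT0 : null_triangle c0 d0 z.
  by case: zT => h1 h2 h3; split => //; [exact: lt_trans h1|exact: lt_trans dd].
move=> /(_ z zT0) ->; rewrite !add0r.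
have m : measurable_fun setT (fun w => G i w * \1_(null_triangle z.2 z.1) w).
  exact: measurable_funM.
apply: (@le_trans _ _ (`|triangle_integral (G i) z|%:E)).
  by rewrite lee_fin normrM ger0_norm// ler_piMl//; lra.
apply: (le_trans (abs_Rintegral_le _ m)); apply: ge0_le_integral => //.
- by apply/measurable_EFinP; exact: measurableT_comp.
- by apply/measurable_EFinP; exact: measurable_funM.
move=> w _; rewrite lee_fin indicE; have [/set_mem wT|_] := boolP (w \in _).
  by rewrite !mulr1; apply: G_le_g; exact: sub_triangle wT.
by rewrite !mulr0 normr0.
Qed.

Let p_le i : {ae area R, forall z, null_triangle c d z -> (`|p1 i z - p2 i z|%:E <= rowI z)%E}.
Proof.
have := derivative_of_zero_data (characteristic_solutionB (sp1 i) (sp2 i)).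
apply: (@filterS _ _ (ae_filter_ringOfSetsType (area R))) => z h zT.
have zT0 : null_triangle c0 d0 z.
  by case: zT => h1 h2 h3; split => //; [exact: lt_trans h1|exact: lt_trans dd].
have [H _] := ray_integral_le_slice (mGi i) mg zT (G_le_g i) g0.
apply: le_trans H; rewrite lee_fin; apply: half_le; exact: h.
Qed.

Let q_le i : {ae area R, forall z, null_triangle c d z -> (`|q1 i z - q2 i z|%:E <= colI z)%E}.
Proof.
have := ae_mirror (derivative_of_zero_data (characteristic_solutionB (sq1 i) (sq2 i))).
apply: (@filterS _ _ (ae_filter_ringOfSetsType (area R))) => z h zT.
have [_ H] := ray_integral_le_slice (mGi i) mg zT (G_le_g i) g0.
apply: le_trans H; rewrite lee_fin; apply: half_le.
move: h; rewrite mirrorK; apply; case: zT => h1 h2 h3.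
by split; rewrite /mirror /= ltrN2//; [exact: lt_trans dd|exact: lt_trans h1].
Qed.

(** The bound [rhs_le] closes into an integral inequality for [g]: the differences
    of the unknowns and of their derivatives are, up to constants, integrals of [G]
    over the triangle below a point and over the two characteristics that bound
    it. *)
Lemma characteristic_uniqueness z i : null_triangle c d z -> U1 i z = U2 i z.
Proof.
move=> zT.
have [A1 HA1] := choice (fun j => derivative_bound cc cd dd (sp1 j)).
have [A2 HA2] := choice (fun j => derivative_bound cc cd dd (sp2 j)).
have [B1 HB1] := choice (fun j => derivative_bound_mirror cc cd dd (sq1 j)).
have [B2 HB2] := choice (fun j => derivative_bound_mirror cc cd dd (sq2 j)).
pose A x := \sum_j (A1 j x + A2 j x); pose B x := \sum_j (B1 j x + B2 j x).
have sum0 (X Y : 'I_n -> R -> R) : (forall j x, 0 <= X j x) -> (forall j x, 0 <= Y j x) ->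
    forall x, 0 <= \sum_j (X j x + Y j x).
  by move=> X0 Y0 x; apply: sumr_ge0 => j _; rewrite addr_ge0.
have sumi (X Y : 'I_n -> R -> R) : (forall j, mu.-integrable setT (EFin \o X j)) ->
    (forall j, mu.-integrable setT (EFin \o Y j)) ->
    mu.-integrable setT (EFin \o (fun x => \sum_j (X j x + Y j x))).
  by move=> Xi Yi; apply: integrable_sumr => j; exact: integrable_addr.
have sumle (X Y : 'I_n -> R -> R) : (forall j x, 0 <= X j x) -> (forall j x, 0 <= Y j x) ->
    forall j x, X j x <= \sum_j (X j x + Y j x) /\ Y j x <= \sum_j (X j x + Y j x).
  move=> X0 Y0 j x; rewrite (bigD1 j)//=.
  have s0 : 0 <= \sum_(i0 < n | i0 != j) (X i0 x + Y i0 x).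
    by apply: sumr_ge0 => k _; rewrite addr_ge0.
  have := X0 j x; have := Y0 j x; lra.
have A10 j x : 0 <= A1 j x by case: (HA1 j).
have A20 j x : 0 <= A2 j x by case: (HA2 j).
have B10 j x : 0 <= B1 j x by case: (HB1 j).
have B20 j x : 0 <= B2 j x by case: (HB2 j).
have aebounds : {ae area R, forall z, forall j, null_triangle c d z ->
   [/\ `|p1 j z| <= A z.1 /\ `|p2 j z| <= A z.1, `|q1 j z| <= B z.2 /\ `|q2 j z| <= B z.2,
      (`|p1 j z - p2 j z|%:E <= rowI z)%E & (`|q1 j z - q2 j z|%:E <= colI z)%E]}.
  have FF := ae_filter_ringOfSetsType (area R).
  apply: filter_forall => j.
  have [_ _ a1] := HA1 j; have [_ _ a2] := HA2 j.
  have [_ _ b1] := HB1 j; have [_ _ b2] := HB2 j.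
  apply: (@filterS3 _ _ FF _ _ _ _ _ (filterI a1 a2) (filterI b1 b2) (filterI (p_le j) (q_le j))).
  move=> w [h1 h2] [h3 h4] [h5 h6] wT.
  have [k1 k2] := sumle A1 A2 A10 A20 j w.1; have [k3 k4] := sumle B1 B2 B10 B20 j w.2.
  split; last 2 first.
  - exact: h5.
  - exact: h6.
  - by split; [exact: le_trans (h1 wT) k1|exact: le_trans (h2 wT) k2].
  - by split; [exact: le_trans (h3 wT) k3|exact: le_trans (h4 wT) k4].
have A0 : forall x, 0 <= A x := sum0 A1 A2 A10 A20.
have B0 : forall x, 0 <= B x := sum0 B1 B2 B10 B20.
have Ai : mu.-integrable setT (EFin \o A) by apply: sumi => j; [case: (HA1 j)|case: (HA2 j)].
have Bi : mu.-integrable setT (EFin \o B) by apply: sumi => j; [case: (HB1 j)|case: (HB2 j)].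
have nC0 : 0 <= n%:R * C by rewrite mulr_ge0// ler0n.
have g_out w : ~ null_triangle c d w -> g w = 0.
  by move=> wT; rewrite /g indicE memNset// mulr0.
have Ig : (\int[area R]_w (g w)%:E = 0)%E.
  apply: (integral_inequality_zero nC0 A0 B0 phi0 g0 Ai Bi phii gi g_out).
  apply: (@filterS _ _ (ae_filter_ringOfSetsType (area R)) _ _ _ aebounds) => w hw wT.
  pose dw := \big[Num.max/0]_j `|U1 j w - U2 j w|.
  pose dp := \big[Num.max/0]_j `|p1 j w - p2 j w|.
  pose dq := \big[Num.max/0]_j `|q1 j w - q2 j w|.
  have max0 (x : 'I_n -> R) : 0 <= \big[Num.max/0]_j x j by exact: bigmax_ge_id.
  have hG j : `|G j w| <= C * (dw * (A w.1 * B w.2 + phi w) + dp * B w.2 + dq * A w.1).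
    apply: rhs_le => //.
    - exact: max0.
    - by move=> k; exact: (le_bigmax _ (fun k => `|_ k w - _ k w|)).
    - by move=> k; case: (hw k wT).
    - by move=> k; case: (hw k wT).
    - by move=> k; exact: (le_bigmax _ (fun k => `|_ k w - _ k w|)).
    - by move=> k; exact: (le_bigmax _ (fun k => `|_ k w - _ k w|)).
  have hg : g w <= n%:R * C * (dw * (A w.1 * B w.2 + phi w) + dp * B w.2 + dq * A w.1).
    rewrite /g indicE mem_set// mulr1; apply: (le_trans (ler_sum _ (fun j _ => hG j))).
    by rewrite sumr_const card_ord -[leLHS]mulr_natl mulrA.
  apply: (@le_trans _ _ ((n%:R * C)%:E * (dw%:E * (A w.1 * B w.2 + phi w)%:E + dp%:E * (B w.2)%:E + dq%:E * (A w.1)%:E))%E).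
    by rewrite lee_fin.
  have AB0 : (0 <= (A w.1 * B w.2 + phi w)%:E)%E by rewrite lee_fin addr_ge0// mulr_ge0.
  have dw0 : (0 <= dw%:E)%E by rewrite lee_fin; exact: max0.
  have dp0 : (0 <= dp%:E)%E by rewrite lee_fin; exact: max0.
  have dq0 : (0 <= dq%:E)%E by rewrite lee_fin; exact: max0.
  have eA0 : (0 <= (A w.1)%:E)%E by rewrite lee_fin.
  have eB0 : (0 <= (B w.2)%:E)%E by rewrite lee_fin.
  apply: lee_pmul => //.
  - by rewrite !adde_ge0// mule_ge0.
  - apply: leeD; first apply: leeD; apply: lee_pmul => //.
    + by apply: bigmax_EFin_le => [|j]; [exact: triI_ge0|exact: U_le].
    + by apply: bigmax_EFin_le => [|j]; [exact: rowI_ge0|case: (hw j wT)].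
    + by apply: bigmax_EFin_le => [|j]; [exact: colI_ge0|case: (hw j wT)].
have tri0 : (triI z <= 0)%E.
  rewrite -Ig; apply: ge0_le_integral => //.
  - by move=> w _; rewrite lee_fin mulr_ge0.
  - by apply/measurable_EFinP; exact: measurable_funM.
  - exact/measurable_EFinP.
  - move=> w _; rewrite lee_fin ler_piMr//; apply: le_trans (norm_indic_le1 _ _); exact: ler_norm.
have := le_trans (U_le i zT) tri0.
by rewrite lee_fin normr_le0 subr_eq0 => /eqP.
Qed.

End Families.
End CharacteristicUniqueness.

(** * Uniqueness of mild solutions *)

Section MildUniqueness.
Variable R : realType.
Local Notation mu := (@lebesgue_measure R).
Local Notation plane := (measurableTypeR R * measurableTypeR R)%type.

(** Boxes with rational vertices are a countable basis. *)
Lemma open_measurable_plane (O : set (R * R)) : open O -> measurable (O : set plane).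
Proof.
move=> oO.
pose box (q : (rat * rat) * (rat * rat)) : set plane :=
  `]ratr q.1.1, ratr q.1.2[%classic `*` `]ratr q.2.1, ratr q.2.2[%classic.
pose D (n : nat) : set plane :=
  if unpickle n is Some q then (if `[< box q `<=` O >] then box q else set0) else set0.
rewrite (_ : O = \bigcup_n D n).
  apply: bigcupT_measurable => n; rewrite /D; case: (unpickle n) => // q.
  by case: ifP => // _; apply: measurableX; exact: measurable_itv.
apply/seteqP; split => [[x y] Oxy|z [n _]]; last first.
  by rewrite /D; case: (unpickle n) => // q; case: ifP => // /asboolP; exact.
have /nbhs_ballP [e /= e0 He] := open_nbhs_nbhs (conj oO Oxy : open_nbhs _ _).
have [q1 /[!in_itv] /= /andP[l1 r1]] := @rat_in_itvoo R (x - e) x ltac:(lra).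
have [q2 /[!in_itv] /= /andP[l2 r2]] := @rat_in_itvoo R x (x + e) ltac:(lra).
have [q3 /[!in_itv] /= /andP[l3 r3]] := @rat_in_itvoo R (y - e) y ltac:(lra).
have [q4 /[!in_itv] /= /andP[l4 r4]] := @rat_in_itvoo R y (y + e) ltac:(lra).
have [k kK] : exists k : nat, unpickle k = Some ((q1, q2), (q3, q4)).
  by eexists; exact: pickleK.
exists k; first by []; rewrite /D kK ifT; first by split; rewrite /= in_itv /=; apply/andP.
apply/asboolP => -[a b] [/=]; rewrite !in_itv /= => /andP[a1 a2] /andP[b1 b2].
by apply: He; split; rewrite /ball /= ltr_norml; apply/andP; split; lra.
Qed.

Lemma closed_measurable_plane (K : set (R * R)) : closed K -> measurable (K : set plane).
Proof.
by move=> cK; rewrite -[K]setCK; apply: measurableC; apply: open_measurable_plane; exact: closed_openC.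
Qed.

Variables (n : nat) (M : set 'rV[R]_n)
  (Gamma : 'I_n -> 'I_n -> 'rV[R]_n -> 'rV[R]_n) (P : 'rV[R]_n -> 'M[R]_n)
  (GammaP : wave_map_coefficients M Gamma P) (K : set (R * R)) (Ktr : trapezoid K)
  (u0 v0 : R -> 'rV[R]_n) (data : L11 (base K) M u0 v0)
  (f : R * R -> 'rV[R]_n) (fi : integrable_vec (area R) K f)
  (u1 ut1 ux1 u2 ut2 ux2 : R * R -> 'rV[R]_n)
  (mild1 : mild_solution M Gamma P K u0 v0 f u1 ut1 ux1)
  (mild2 : mild_solution M Gamma P K u0 v0 f u2 ut2 ux2).

(** Every point of the open triangle lies in a triangle over a smaller interval, as
    the bounds on derivatives require. *)
Lemma mild_uniqueness_interior t0 x0 : K (t0, x0) -> 0 < t0 ->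
  forall z, null_triangle (x0 - t0) (x0 + t0) z -> u1 (of_null z) = u2 (of_null z).
Proof.
move=> Kz t00 z zT.
set c0 := x0 - t0; set d0 := x0 + t0.
pose T0 := null_triangle c0 d0.
have TK w : null_triangle c0 d0 w -> K (of_null w).
  by case: Ktr => _ _ _ _ BK /(null_triangle_backward t00); exact: BK.
have mT0 : measurable (T0 : set plane) by exact: measurable_null_triangle.
pose F (u ut ux : R * R -> 'rV[R]_n) (i : 'I_n) (w : plane) :=
  wave_map_rhs Gamma P f u ut ux (of_null w) ord0 i * \1_T0 w.
have [C C0 HC] := wave_map_rhs_difference GammaP.
pose phi (w : plane) := (\sum_k `|f (of_null w) ord0 k|) * \1_T0 w.
have phi0 w : 0 <= phi w by rewrite mulr_ge0// sumr_ge0.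
have phii : (area R).-integrable setT (EFin \o phi).
  have mK : measurable (K : set plane) by apply: closed_measurable_plane; case: Ktr.
  pose T (w : plane) := to_null w \in T0.
  have mT : measurable (@to_null R @^-1` T0 : set plane).
    by rewrite -[X in measurable X]setTI; exact: measurable_to_null.
  have fk k : (area R).-integrable setT (EFin \o (fun w : plane => `|f (of_null w) ord0 k| * \1_T0 w)).
    have fT : (area R).-integrable (@to_null R @^-1` T0) (EFin \o (fun w => f w ord0 k)).
      by apply: integrableS (fi k) => // w /TK; rewrite to_nullK.
    have fT' := integrable_extend mT fT.
    have := integrable_norm ((integrable_of_null _).1 fT').
    congr (_.-integrable _ _); apply/funext => w; congr EFin; rewrite /= normrM; congr (_ * _).
    rewrite ger0_norm// !indicE; congr (nat_of_bool _)%:R.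
    apply/idP/idP => /set_mem h; apply/mem_set.
      have : T0 (to_null (of_null w)) by exact: h.
      by rewrite of_nullK.
    by change (T0 (to_null (of_null w))); rewrite of_nullK.
  rewrite (_ : phi = (fun w => \sum_k (`|f (of_null w) ord0 k| * \1_T0 w))).
    exact: integrable_sumr.
  by apply/funext => w; rewrite /phi mulr_suml.
pose c := (c0 + z.2) / 2; pose d := (z.1 + d0) / 2.
have [zT1 zT2 zT3] : [/\ c0 < z.2, z.2 < z.1 & z.1 < d0] by [].
have cc : c0 < c by rewrite /c; lra.
have cd : c < d by rewrite /c /d; lra.
have dd : d < d0 by rewrite /d; lra.
have zT' : null_triangle c d z by split => //; rewrite /c /d; lra.
have [_ wt1 wx1 _ _] := mild1; have [_ wt2 wx2 _ _] := mild2.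
apply/rowP => i.
have rep1 j := mild_representation j Ktr Kz t00 data mild1.
have rep2 j := mild_representation j Ktr Kz t00 data mild2.
pose al j := forward_data c0 d0 (fun x => u0 x ord0 j) (fun x => v0 x ord0 j).
pose be j := backward_data c0 d0 (fun x => u0 x ord0 j) (fun x => v0 x ord0 j).
have sp1 j : characteristic_solution c0 d0 (al j) (be j) (fun w => u1 (of_null w) ord0 j)
    (fun w => ut1 (of_null w) ord0 j + ux1 (of_null w) ord0 j) (F u1 ut1 ux1 j).
  by have [a1 a2 a3 a4] := rep1 j; exact: (characteristic_solution_p TK wt1 wx1 a1 a2 a3 a4).
have sp2 j : characteristic_solution c0 d0 (al j) (be j) (fun w => u2 (of_null w) ord0 j)
    (fun w => ut2 (of_null w) ord0 j + ux2 (of_null w) ord0 j) (F u2 ut2 ux2 j).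
  by have [a1 a2 a3 a4] := rep2 j; exact: (characteristic_solution_p TK wt2 wx2 a1 a2 a3 a4).
pose q1 j (w : plane) := ut1 (of_null w) ord0 j - ux1 (of_null w) ord0 j.
pose q2 j (w : plane) := ut2 (of_null w) ord0 j - ux2 (of_null w) ord0 j.
have sq1 j : characteristic_solution (- d0) (- c0) (fun x => be j (- x)) (fun y => al j (- y))
    (fun w => u1 (of_null (mirror w)) ord0 j) (fun w => q1 j (mirror w))
    (fun w => F u1 ut1 ux1 j (mirror w)).
  by have [a1 a2 a3 a4] := rep1 j; exact: (characteristic_solution_q TK wt1 wx1 a1 a2 a3 a4).
have sq2 j : characteristic_solution (- d0) (- c0) (fun x => be j (- x)) (fun y => al j (- y))
    (fun w => u2 (of_null (mirror w)) ord0 j) (fun w => q2 j (mirror w))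
    (fun w => F u2 ut2 ux2 j (mirror w)).
  by have [a1 a2 a3 a4] := rep2 j; exact: (characteristic_solution_q TK wt2 wx2 a1 a2 a3 a4).
apply: (characteristic_uniqueness cc cd dd C0 phi0 phii sp1 sp2 sq1 sq2 _ i zT').
move=> w A B dw dp dq wT dw0 Hw HA HB Hdp Hdq j.
have wT0 : w \in T0.
  by apply/mem_set; case: wT => h1 h2 h3; split => //; [exact: lt_trans h1|exact: lt_trans dd].
rewrite /F /phi indicE wT0 !mulr1; apply: HC => //.
by move=> k; rewrite (bigD1 k)//= lerDl; exact: sumr_ge0.
Qed.

(** A point of positive time is a limit of points inside its backward triangle; at
    time 0 both solutions are given by the data. *)
Lemma mild_uniqueness : forall z, K z -> u1 z = u2 z.
Proof.
move=> [t x] Kz; have [cK _ tK _ BK] := Ktr.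
have [[cu1 _] _ _ _ m1] := mild1; have [[cu2 _] _ _ _ m2] := mild2.
have := tK _ Kz; rewrite /= le_eqVlt => /orP[/eqP t0|t0].
  apply/rowP => i; have [_ /(_ i) ->] := m1 _ _ Kz; have [_ /(_ i) ->] := m2 _ _ Kz.
  by rewrite -t0 !set_itv1 !Rintegral_set1.
pose s (k : nat) : R := t * (1 - k.+2%:R^-1).
have sk k : 0 < s k < t.
  have k0 : 0 < k.+2%:R^-1 :> R by rewrite invr_gt0.
  have k1 : k.+2%:R^-1 < 1 :> R by rewrite invf_lt1// ltr1n.
  by rewrite /s mulr_gt0 ?subr_gt0//= gtr_pMr// ltrBlDr ltrDl.
have Ks k : K (s k, x).
  apply: (BK _ _ Kz); rewrite backward_triangleE//=; case/andP: (sk k) => s0 st.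
  by split; [exact: ltW|apply/andP; split; lra].
have eqs k : u1 (s k, x) = u2 (s k, x).
  case/andP: (sk k) => s0 st.
  have := mild_uniqueness_interior Kz t0 (z := to_null (s k, x)).
  by rewrite to_nullK; apply; split; rewrite /to_null /=; lra.
have scv : (s k, x) @[k --> \oo] --> (t, x).
  apply: (@cvg_pair _ _ _ _ (nbhs t) (nbhs x)); last exact: cvg_cst.
  rewrite -[X in _ --> nbhs X]mulr1 -[X in _ * X]subr0.
  apply: cvgM; first exact: cvg_cst.
  apply: cvgB; first exact: cvg_cst.
  have := @cvg_harmonic R; rewrite -cvg_shiftS; exact.
have lim (u : R * R -> 'rV[R]_n) : {within K, continuous u} -> u (s k, x) @[k --> \oo] --> u (t, x).
  move=> /subspace_continuousP /(_ _ Kz); apply: cvg_comp => A wA.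
  have : \forall k \near \oo, K (s k, x) -> A (s k, x) := scv _ wA.
  by apply: filterS => k /(_ (Ks k)).
have h1 := lim _ cu1; have h2 := lim _ cu2.
have E : (fun k => u2 (s k, x)) = (fun k => u1 (s k, x)) by apply/funext => k; rewrite eqs.
rewrite E in h2; exact: (cvg_unique _ h1 h2).
Qed.

End MildUniqueness.

Theorem theorem6p9 (R : realType) (n m : nat) (M : set 'rV[R]_n)
    (M_compact : compact M) (M_submanifold : submanifold m M)
    (Gamma : 'I_n -> 'I_n -> 'rV[R]_n -> 'rV[R]_n) (P : 'rV[R]_n -> 'M[R]_n)
    (GammaP : wave_map_coefficients M Gamma P)
    (K : set (R * R)) (L : \bar R)
    (K_trapezoid : trapezoid K) (K_unbounded : ~ bounded_set K)
    (K_height : height K = L) (L_gt0 : (0 < L)%E)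
    (u0 v0 : R -> 'rV[R]_n)
    (data_L11 : L11 (base K) M u0 v0)
    (data_compatible : compatible (base K) M u0 v0)
    (f : R * R -> 'rV[R]_n) (f_L1 : integrable_vec (area R) K f)
    (u1 ut1 ux1 u2 ut2 ux2 : R * R -> 'rV[R]_n)
    (u1_H : in_H K L u1 ut1 ux1) (u2_H : in_H K L u2 ut2 ux2)
    (u1_mild : mild_solution M Gamma P K u0 v0 f u1 ut1 ux1)
    (u2_mild : mild_solution M Gamma P K u0 v0 f u2 ut2 ux2) :
  forall z, K z -> u1 z = u2 z.
Proof.
exact: (mild_uniqueness GammaP K_trapezoid data_L11 f_L1 u1_mild u2_mild).
Qed.
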